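(* Let $\mu\in\mathbb{C}\setminus\{-1,-2,-3,\dots\}$ and $\nu\in\mathbb{R}$; for $i=3,4$ assume moreover that $\mu$ is a positive odd integer. Let $j\ge0$ if $i=1,2$ and $j\geq-\mu$ if $i=3,4$. (1) As $x\to0^+$: $\Lambda_{1,j}^{\mu,\nu}(x)=\frac{(\frac{\mu+\nu+2}{2})_j}{j!\,\Gamma(\frac{\mu+2}{2})\Gamma(\frac{\nu+2}{2})}+o(1)$; $\Lambda_{2,j}^{\mu,\nu}(x)=\frac{(\frac{\mu-|\nu|+2}{2})_j}{j!\,\Gamma(\frac{\mu+2}{2})}\times\begin{cases}2^{\nu-1}\Gamma(\frac\nu2)x^{-\nu}+o(x^{-\nu}),&\nu>0,\\ -\log(\frac x2)+o(\log(\frac x2)),&\nu=0,\\ \frac12\Gamma(-\frac\nu2)+o(1),&\nu<0;\end{cases}$ $\Lambda_{3,j}^{\mu,\nu}(x)=\frac{2^{\mu-1}\Gamma(\frac\mu2)(\frac{-\mu+\nu+2}{2})_{j+\mu}}{(j+\mu)!\,\Gamma(\frac{\nu+2}{2})}x^{-\mu}+o(x^{-\mu})$; $\Lambda_{4,j}^{\mu,\nu}(x)=\frac{\Gamma(\frac\mu2)(\frac{-\mu-|\nu|+2}{2})_{j+\mu}}{(j+\mu)!}\times\begin{cases}2^{\mu+\nu-2}\Gamma(\frac\nu2)x^{-\mu-\nu}+o(x^{-\mu-\nu}),&\nu>0,\\ -2^{\mu-1}x^{-\mu}\log(\frac x2)+o(x^{-\mu}\log(\frac x2)),&\nu=0,\\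 2^{\mu-2}\Gamma(-\frac\nu2)x^{-\mu}+o(x^{-\mu}),&\nu<0.\end{cases}$ (2) As $x\to\infty$: $\Lambda_{1,j}^{\mu,\nu}(x)=C_{1,j}^{\mu,\nu}x^{j-\frac{\nu+1}{2}}e^{x}(1+O(\frac1x))$, $\Lambda_{2,j}^{\mu,\nu}(x)=C_{2,j}^{\mu,\nu}x^{j-\frac{\nu+1}{2}}e^{-x}(1+O(\frac1x))$ with constants $C_{1,j}^{\mu,\nu},C_{2,j}^{\mu,\nu}\neq0$, and $\Lambda_{3,j}^{\mu,\nu}(x)=O(x^{j-\frac{\nu+1}{2}}e^{x})$, $\Lambda_{4,j}^{\mu,\nu}(x)=O(x^{j-\frac{\nu+1}{2}}e^{-x})$.
   Context: $(a)_n=a(a+1)\cdots(a+n-1)$ is the Pochhammer symbol. Normalized modified Bessel functions: $\widetilde I_\alpha(z)=(z/2)^{-\alpha}I_\alpha(z)=\sum_{n\ge0}\frac{(z/2)^{2n}}{n!\Gamma(n+\alpha+1)}$, $\widetilde K_\alpha(z)=(z/2)^{-\alpha}K_\alpha(z)$. For $x>0$ and $t$ near $0$ (principal branch of $(1-t)^{-s}$), define $G_1^{\mu,\nu}=(1-t)^{-\frac{\mu+\nu+2}{2}}\widetilde I_{\mu/2}(\tfrac{tx}{1-t})\widetilde I_{\nu/2}(\tfrac{x}{1-t})$, $G_2^{\mu,\nu}=(1-t)^{-\frac{\mu+\nu+2}{2}}\widetilde I_{\mu/2}(\tfrac{tx}{1-t})\widetilde K_{\nu/2}(\tfrac{x}{1-t})$,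 $G_3^{\mu,\nu}=(1-t)^{-\frac{\mu+\nu+2}{2}}\widetilde K_{\mu/2}(\tfrac{tx}{1-t})\widetilde I_{\nu/2}(\tfrac{x}{1-t})$, $G_4^{\mu,\nu}=(1-t)^{-\frac{\mu+\nu+2}{2}}\widetilde K_{\mu/2}(\tfrac{tx}{1-t})\widetilde K_{\nu/2}(\tfrac{x}{1-t})$. $G_1,G_2$ are holomorphic in $t$ near $0$; when $\mu$ is an odd integer, $G_3,G_4$ are meromorphic at $t=0$. The functions $\Lambda_{i,j}^{\mu,\nu}$ on $\mathbb{R}_+$ ($j\in\mathbb{Z}$) are defined by the Taylor/Laurent expansions $G_i^{\mu,\nu}(t,x)=\sum_{j\in\mathbb{Z}}t^j\Lambda_{i,j}^{\mu,\nu}(x)$ (for $i=3,4$ only when $\mu$ is an odd integer). Thus $\Lambda_{1,j}=\Lambda_{2,j}=0$ for $j<0$ and, for $\mu$ a positive odd integer, $\Lambda_{3,j}=\Lambda_{4,j}=0$ for $j<-\mu$. *)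

(* Defs.v *)
From Stdlib Require Import Reals ZArith.
From Coquelicot Require Import Coquelicot.

Local Open Scope R_scope.

Notation CC := Complex.C.

Definition Cexp (z : CC) : CC :=
  (exp (Re z) * cos (Im z), exp (Re z) * sin (Im z)).

Definition Cpowpos (b : R) (s : CC) : CC := Cexp (Cmult s (RtoC (ln b))).

Definition Clim_seq (u : nat -> CC) : CC :=
  (real (Lim_seq (fun n => Re (u n))), real (Lim_seq (fun n => Im (u n)))).

Definition Cis_series (a : nat -> CC) (l : CC) : Prop :=
  is_series (fun n => Re (a n)) (Re l) /\ is_series (fun n => Im (a n)) (Im l).

Definition Cseries (a : nat -> CC) : CC :=
  (Series (fun n => Re (a n)), Series (fun n => Im (a n))).

Fixpoint poch (a : CC) (n : nat) : CC :=
  match n with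
  | O => RtoC 1
  | S k => Cmult (poch a k) (Cplus a (RtoC (INR k)))
  end.

(* reciprocal Gamma function, 1/Gamma(z), via Gauss' product formula
   1/Gamma(z) = lim_n z(z+1)...(z+n) / (n! n^z); entire, zero at 0,-1,-2,... *)
Definition rgamma (z : CC) : CC :=
  Clim_seq (fun n =>
    Cdiv (poch z (S n))
         (Cmult (RtoC (INR (fact n))) (Cpowpos (INR n) z))).

(* Gamma function (used only at points where it is finite) *)
Definition Gamma (z : CC) : CC := Cinv (rgamma z).

Definition Itilde (alpha : CC) (z : R) : CC :=
  Cseries (fun n =>
    Cmult (RtoC ((z / 2) ^ (2 * n) / INR (fact n)))
          (rgamma (Cplus alpha (RtoC (INR n + 1))))).

(* Macdonald function K_alpha(z), real order, z > 0:
   K_alpha(z) = int_0^oo exp(-z cosh u) cosh(alpha u) du  (DLMF 10.32.9) *)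
Definition BesselK (alpha z : R) : R :=
  RInt_gen (fun u => exp (- z * cosh u) * cosh (alpha * u))
           (at_point 0) (Rbar_locally p_infty).

Definition Ktilde (alpha z : R) : R := Rpower (z / 2) (- alpha) * BesselK alpha z.

Definition pref (mu : CC) (nu t : R) : CC :=
  Cpowpos (1 - t) (Copp (Cdiv (Cplus mu (RtoC (nu + 2))) (RtoC 2))).

Definition G1 (mu : CC) (nu t x : R) : CC :=
  Cmult (pref mu nu t)
    (Cmult (Itilde (Cdiv mu (RtoC 2)) (t * x / (1 - t)))
           (Itilde (RtoC (nu / 2)) (x / (1 - t)))).

Definition G2 (mu : CC) (nu t x : R) : CC :=
  Cmult (pref mu nu t)
    (Cmult (Itilde (Cdiv mu (RtoC 2)) (t * x / (1 - t)))
           (RtoC (Ktilde (nu / 2) (x / (1 - t))))).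

(* For G3, G4 the order mu is real (a positive odd integer in the theorem). *)
Definition G3 (mu nu t x : R) : CC :=
  Cmult (pref (RtoC mu) nu t)
    (Cmult (RtoC (Ktilde (mu / 2) (t * x / (1 - t))))
           (Itilde (RtoC (nu / 2)) (x / (1 - t)))).

Definition G4 (mu nu t x : R) : CC :=
  Cmult (pref (RtoC mu) nu t)
    (RtoC (Ktilde (mu / 2) (t * x / (1 - t)) * Ktilde (nu / 2) (x / (1 - t)))).

(* c : Z -> CC are the Laurent coefficients at t = 0 of G, with pole order at
   most m:  c_j = 0 for j < -m and G(t) = sum_{j >= -m} c_j t^j for all small
   t > 0 (this determines the c_j uniquely). *)
Definition laurent_coeffs (m : nat) (G : R -> CC) (c : Z -> CC) : Prop :=
  (forall j : Z, (j < - Z.of_nat m)%Z -> c j = RtoC 0) /\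
  exists r, 0 < r /\ forall t, 0 < t < r ->
    Cis_series (fun k : nat =>
        Cmult (c (Z.of_nat k - Z.of_nat m)%Z)
              (RtoC (powerRZ t (Z.of_nat k - Z.of_nat m)%Z)))
      (G t).

Definition is_Lambda (m : nat) (G : R -> R -> CC) (Lam : Z -> R -> CC) : Prop :=
  forall x, 0 < x -> laurent_coeffs m (fun t => G t x) (fun j => Lam j x).

Definition small_o_0 (f g : R -> CC) : Prop :=
  forall eps, 0 < eps -> exists d, 0 < d /\
    forall x, 0 < x < d -> Cmod (f x) <= eps * Cmod (g x).

Definition big_O_oo (f g : R -> CC) : Prop :=
  exists M X, forall x, X < x -> Cmod (f x) <= M * Cmod (g x).

(* Main.v *)
(** The coefficients are never summed: an expansion [G(t) = sum_(k<n) c_k t^k + O(t^n)] as [t -> 0+], for all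
    [n], determines the [c_k], so it suffices to expand [G_i] to every finite order.

    With [eta_m(x) = (x/2)^(2m) Z_(nu/2+m)(x)] for [Z = Itilde] ([sg = 1]) or [Z = Ktilde] ([sg = -1]), one has
    [x eta_m' = 2 m eta_m + 2 sg eta_(m+1)]. Hence the coefficients of [(1-t)^(-s) eta_m(x/(1-t))] obey a two-term
    recursion started from [eta_m(x)], and those of [(1-t)^(-s) F(tx/(1-t)) eta_0(x/(1-t))] follow by expanding
    [F] (the factor of order [mu/2]; for [Ktilde] and odd [mu], [z^mu Ktilde_(mu/2)(z)] is smooth at 0) and
    absorbing each [z^n] into the power of [1-t]. Both regimes in [x] propagate through this recursion from the
    behaviour of the [eta_m].

    As [x -> oo], the leading coefficients are those of [exp(sg z) F(z)], which satisfy
    [k (k + mu) g_k = sg (2 k - 1 + mu) g_(k-1)] and so never vanish. For [K] the large-argument behaviour is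
    compared with the half-integer orders, which are explicit; for [I] it comes from the Riccati equation of its
    logarithmic derivative. As [x -> 0], [(x/2)^b K_b(x)] tends to half of Gauss' [Gamma(b)], by squeezing between
    integer moments as in the Bohr-Mollerup theorem. *)

Require Import Defs.
From Stdlib Require Import Reals ZArith.
From Coquelicot Require Import Coquelicot.
From Stdlib Require Import Lra Lia Psatz FunctionalExtensionality.

Local Open Scope R_scope.

(** * Asymptotic expansions at 0+ *)

(** The link between [t] and [x] is an exact identity: at each fixed [x > 0], the coefficient is a
    finite expression [Lc] in [x] and the values [eta_m(x)]. Limits in [x] are thus taken in finite
    expressions, and no uniformity in [t] is required. The power [(x/2)^(2m)] in [eta_m] lets one
    recursion serve both ends. Near 0, if [eta_m ~ e_m g] with [g] like [x^(-2a)], the recursion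
    becomes that of the binomial series of [(1-t)^(2a-s)]; taking [a = nu/2] for K with [nu > 0],
    and [a = 0] otherwise, turns [nu] into [-|nu|] for K. At infinity [eta_(m+1) ~ (x/2) eta_m], so
    each step gains one power of [x], from the raising term alone. The analytic obstacle is that the
    order is an arbitrary real number, while exact information on K exists only at special orders:
    integers near 0, half-integers at infinity. Pointwise inequalities between the integrands carry
    it to all other orders. *)

Lemma Cmod_le_Re_Im (z : CC) : Cmod z <= Rabs (Re z) + Rabs (Im z).
Proof.
  destruct z as [a b]; unfold Cmod; simpl.
  apply Rle_trans with (sqrt ((Rabs a + Rabs b) ^ 2)).
  - apply sqrt_le_1_alt.
    assert (Ha := Rabs_pos a); assert (Hb := Rabs_pos b).
    assert (Ha2 := pow2_abs a); assert (Hb2 := pow2_abs b). simpl in *. nra.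
  - rewrite sqrt_pow2. lra.
    assert (Ha := Rabs_pos a); assert (Hb := Rabs_pos b); lra.
Qed.

Lemma Re_le_Cmod (z : CC) : Rabs (Re z) <= Cmod z.
Proof. apply Rle_trans with (2 := Rmax_Cmod z). apply Rmax_l. Qed.

Lemma Im_le_Cmod (z : CC) : Rabs (Im z) <= Cmod z.
Proof. apply Rle_trans with (2 := Rmax_Cmod z). apply Rmax_r. Qed.

Fixpoint psum (a : nat -> R) (n : nat) (t : R) : R :=
  match n with
  | O => 0
  | S k => psum a k t + a k * t ^ k
  end.

Fixpoint cpsum (a : nat -> CC) (n : nat) (t : R) : CC :=
  match n with
  | O => RtoC 0
  | S k => (cpsum a k t + a k * RtoC (t ^ k))%C
  end.

(** The estimate is one-sided because [laurent_coeffs] constrains only small positive [t]; [M] and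
    [d] may depend on [n]. *)
Definition rexpands (g : R -> R) (a : nat -> R) (n : nat) : Prop :=
  exists M d, 0 < d /\ forall t, 0 < t < d -> Rabs (g t - psum a n t) <= M * t ^ n.

Definition expands (g : R -> CC) (a : nat -> CC) (n : nat) : Prop :=
  exists M d, 0 < d /\ forall t, 0 < t < d -> Cmod (g t - cpsum a n t)%C <= M * t ^ n.

Lemma Re_cpsum a n t : Re (cpsum a n t) = psum (fun k => Re (a k)) n t.
Proof. induction n as [|n IH]; simpl; [reflexivity|]. rewrite <- IH. unfold Re; simpl. ring. Qed.

Lemma Im_cpsum a n t : Im (cpsum a n t) = psum (fun k => Im (a k)) n t.
Proof. induction n as [|n IH]; simpl; [reflexivity|]. rewrite <- IH. unfold Im; simpl. ring. Qed.

Lemma expands_Re_Im g a n :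
  rexpands (fun t => Re (g t)) (fun k => Re (a k)) n ->
  rexpands (fun t => Im (g t)) (fun k => Im (a k)) n -> expands g a n.
Proof.
  intros [M [d [Hd H]]] [M' [d' [Hd' H']]].
  exists (M + M'), (Rmin d d'). split; [now apply Rmin_pos|].
  intros t [Ht0 Ht].
  assert (H1 := Rmin_l d d'). assert (H2 := Rmin_r d d').
  eapply Rle_trans; [apply Cmod_le_Re_Im|].
  specialize (H t ltac:(lra)). specialize (H' t ltac:(lra)).
  replace (Re (g t - cpsum a n t)%C) with (Re (g t) - Re (cpsum a n t)) by reflexivity.
  replace (Im (g t - cpsum a n t)%C) with (Im (g t) - Im (cpsum a n t)) by reflexivity.
  rewrite Re_cpsum, Im_cpsum. lra.
Qed.

Lemma expands_Re g a n : expands g a n ->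
  rexpands (fun t => Re (g t)) (fun k => Re (a k)) n.
Proof.
  intros [M [d [Hd H]]]. exists M, d. split; [easy|]. intros t Ht.
  rewrite <- Re_cpsum.
  eapply Rle_trans; [|apply (H t Ht)].
  apply (Re_le_Cmod (g t - cpsum a n t)%C).
Qed.

Lemma expands_Im g a n : expands g a n ->
  rexpands (fun t => Im (g t)) (fun k => Im (a k)) n.
Proof.
  intros [M [d [Hd H]]]. exists M, d. split; [easy|]. intros t Ht.
  rewrite <- Im_cpsum.
  eapply Rle_trans; [|apply (H t Ht)].
  apply (Im_le_Cmod (g t - cpsum a n t)%C).
Qed.

Lemma expands_RtoC g a n : rexpands g a n ->
  expands (fun t => RtoC (g t)) (fun k => RtoC (a k)) n.
Proof.
  intros H. apply expands_Re_Im; [exact H|].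
  exists 0, 1. split; [lra|]. intros t Ht.
  cbv beta. replace (psum (fun k => Im (RtoC (a k))) n t) with 0.
  { simpl. rewrite Rminus_0_r, Rabs_R0. lra. }
  clear. induction n as [|n IH]; cbn [psum]; [easy|]. rewrite <- IH. simpl. ring.
Qed.

Lemma expands_ext g h a b n d : 0 < d ->
  (forall t, 0 < t < d -> g t = h t) -> (forall k, (k < n)%nat -> a k = b k) ->
  expands g a n -> expands h b n.
Proof.
  intros Hd0 Hg Ha [M [d' [Hd H]]]. exists M, (Rmin d d'). split; [now apply Rmin_pos|].
  intros t Ht. assert (H1 := Rmin_l d d'). assert (H2 := Rmin_r d d').
  rewrite <- Hg by lra.
  replace (cpsum b n t) with (cpsum a n t); [apply H; lra|].
  clear H. induction n as [|n IH]; simpl; [easy|]. rewrite IH, Ha; auto.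
Qed.

Lemma expands_plus g h a b n : expands g a n -> expands h b n ->
  expands (fun t => g t + h t)%C (fun k => a k + b k)%C n.
Proof.
  intros [M [d [Hd H]]] [M' [d' [Hd' H']]].
  exists (M + M'), (Rmin d d'). split; [now apply Rmin_pos|].
  intros t [Ht0 Ht].
  assert (H1 := Rmin_l d d'). assert (H2 := Rmin_r d d').
  specialize (H t ltac:(lra)). specialize (H' t ltac:(lra)).
  assert (E : cpsum (fun k => a k + b k)%C n t = (cpsum a n t + cpsum b n t)%C).
  { clear. induction n as [|n IH]; simpl; [ring|]. rewrite IH. ring. }
  rewrite E.
  replace (g t + h t - (cpsum a n t + cpsum b n t))%C
    with ((g t - cpsum a n t) + (h t - cpsum b n t))%C by ring.
  eapply Rle_trans; [apply Cmod_triangle|]. lra.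
Qed.

Lemma expands_scal c g a n : expands g a n ->
  expands (fun t => c * g t)%C (fun k => c * a k)%C n.
Proof.
  intros [M [d [Hd H]]].
  exists (Cmod c * M), d. split; [easy|].
  intros t Ht. specialize (H t Ht).
  assert (E : cpsum (fun k => c * a k)%C n t = (c * cpsum a n t)%C).
  { clear. induction n as [|n IH]; simpl; [ring|]. rewrite IH. ring. }
  rewrite E.
  replace (c * g t - c * cpsum a n t)%C with (c * (g t - cpsum a n t))%C by ring.
  rewrite Cmod_mult, Rmult_assoc. apply Rmult_le_compat_l; [apply Cmod_ge_0|easy].
Qed.

Definition cshift (a : nat -> CC) (k : nat) : CC :=
  match k with O => RtoC 0 | S j => a j end.

Lemma cpsum_shift a n t : cpsum (cshift a) (S n) t = (RtoC t * cpsum a n t)%C.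
Proof.
  induction n as [|n IH]; [simpl; ring|].
  change (cpsum (cshift a) (S (S n)) t) with (cpsum (cshift a) (S n) t + a n * RtoC (t ^ S n))%C.
  rewrite IH. simpl cpsum. rewrite <- tech_pow_Rmult, RtoC_mult. ring.
Qed.

Lemma expands_shift g a n : expands g a n ->
  expands (fun t => RtoC t * g t)%C (cshift a) (S n).
Proof.
  intros [M [d [Hd H]]].
  exists M, d. split; [easy|]. intros t Ht. specialize (H t Ht).
  rewrite cpsum_shift.
  replace (RtoC t * g t - RtoC t * cpsum a n t)%C with (RtoC t * (g t - cpsum a n t))%C by ring.
  rewrite Cmod_mult, Cmod_R, Rabs_right by lra. simpl.
  replace (M * (t * t ^ n)) with (t * (M * t ^ n)) by ring.
  apply Rmult_le_compat_l; lra.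
Qed.

Lemma expands_pred g a n : expands g a (S n) -> expands g a n.
Proof.
  intros [M [d [Hd H]]]. exists (M + Cmod (a n)), (Rmin d 1). split.
  apply Rmin_pos; lra. intros s Hs.
  assert (H1 := Rmin_l d 1). assert (H2 := Rmin_r d 1).
  specialize (H s ltac:(lra)). simpl in H.
  replace (g s - cpsum a n s)%C with ((g s - (cpsum a n s + a n * RtoC (s ^ n))) + a n * RtoC (s ^ n))%C by ring.
  eapply Rle_trans; [apply Cmod_triangle|].
  rewrite Cmod_mult, Cmod_R, (Rabs_right (s ^ n)) by (apply Rle_ge, pow_le; lra).
  assert (Hp : 0 < s ^ n) by (apply pow_lt; lra).
  assert (HM : 0 <= M). { assert (0 <= M * (s * s ^ n)). eapply Rle_trans; [apply Cmod_ge_0|apply H].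
    assert (0 < s * s ^ n) by (apply Rmult_lt_0_compat; lra). nra. }
  assert (M * (s * s ^ n) <= M * s ^ n).
  { apply Rmult_le_compat_l; [easy|]. rewrite <- (Rmult_1_l (s ^ n)) at 2. apply Rmult_le_compat_r; lra. }
  lra.
Qed.

Lemma expands_le g a n p : (p <= n)%nat -> expands g a n -> expands g a p.
Proof. intros H; induction H; auto. intros H'; apply IHle, expands_pred, H'. Qed.

Lemma expands_perturb g h a n M d : 0 < d ->
  (forall t, 0 < t < d -> Cmod (h t - g t)%C <= M * t ^ n) ->
  expands g a n -> expands h a n.
Proof.
  intros Hd0 Hgh [M' [d' [Hd H]]]. exists (M + M'), (Rmin d d'). split; [now apply Rmin_pos|].
  intros t Ht. assert (H1 := Rmin_l d d'). assert (H2 := Rmin_r d d').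
  specialize (H t ltac:(lra)). specialize (Hgh t ltac:(lra)).
  replace (h t - cpsum a n t)%C with ((h t - g t) + (g t - cpsum a n t))%C by ring.
  eapply Rle_trans; [apply Cmod_triangle|]. lra.
Qed.

Lemma small_eq_0 (x M d : R) : 0 < d -> 0 <= x ->
  (forall t, 0 < t < d -> x <= M * t) -> x = 0.
Proof.
  intros Hd Hx H. destruct (Rle_lt_or_eq_dec _ _ Hx) as [Hp|]; [|easy]. exfalso.
  assert (HM : 0 < M).
  { specialize (H (d/2) ltac:(lra)). assert (0 < d / 2) by lra. nra. }
  assert (Hq : 0 < Rmin (d/2) (x / (2 * M))).
  { apply Rmin_pos; [lra|]. apply Rdiv_lt_0_compat; lra. }
  assert (H1 := Rmin_l (d/2) (x/(2*M))). assert (H2 := Rmin_r (d/2) (x/(2*M))).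
  specialize (H (Rmin (d/2) (x / (2 * M))) ltac:(lra)).
  assert (M * Rmin (d/2) (x / (2 * M)) <= M * (x / (2*M))) by (apply Rmult_le_compat_l; lra).
  replace (M * (x / (2 * M))) with (x / 2) in H0 by (field; lra). lra.
Qed.

(** Strong induction: once the coefficients below [k] agree, subtracting the two expansions of order
    [k + 1] leaves [(a k - b k) t^k = O(t^(k+1))]; dividing by [t^k] and letting [t] tend to 0 gives
    equality. *)
Lemma expands_unique g a b :
  (forall n, expands g a n) -> (forall n, expands g b n) -> forall k, a k = b k.
Proof.
  intros Ha Hb k. induction k as [k IH] using (well_founded_induction lt_wf).
  destruct (Ha (S k)) as [M [d [Hd H]]], (Hb (S k)) as [M' [d' [Hd' H']]].
  assert (E : forall t, cpsum a k t = cpsum b k t).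
  { clear - IH. intros t. assert (forall j, (j <= k)%nat -> cpsum a j t = cpsum b j t); auto.
    induction j as [|j IHj]; intros Hj; simpl; [easy|]. rewrite IHj, IH by lia. easy. }
  assert (E0 : Cmod (a k - b k)%C = 0).
  { apply (small_eq_0 _ (M + M') (Rmin d d')); [now apply Rmin_pos|apply Cmod_ge_0|].
    intros t Ht. assert (H1 := Rmin_l d d'). assert (H2 := Rmin_r d d').
    specialize (H t ltac:(lra)). specialize (H' t ltac:(lra)). simpl in H, H'.
    rewrite E in H.
    assert (Hp : 0 < t ^ k) by (apply pow_lt; lra).
    apply Rmult_le_reg_r with (t ^ k); [easy|].
    rewrite <- (Rabs_right (t ^ k)) at 1 by lra. rewrite <- Cmod_R, <- Cmod_mult.
    replace ((a k - b k) * RtoC (t ^ k))%C with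
      ((g t - (cpsum b k t + b k * RtoC (t ^ k))) + - (g t - (cpsum b k t + a k * RtoC (t ^ k))))%C by ring.
    eapply Rle_trans; [apply Cmod_triangle|]. rewrite Cmod_opp. nra. }
  apply Cmod_eq_0 in E0.
  replace (a k) with ((a k - b k) + b k)%C by ring. rewrite E0. ring.
Qed.

Lemma psum_sum_n a n t : psum a (S n) t = sum_n (fun k => a k * t ^ k) n.
Proof.
  induction n as [|n IH]. rewrite sum_O. simpl. ring.
  rewrite sum_Sn, <- IH. reflexivity.
Qed.

(** Comparison with a geometric series of ratio [q t]; the assumption [q t <= 1/2] bounds
    [1/(1 - q t)] by 2, the source of the factor in the conclusion. *)
Lemma pseries_tail (a : nat -> R) (B q t l : R) (n : nat) :
  (forall k, Rabs (a k) <= B * q ^ k) -> 0 <= q -> 0 <= t -> q * t <= 1 / 2 ->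
  is_series (fun k => a k * t ^ k) l -> Rabs (l - psum a n t) <= 2 * B * (q * t) ^ n.
Proof.
  intros Ha Hq Ht Hqt Hl.
  assert (Hg : is_series (fun k => B * (q * t) ^ n * (q * t) ^ k) (B * (q * t) ^ n * / (1 - q * t))).
  { apply (is_series_scal (K := R_AbsRing) (V := R_NormedModule) (B * (q * t) ^ n)). apply is_series_geom.
    rewrite Rabs_right. lra. apply Rle_ge. apply Rmult_le_pos; lra. }
  assert (Hqt0 : 0 <= q * t) by (apply Rmult_le_pos; lra).
  assert (HB : 0 <= B).
  { specialize (Ha O). simpl in Ha. rewrite Rmult_1_r in Ha. eapply Rle_trans; [apply Rabs_pos|apply Ha]. }
  assert (Hs : is_series (fun k => a (n + k)%nat * t ^ (n + k)) (l - psum a n t)).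
  { destruct n as [|n].
    - simpl. rewrite Rminus_0_r. exact Hl.
    - rewrite psum_sum_n.
      apply (is_series_incr_n (K := R_AbsRing) (V := R_NormedModule) (fun k => a k * t ^ k) (S n)); [lia|].
      simpl pred. match goal with |- is_series _ ?x => replace x with l; [exact Hl|] end.
      match goal with |- _ = plus ?u ?v => change (l = u + sum_n (fun k => a k * t ^ k) n) end. ring. }
  assert (Hb : forall k, Rabs (a (n + k)%nat * t ^ (n + k)) <= B * (q * t) ^ n * (q * t) ^ k).
  { intros k. rewrite Rabs_mult, (Rabs_right (t ^ (n + k))) by (apply Rle_ge, pow_le; lra).
    rewrite Rmult_assoc, <- pow_add, Rpow_mult_distr, <- Rmult_assoc.
    apply Rmult_le_compat_r; [apply pow_le; lra|apply Ha]. }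
  rewrite <- (is_series_unique _ _ Hs).
  eapply Rle_trans.
  { apply Series_Rabs. eapply (ex_series_le (K := R_AbsRing) (V := R_CompleteNormedModule));
      [|exists (B * (q * t) ^ n * / (1 - q * t)); exact Hg].
    intros k. unfold norm; simpl. unfold abs; simpl. rewrite Rabs_Rabsolu. apply Hb. }
  eapply Rle_trans.
  { apply (Series_le _ (fun k => B * (q * t) ^ n * (q * t) ^ k)).
    intros k. split; [apply Rabs_pos|apply Hb].
    exists (B * (q * t) ^ n * / (1 - q * t)); exact Hg. }
  rewrite (is_series_unique _ _ Hg).
  replace (2 * B * (q * t) ^ n) with (B * (q * t) ^ n * 2) by ring.
  apply Rmult_le_compat_l. apply Rmult_le_pos; [easy|now apply pow_le].
  rewrite <- (Rinv_inv 2). apply Rinv_le_contravar; lra.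
Qed.

(** Convergence at the single point [r/2] bounds the terms there, hence [|a_k| <= B (2/r)^k]. On
    [t < r/4] the ratio [(2/r) t] is at most 1/2 and [pseries_tail] applies. *)
Lemma rexpands_series (a : nat -> R) (g : R -> R) r : 0 < r ->
  (forall t, 0 < t < r -> is_series (fun k => a k * t ^ k) (g t)) ->
  forall n, rexpands g a n.
Proof.
  intros Hr H n.
  assert (Hlim := ex_series_lim_0 _ (ex_intro _ _ (H (r / 2) ltac:(lra)))).
  destruct (proj2 (is_lim_seq_spec _ _) Hlim (mkposreal 1 Rlt_0_1)) as [N HN]. simpl in HN.
  assert (HB : exists B, forall k, Rabs (a k * (r / 2) ^ k) <= B).
  { assert (HF : exists B, forall k, (k < N)%nat -> Rabs (a k * (r / 2) ^ k) <= B).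
    { clear. induction N as [|N [B HB]]. exists 0; intros; lia.
      exists (Rmax B (Rabs (a N * (r / 2) ^ N))). intros k Hk.
      destruct (Nat.eq_dec k N) as [->|]; [apply Rmax_r|].
      eapply Rle_trans; [apply HB; lia|apply Rmax_l]. }
    destruct HF as [B HB]. exists (Rmax B 1). intros k.
    destruct (Nat.lt_ge_cases k N) as [Hk|Hk].
    eapply Rle_trans; [now apply HB|apply Rmax_l].
    specialize (HN k Hk). rewrite Rminus_0_r in HN. eapply Rle_trans; [|apply Rmax_r]. lra. }
  destruct HB as [B HB].
  exists (2 * B * (2 / r) ^ n), (r / 4). split; [lra|]. intros t Ht.
  rewrite Rmult_assoc, <- Rpow_mult_distr.
  apply pseries_tail.
  - intros k. specialize (HB k). rewrite Rabs_mult, (Rabs_right ((r / 2) ^ k)) in HB by (apply Rle_ge, pow_le; lra).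
    replace (2 / r) with (/ (r / 2)) by (field; lra). rewrite pow_inv.
    apply Rmult_le_reg_r with ((r / 2) ^ k). apply pow_lt; lra.
    rewrite Rmult_assoc, Rinv_l, Rmult_1_r; [easy|]. apply pow_nonzero; lra.
  - apply Rlt_le, Rdiv_lt_0_compat; lra.
  - lra.
  - apply Rmult_le_reg_r with r; [lra|]. replace (2 / r * t * r) with (2 * t) by (field; lra). lra.
  - apply H. lra.
Qed.

Lemma laurent_expands m G c : laurent_coeffs m G c ->
  forall n, expands (fun t => RtoC (t ^ m) * G t)%C (fun k => c (Z.of_nat k - Z.of_nat m)%Z) n.
Proof.
  intros [_ [r [Hr H]]] n.
  assert (Hp : forall t k, 0 < t ->
     t ^ m * powerRZ t (Z.of_nat k - Z.of_nat m)%Z = t ^ k).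
  { intros t k Ht. rewrite !pow_powerRZ, <- powerRZ_add by lra. f_equal. lia. }
  apply expands_Re_Im; (apply rexpands_series with r; [easy|]; intros t Ht;
    destruct (H t Ht) as [H1 H2]).
  - replace (Re (RtoC (t ^ m) * G t)%C) with (t ^ m * Re (G t)) by (unfold Re; simpl; ring).
    eapply is_series_ext; [|apply (is_series_scal_l (t ^ m) _ _ H1)].
    intros k. rewrite <- (Hp t k) by lra. unfold Re, scal; simpl. unfold mult; simpl. ring.
  - replace (Im (RtoC (t ^ m) * G t)%C) with (t ^ m * Im (G t)) by (unfold Im; simpl; ring).
    eapply is_series_ext; [|apply (is_series_scal_l (t ^ m) _ _ H2)].
    intros k. rewrite <- (Hp t k) by lra. unfold Im, scal; simpl. unfold mult; simpl. ring.
Qed.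

(** For [k = 0] the truncated [pred] does no harm, as the factor [INR 0] vanishes. *)
Fixpoint dpsum (a : nat -> R) (n : nat) (t : R) : R :=
  match n with
  | O => 0
  | S k => dpsum a k t + a k * (INR k * t ^ pred k)
  end.

Lemma is_derive_psum a n t : is_derive (psum a n) t (dpsum a n t).
Proof.
  induction n as [|n IH]; simpl.
  apply (is_derive_const 0).
  apply (is_derive_plus (psum a n) (fun t => a n * t ^ n)); [exact IH|].
  auto_derive; [easy|]. ring.
Qed.

Lemma psum_0 a n : psum a (S n) 0 = a O.
Proof. induction n as [|n IH]. simpl; ring. change (psum a (S n) 0 + a (S n) * 0 ^ S n = a O). rewrite IH. simpl. ring. Qed.

(** The hypothesis is the equation [(1 - t) a' = b] read on coefficients; truncation leaves the
    single defect [- n a_n t^n], of the size of the permitted error. *)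
Lemma dpsum_ode a b n t : (forall k, INR (S k) * a (S k) = INR k * a k + b k) ->
  (1 - t) * dpsum a (S n) t = psum b n t - INR n * a n * t ^ n.
Proof.
  intros H. induction n as [|n IH]. simpl; ring.
  change (dpsum a (S (S n)) t) with (dpsum a (S n) t + a (S n) * (INR (S n) * t ^ n)).
  rewrite Rmult_plus_distr_l, IH.
  change (psum b (S n) t) with (psum b n t + b n * t ^ n).
  replace (b n) with (INR (S n) * a (S n) - INR n * a n) by (rewrite H; ring).
  simpl pow. ring.
Qed.

(** Integration gains one order: the mean value theorem bounds the remainder of [g] by [t] times the
    remainder of its derivative, so order [n] for [h] yields order [n + 1] for [g], once the value
    at 0 is known. *)
Lemma rexpands_ode (g h : R -> R) (a b : nat -> R) (n : nat) :
  (forall t, 0 <= t < 1 -> is_derive g t (h t / (1 - t))) -> g 0 = a O ->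
  (forall k, INR (S k) * a (S k) = INR k * a k + b k) ->
  rexpands h b n -> rexpands g a (S n).
Proof.
  intros Hg Hg0 Hab [M [d [Hd H]]].
  (* [M] accounts for the remainder of [h], the second term for the defect in [dpsum_ode], and 2 for
     [1/(1 - c)] with [c < 1/2]. *)
  exists (2 * (M + Rabs (INR n * a n))), (Rmin d (1 / 2)). split; [apply Rmin_pos; lra|].
  intros t Ht. assert (H1 := Rmin_l d (1 / 2)). assert (H2 := Rmin_r d (1 / 2)).
  destruct (MVT_cor2 (fun t => g t - psum a (S n) t) (fun t => h t / (1 - t) - dpsum a (S n) t) 0 t)
    as [c [Hc Hct]]; [lra| |].
  { intros u Hu. apply is_derive_Reals. apply (is_derive_minus g (psum a (S n))).
    apply Hg; lra. apply is_derive_psum. }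
  rewrite psum_0, Hg0 in Hc.
  replace (g t - psum a (S n) t) with ((h c / (1 - c) - dpsum a (S n) c) * (t - 0)) by lra.
  replace (h c / (1 - c) - dpsum a (S n) c) with
    ((h c - (1 - c) * dpsum a (S n) c) / (1 - c)) by (field; lra).
  rewrite (dpsum_ode a b n c Hab).
  specialize (H c ltac:(lra)).
  rewrite Rminus_0_r, Rabs_mult, (Rabs_right t) by lra.
  unfold Rdiv. rewrite Rabs_mult, (Rabs_right (/ (1 - c))) by (apply Rle_ge, Rlt_le, Rinv_0_lt_compat; lra).
  assert (Hcn : 0 < c ^ n) by (apply pow_lt; lra).
  assert (Hctn : c ^ n <= t ^ n) by (apply pow_incr; lra).
  assert (HM : 0 <= M). { assert (0 <= M * c ^ n). eapply Rle_trans; [apply Rabs_pos|apply H]. nra. }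
  assert (Hi : / (1 - c) <= 2) by (rewrite <- (Rinv_inv 2); apply Rinv_le_contravar; lra).
  assert (Hn : Rabs (h c - (psum b n c - INR n * a n * c ^ n)) <= (M + Rabs (INR n * a n)) * t ^ n).
  { replace (h c - (psum b n c - INR n * a n * c ^ n)) with ((h c - psum b n c) + INR n * a n * c ^ n) by ring.
    eapply Rle_trans; [apply Rabs_triang|]. rewrite (Rabs_mult (INR n * a n)), (Rabs_right (c ^ n)) by lra.
    assert (Hb := Rabs_pos (INR n * a n)).
    apply Rle_trans with ((M + Rabs (INR n * a n)) * c ^ n); [lra|].
    apply Rmult_le_compat_l; lra. }
  change (t ^ S n) with (t * t ^ n).
  replace (2 * (M + Rabs (INR n * a n)) * (t * t ^ n)) with ((M + Rabs (INR n * a n)) * t ^ n * 2 * t) by ring.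
  apply Rmult_le_compat_r; [lra|].
  apply Rmult_le_compat; try easy. apply Rabs_pos. apply Rlt_le, Rinv_0_lt_compat; lra.
Qed.

Lemma rexpands_O g l a : is_derive g 0 l -> rexpands g a 0.
Proof.
  intros H.
  assert (Hc : continuous g 0) by (apply (ex_derive_continuous g); now exists l).
  destruct (proj1 (filterlim_locally _ _) Hc (mkposreal 1 Rlt_0_1)) as [d Hd].
  exists (Rabs (g 0) + 1), d. split; [apply d|]. intros t Ht. simpl. rewrite Rminus_0_r.
  specialize (Hd t). unfold ball in Hd; simpl in Hd. unfold AbsRing_ball, abs, minus, plus, opp in Hd; simpl in Hd.
  assert (Ht' : Rabs (t + - 0) < d) by (rewrite Ropp_0, Rplus_0_r, Rabs_right; lra).
  specialize (Hd Ht'). replace (g t) with (g 0 + (g t + - g 0)) by ring.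
  eapply Rle_trans; [apply Rabs_triang|]. lra.
Qed.

(** * The reciprocal Gamma function *)

Lemma is_lim_seq_Cauchy_rate (u : nat -> R) (D : R) (N : nat) :
  (forall n m, (N <= n)%nat -> (n <= m)%nat -> Rabs (u m - u n) <= D / INR (S n)) ->
  exists l : R, is_lim_seq u l.
Proof.
  intros H.
  assert (HD : 0 <= D).
  { specialize (H N N ltac:(lia) ltac:(lia)).
    assert (0 <= D / INR (S N)) by (eapply Rle_trans; [apply Rabs_pos|apply H]).
    assert (Hn : 0 < INR (S N)) by (apply lt_0_INR; lia).
    replace D with (D / INR (S N) * INR (S N)) by (field; lra). apply Rmult_le_pos; lra. }
  assert (Hc : ex_finite_lim_seq u).
  { apply ex_lim_seq_cauchy_corr. intros eps.
    destruct (nfloor_ex (D / eps)) as [K HK].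
    { apply Rle_mult_inv_pos; [easy|apply eps]. }
    assert (Heps := cond_pos eps).
    assert (Hb : forall n, (max N (S K) <= n)%nat -> D / INR (S n) < eps).
    { intros n Hn. assert (HSn : INR (S K) <= INR n) by (apply le_INR; lia).
      rewrite S_INR in HSn. rewrite S_INR.
      assert (0 <= INR K) by apply pos_INR.
      apply Rmult_lt_reg_r with (INR n + 1); [lra|].
      replace (D / (INR n + 1) * (INR n + 1)) with (D / eps * eps) by (field; lra).
      rewrite (Rmult_comm eps). apply Rmult_lt_compat_r; lra. }
    exists (max N (S K)). intros n m Hn Hm.
    destruct (Nat.le_ge_cases n m) as [Hnm|Hnm].
    - rewrite Rabs_minus_sym. eapply Rle_lt_trans; [apply H; lia|]. apply Hb; lia.
    - eapply Rle_lt_trans; [apply H; lia|]. apply Hb; lia. }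
  exact Hc.
Qed.

Definition Clim (u : nat -> CC) (l : CC) : Prop :=
  is_lim_seq (fun n => Re (u n)) (Re l) /\ is_lim_seq (fun n => Im (u n)) (Im l).

Lemma Clim_seq_unique u l : Clim u l -> Clim_seq u = l.
Proof.
  intros [H1 H2]. unfold Clim_seq.
  rewrite (is_lim_seq_unique _ _ H1), (is_lim_seq_unique _ _ H2). now destruct l.
Qed.

Lemma Clim_ext_loc u v l N : (forall n, (N <= n)%nat -> u n = v n) -> Clim u l -> Clim v l.
Proof.
  intros H [H1 H2]; split; (eapply is_lim_seq_ext_loc; [|eassumption]);
    exists N; intros n Hn; simpl; now rewrite H.
Qed.

Lemma Clim_mult u v l l' : Clim u l -> Clim v l' -> Clim (fun n => u n * v n)%C (l * l')%C.
Proof.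
  intros [H1 H2] [H3 H4]. split.
  - replace (Re (l * l')%C) with (Re l * Re l' - Im l * Im l') by reflexivity.
    apply (is_lim_seq_minus' (fun n => Re (u n) * Re (v n)) (fun n => Im (u n) * Im (v n)));
      now apply is_lim_seq_mult'.
  - replace (Im (l * l')%C) with (Re l * Im l' + Im l * Re l') by reflexivity.
    apply (is_lim_seq_plus' (fun n => Re (u n) * Im (v n)) (fun n => Im (u n) * Re (v n)));
      now apply is_lim_seq_mult'.
Qed.

Lemma Clim_const c : Clim (fun _ => c) c.
Proof. split; apply is_lim_seq_const. Qed.

Lemma Clim_Cmod u l : Clim u l -> is_lim_seq (fun n => Cmod (u n - l)%C) 0.
Proof.
  intros [H1 H2].
  apply (is_lim_seq_le_le (fun _ => 0) _ (fun n => Rabs (Re (u n) - Re l) + Rabs (Im (u n) - Im l))).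
  - intros n. split; [apply Cmod_ge_0|]. apply (Cmod_le_Re_Im (u n - l)%C).
  - apply is_lim_seq_const.
  - replace (Finite 0) with (Rbar_plus (Rabs (Re l - Re l)) (Rabs (Im l - Im l)))
      by (rewrite !Rminus_diag, Rabs_R0; simpl; f_equal; ring).
    apply is_lim_seq_plus'; apply (is_lim_seq_abs (fun n => _ - _) (Finite _));
      apply is_lim_seq_minus'; try assumption; apply is_lim_seq_const.
Qed.

(* [u] is the sequence of partial products of an infinite product with factors [1 + O(1/n^2)]. *)
Lemma Cprod_converges (u : nat -> CC) (C : R) (N : nat) :
  (forall n, (N <= n)%nat -> Cmod (u (S n) - u n)%C <= C / (INR (S n) * INR (S (S n))) * Cmod (u n)) ->
  exists l, Clim u l /\ ((forall n, (N <= n)%nat -> u n <> RtoC 0) -> l <> RtoC 0).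
Proof.
  intros H0.
  assert (exists C', 0 <= C' /\ forall n, (N <= n)%nat -> Cmod (u (S n) - u n)%C <= C' / (INR (S n) * INR (S (S n))) * Cmod (u
    n)) as [C' [HC H]].
  { exists (Rabs C). split; [apply Rabs_pos|]. intros n Hn. eapply Rle_trans; [now apply H0|].
    apply Rmult_le_compat_r; [apply Cmod_ge_0|]. apply Rmult_le_compat_r; [|apply Rle_abs].
    apply Rlt_le, Rinv_0_lt_compat, Rmult_lt_0_compat; apply lt_0_INR; lia. }
  clear H0 C.
  destruct (nfloor_ex (4 * C') ltac:(lra)) as [K HK].
  set (n0 := max N K).
  (* Beyond [n0] the total variation is controlled by the telescoping sum of [C'/((n+1)(n+2))],
     which is at most [C'/(n0 + 1) <= 1/4]. *)
  assert (Hn0 : 4 * C' <= INR (S n0)).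
  { rewrite S_INR. assert (INR K <= INR n0) by (apply le_INR; lia). lra. }
  assert (Hpos : forall n, 0 < INR (S n)) by (intros; apply lt_0_INR; lia).
  assert (Hstep : forall n, C' / (INR (S n) * INR (S (S n))) = C' / INR (S n) - C' / INR (S (S n))).
  { intros n. rewrite (S_INR (S n)). specialize (Hpos n). field. split; lra. }
  set (A := Cmod (u n0)).
  assert (HA : 0 <= A) by apply Cmod_ge_0.
  assert (Hsmall : C' / INR (S n0) <= 1 / 4).
  { apply Rmult_le_reg_r with (INR (S n0)); [apply Hpos|].
    unfold Rdiv at 1. rewrite Rmult_assoc, Rinv_l by (apply Rgt_not_eq, Hpos). lra. }
  assert (Hd0 : forall k, 0 <= C' / INR (S k)) by (intros k; apply Rle_mult_inv_pos; [easy|apply Hpos]).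
  (* Bootstrap: the variation so far is at most [2 A / 4 = A/2], hence [|u| <= 2 A], and that bound
     controls the next increment. *)
  assert (Hind : forall k, Cmod (u (n0 + k)%nat - u n0)%C <= 2 * A * (C' / INR (S n0) - C' / INR (S (n0 + k)))).
  { induction k as [|k IH].
    - rewrite Nat.add_0_r. replace (u n0 - u n0)%C with (RtoC 0) by ring. rewrite Cmod_0. lra.
    - assert (HB : Cmod (u (n0 + k)%nat) <= 2 * A).
      { replace (u (n0 + k)%nat) with ((u (n0 + k)%nat - u n0) + u n0)%C by ring.
        eapply Rle_trans; [apply Cmod_triangle|]. fold A. specialize (Hd0 (n0 + k)%nat). nra. }
      replace (n0 + S k)%nat with (S (n0 + k)) by lia.
      replace (u (S (n0 + k)) - u n0)%C with ((u (S (n0 + k)) - u (n0 + k)%nat) + (u (n0 + k)%nat - u n0))%C by ring.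
      eapply Rle_trans; [apply Cmod_triangle|].
      assert (H1 := H (n0 + k)%nat ltac:(lia)).
      assert (Hp : 0 <= C' / (INR (S (n0 + k)) * INR (S (S (n0 + k))))).
      { apply Rle_mult_inv_pos; [easy|]. apply Rmult_lt_0_compat; apply Hpos. }
      assert (H2 := Rmult_le_compat_l _ _ _ Hp HB).
      rewrite Hstep in H1, H2. lra. }
  assert (HB : forall k, Cmod (u (n0 + k)%nat) <= 2 * A).
  { intros k. replace (u (n0 + k)%nat) with ((u (n0 + k)%nat - u n0) + u n0)%C by ring.
    eapply Rle_trans; [apply Cmod_triangle|]. fold A. specialize (Hd0 (n0 + k)%nat). specialize (Hind k). nra. }
  assert (Hcau : forall n m, (n0 <= n)%nat -> (n <= m)%nat -> Cmod (u m - u n)%C <= 2 * A * C' / INR (S n)).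
  { intros n m Hn Hm.
    assert (Hk : forall k, Cmod (u (n + k)%nat - u n)%C <= 2 * A * (C' / INR (S n) - C' / INR (S (n + k)))).
    { induction k as [|k IH].
      - rewrite Nat.add_0_r. replace (u n - u n)%C with (RtoC 0) by ring. rewrite Cmod_0. lra.
      - replace (n + S k)%nat with (S (n + k)) by lia.
        replace (u (S (n + k)) - u n)%C with ((u (S (n + k)) - u (n + k)%nat) + (u (n + k)%nat - u n))%C by ring.
        eapply Rle_trans; [apply Cmod_triangle|].
        assert (H1 := H (n + k)%nat ltac:(lia)).
        assert (Hp : 0 <= C' / (INR (S (n + k)) * INR (S (S (n + k))))).
        { apply Rle_mult_inv_pos; [easy|]. apply Rmult_lt_0_compat; apply Hpos. }
        assert (HB' := HB (n + k - n0)%nat). replace (n0 + (n + k - n0))%nat with (n + k)%nat in HB' by lia.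
        assert (H2 := Rmult_le_compat_l _ _ _ Hp HB').
        rewrite Hstep in H1, H2. lra. }
    specialize (Hk (m - n)%nat). replace (n + (m - n))%nat with m in Hk by lia.
    specialize (Hd0 m). unfold Rdiv in *. nra. }
  assert (HRe : exists l, is_lim_seq (fun n => Re (u n)) (Finite l)).
  { apply (is_lim_seq_Cauchy_rate _ (2 * A * C') n0). intros n m Hn Hm.
    eapply Rle_trans; [|apply (Hcau n m Hn Hm)]. apply (Re_le_Cmod (u m - u n)%C). }
  assert (HIm : exists l, is_lim_seq (fun n => Im (u n)) (Finite l)).
  { apply (is_lim_seq_Cauchy_rate _ (2 * A * C') n0). intros n m Hn Hm.
    eapply Rle_trans; [|apply (Hcau n m Hn Hm)]. apply (Im_le_Cmod (u m - u n)%C). }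
  destruct HRe as [lr Hr], HIm as [li Hi].
  exists (lr, li). split; [split; assumption|].
  (* The variation after [n0] is at most [A/2], so the moduli stay above [A/2 > 0] and the limit
     cannot vanish. *)
  intros Hnz Hl.
  assert (HA0 : 0 < A) by (apply Cmod_gt_0; apply Hnz; lia).
  assert (Hlim : is_lim_seq (fun n => Cmod (u n - RtoC 0)%C) 0).
  { rewrite <- Hl. apply Clim_Cmod. split; assumption. }
  apply (is_lim_seq_incr_n _ n0) in Hlim.
  assert (Hle := is_lim_seq_le (fun _ => A / 2) (fun n => Cmod (u (n + n0)%nat - RtoC 0)%C) (A / 2) 0).
  cut (Rbar_le (A / 2) 0); [simpl; lra|]. apply Hle; [|apply is_lim_seq_const|exact Hlim].
  intros k. rewrite (Nat.add_comm k).
  replace (u (n0 + k)%nat - RtoC 0)%C with (u (n0 + k)%nat) by ring.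
  assert (Htri : A <= Cmod (u (n0 + k)%nat) + Cmod (u (n0 + k)%nat - u n0)%C).
  { unfold A. replace (u n0) with (u (n0 + k)%nat + - (u (n0 + k)%nat - u n0))%C at 1 by ring.
    eapply Rle_trans; [apply Cmod_triangle|]. rewrite Cmod_opp. lra. }
  specialize (Hind k). specialize (Hd0 (n0 + k)%nat). nra.
Qed.

Lemma exp_taylor1 (x : R) : Rabs x <= 1 / 2 -> Rabs (exp x - 1 - x) <= 2 * x ^ 2.
Proof.
  intros Hx. apply Rabs_le_between in Hx.
  assert (H1 := exp_ineq1_le x). assert (H2 := exp_ineq1_le (- x)).
  rewrite Rabs_right by lra.
  assert (Hm : exp x * exp (- x) = 1) by (rewrite <- exp_plus, Rplus_opp_r; apply exp_0).
  assert (Hp := exp_pos x).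
  assert (exp x * (1 - x) <= 1) by (rewrite <- Hm; apply Rmult_le_compat_l; lra).
  simpl; nra.
Qed.

Lemma Rabs_sin_le (x : R) : Rabs (sin x) <= Rabs x.
Proof.
  assert (H : forall y, 0 < y -> Rabs (sin y) <= y).
  { intros y Hy. destruct (MVT_cor2 sin cos 0 y Hy) as [c [Hc _]].
    intros; apply derivable_pt_lim_sin. rewrite sin_0, !Rminus_0_r in Hc. rewrite Hc.
    rewrite Rabs_mult, (Rabs_right y) by lra.
    assert (Rabs (cos c) <= 1) by (apply Rabs_le, COS_bound). nra. }
  destruct (Rtotal_order x 0) as [Hx|[->|Hx]].
  - rewrite <- (Rabs_Ropp (sin x)), <- sin_neg, (Rabs_left x) by lra. apply H; lra.
  - rewrite sin_0. lra.
  - rewrite (Rabs_right x) by lra. now apply H.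
Qed.

Lemma cos_taylor (x : R) : 0 <= 1 - cos x <= x ^ 2 / 2.
Proof.
  assert (Hb := COS_bound x).
  replace x with (2 * (x / 2)) by lra. rewrite cos_2a_sin.
  assert (H := Rabs_sin_le (x / 2)). apply Rsqr_le_abs_1 in H. unfold Rsqr in H.
  split; [|simpl; nra].
  assert (0 <= sin (x / 2) * sin (x / 2)) by nra. lra.
Qed.

Lemma sin_taylor (x : R) : Rabs (sin x - x) <= Rabs x * x ^ 2 / 2.
Proof.
  assert (H : forall y, 0 < y -> Rabs (sin y - y) <= y * y ^ 2 / 2).
  { intros y Hy. destruct (MVT_cor2 sin cos 0 y Hy) as [c [Hc Hc2]].
    intros; apply derivable_pt_lim_sin. rewrite sin_0, !Rminus_0_r in Hc. rewrite Hc.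
    assert (Hq := cos_taylor c). rewrite Rabs_left1 by nra.
    assert (c ^ 2 <= y ^ 2) by (apply pow_incr; lra). simpl in *. nra. }
  destruct (Rtotal_order x 0) as [Hx|[->|Hx]].
  - rewrite (Rabs_left x) by lra. rewrite <- Rabs_Ropp.
    replace (- (sin x - x)) with (sin (- x) - (- x)) by (rewrite sin_neg; ring).
    replace (x ^ 2) with ((- x) ^ 2) by ring. apply H; lra.
  - rewrite sin_0, !Rminus_0_r, Rabs_R0. lra.
  - rewrite (Rabs_right x) by lra. now apply H.
Qed.

Lemma Cmod_sqr (z : CC) : Cmod z ^ 2 = Re z ^ 2 + Im z ^ 2.
Proof.
  unfold Cmod. rewrite pow2_sqrt; [reflexivity|]. destruct z as [a b]; simpl. nra.
Qed.

Lemma Cexp_taylor1 (z : CC) : Cmod z <= 1 / 2 -> Cmod (Cexp z - RtoC 1 - z)%C <= 10 * Cmod z ^ 2.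
Proof.
  intros Hz. rewrite Cmod_sqr.
  assert (Ha := Re_le_Cmod z). assert (Hb := Im_le_Cmod z).
  destruct z as [a b]; unfold Cexp; simpl Re in *; simpl Im in *.
  eapply Rle_trans; [apply Cmod_le_Re_Im|]. unfold Re, Im; simpl fst; simpl snd.
  assert (He := exp_taylor1 a ltac:(lra)). apply Rabs_le_between in He.
  assert (Ha2 : -(1/2) <= a <= 1/2) by (apply Rabs_le_between; lra).
  assert (Hb2 : -(1/2) <= b <= 1/2) by (apply Rabs_le_between; lra).
  assert (Hc := cos_taylor b). assert (Hs := sin_taylor b).
  assert (Hs2 : Rabs (sin b - b) <= b ^ 2 / 4).
  { eapply Rle_trans; [apply Hs|]. assert (0 <= b ^ 2) by (simpl; nra).
    assert (Rabs b * b ^ 2 <= 1/2 * b ^ 2) by (apply Rmult_le_compat_r; lra). lra. }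
  apply Rabs_le_between in Hs2.
  assert (Hep := exp_pos a). assert (Hu : exp a <= 2) by (simpl in He; nra).
  assert (Hsq : 0 <= b ^ 2) by (simpl; nra). assert (Hsqa : 0 <= a ^ 2) by (simpl; nra).
  assert (H1 : Rabs (exp a * cos b + - (1) + - a) <= 2 * a ^ 2 + b ^ 2).
  { apply Rabs_le. replace (exp a * cos b + - (1) + - a) with ((exp a - 1 - a) - exp a * (1 - cos b)) by ring.
    split; nra. }
  assert (H2 : Rabs (exp a * sin b + -0 + - b) <= 4 * a ^ 2 + 4 * b ^ 2).
  { replace (exp a * sin b + -0 + - b) with (exp a * (sin b - b) + (exp a - 1 - a) * b + a * b) by ring.
    assert (Rabs (exp a * (sin b - b)) <= b ^ 2).
    { rewrite Rabs_mult, (Rabs_right (exp a)) by lra. apply Rabs_le in Hs2. nra. }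
    assert (Rabs ((exp a - 1 - a) * b) <= 2 * a ^ 2).
    { rewrite Rabs_mult. apply Rabs_le in He. assert (0 <= Rabs (exp a - 1 - a)) by apply Rabs_pos.
      assert (0 <= Rabs b <= 1/2) by (split; [apply Rabs_pos|lra]). nra. }
    assert (Rabs (a * b) <= a ^ 2 + b ^ 2) by (apply Rabs_le; split; simpl; nra).
    eapply Rle_trans; [apply Rabs_triang|].
    assert (Ht := Rabs_triang (exp a * (sin b - b)) ((exp a - 1 - a) * b)). lra. }
  lra.
Qed.

Lemma Cexp_plus (z w : CC) : Cexp (z + w)%C = (Cexp z * Cexp w)%C.
Proof.
  destruct z as [a b], w as [c d]. unfold Cexp, Cmult; simpl.
  rewrite exp_plus, cos_plus, sin_plus. f_equal; ring.
Qed.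

Lemma Cexp_0 : Cexp (RtoC 0) = RtoC 1.
Proof. unfold Cexp; simpl. rewrite exp_0, cos_0, sin_0. unfold RtoC. f_equal; ring. Qed.

Lemma Cexp_neq_0 z : Cexp z <> RtoC 0.
Proof.
  intros H. assert (E : (Cexp z * Cexp (- z))%C = RtoC 1).
  { rewrite <- Cexp_plus. replace (z + - z)%C with (RtoC 0) by ring. apply Cexp_0. }
  rewrite H, Cmult_0_l in E. injection E. lra.
Qed.

Lemma Cexp_real (x : R) : Cexp (RtoC x) = RtoC (exp x).
Proof. unfold Cexp; simpl. rewrite cos_0, sin_0. unfold RtoC. f_equal; ring. Qed.

Lemma Cpowpos_real b x : Cpowpos b (RtoC x) = RtoC (Rpower b x).
Proof. unfold Cpowpos. rewrite <- RtoC_mult, Cexp_real. reflexivity. Qed.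

Lemma Cpowpos_plus b s w : Cpowpos b (s + w)%C = (Cpowpos b s * Cpowpos b w)%C.
Proof. unfold Cpowpos. rewrite <- Cexp_plus. f_equal. ring. Qed.

Lemma poch_shift (a : CC) n : poch a (S n) = (a * poch (a + RtoC 1) n)%C.
Proof.
  induction n as [|n IH]; [simpl; ring|].
  change (poch a (S (S n))) with (poch a (S n) * (a + RtoC (INR (S n))))%C.
  rewrite IH. change (poch (a + RtoC 1) (S n)) with (poch (a + RtoC 1) n * (a + RtoC 1 + RtoC (INR n)))%C.
  rewrite S_INR, RtoC_plus. ring.
Qed.

Definition gauss (z : CC) (n : nat) : CC :=
  (poch z (S n) / (RtoC (INR (fact n)) * Cpowpos (INR n) z))%C.

(** The quotient of consecutive terms is [(1 + z/(n+1)) (n/(n+1))^z], whose two factors cancel to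
    first order. *)
Lemma gauss_step (z : CC) (n : nat) : (0 < n)%nat ->
  gauss z (S n) = (gauss z n * (RtoC 1 + z * RtoC (/ INR (S n)))
                   * Cexp (- z * RtoC (ln (INR (S n)) - ln (INR n))))%C.
Proof.
  intros Hn. unfold gauss.
  change (poch z (S (S n))) with (poch z (S n) * (z + RtoC (INR (S n))))%C.
  rewrite fact_simpl, mult_INR, RtoC_mult.
  assert (Hp : Cpowpos (INR n) z = (Cpowpos (INR (S n)) z * Cexp (- z * RtoC (ln (INR (S n)) - ln (INR n))))%C).
  { unfold Cpowpos. rewrite <- Cexp_plus. f_equal. rewrite RtoC_minus. ring. }
  rewrite Hp.
  assert (H1 : RtoC (INR (fact n)) <> RtoC 0).
  { intros E; injection E; apply INR_fact_neq_0. }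
  assert (H2 : INR (S n) <> 0) by (apply not_0_INR; lia).
  assert (H3 : RtoC (INR (S n)) <> RtoC 0) by (intros E; injection E; easy).
  rewrite RtoC_inv by easy.
  field. repeat split; try assumption; apply Cexp_neq_0.
Qed.

(** Both bounds are [1 + y <= exp y], at [y = - ln((n+1)/n)] for the lower one and at
    [y = ln((n+1)/n)] for the upper. *)
Lemma ln_step_bound (n : nat) : (0 < n)%nat ->
  0 <= ln (INR (S n)) - ln (INR n) - / INR (S n) <= / (INR n * INR (S n)).
Proof.
  intros Hn. assert (H : 0 < INR n) by (apply lt_0_INR; lia).
  rewrite <- ln_div by (rewrite ?S_INR; lra). rewrite S_INR.
  split.
  - assert (Hl : ln (INR n / (INR n + 1)) <= INR n / (INR n + 1) - 1).
    { assert (E := exp_ineq1_le (ln (INR n / (INR n + 1)))).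
      rewrite exp_ln in E; [lra|]. apply Rdiv_lt_0_compat; lra. }
    replace (INR n / (INR n + 1)) with (/ ((INR n + 1) / INR n)) in Hl at 1 by (field; lra).
    rewrite ln_Rinv in Hl by (apply Rdiv_lt_0_compat; lra).
    replace (INR n / (INR n + 1) - 1) with (- / (INR n + 1)) in Hl by (field; lra). lra.
  - assert (E := exp_ineq1_le (ln ((INR n + 1) / INR n))).
    rewrite exp_ln in E; [|apply Rdiv_lt_0_compat; lra].
    replace (/ (INR n * (INR n + 1))) with ((INR n + 1) / INR n - 1 - / (INR n + 1)) by (field; lra). lra.
Qed.

(** With [h = 1/(n+1)] and [l = ln(n+1) - ln n = h + O(h^2)], the factor [(1 + z h) exp(- z l)] is
    [1 + O(h^2)], and [h^2] is comparable to [1/((n+1)(n+2))], the form that telescopes in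
    [Cprod_converges]. *)
Lemma gauss_ratio (z : CC) : exists C N, forall n, (N <= n)%nat ->
  Cmod (gauss z (S n) - gauss z n)%C <= C / (INR (S n) * INR (S (S n))) * Cmod (gauss z n).
Proof.
  set (A := Cmod z). assert (HA : 0 <= A) by apply Cmod_ge_0.
  (* For [n >= K + 2] one has [A h <= 1/4], so [|z l| <= 2 A h <= 1/2], the range of
     [Cexp_taylor1]. *)
  destruct (nfloor_ex (4 * A) ltac:(lra)) as [K HK].
  exists (2 * ((1 + A) * (40 * A ^ 2) + 2 * A + 2 * A ^ 2)), (S (S K)). intros n Hn.
  rewrite gauss_step by lia.
  assert (Hl := ln_step_bound n ltac:(lia)).
  set (l := ln (INR (S n)) - ln (INR n)) in *.
  set (e := l - / INR (S n)) in *.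
  assert (HKn : INR K + 2 <= INR n). { apply le_INR in Hn. rewrite !S_INR in Hn. lra. }
  assert (HK0 := pos_INR K).
  set (h := / INR (S n)).
  assert (Hh : 0 < h <= 1) by (unfold h; split; [apply Rinv_0_lt_compat; rewrite S_INR; lra|rewrite <- Rinv_1; apply
    Rinv_le_contravar; rewrite ?S_INR; lra]).
  assert (HSn : INR (S n) = INR n + 1) by apply S_INR.
  assert (Hh2 : / (INR n * INR (S n)) <= 2 * h ^ 2).
  { unfold h. replace (2 * (/ INR (S n)) ^ 2) with (/ (INR (S n) / 2 * INR (S n))) by (field; lra).
    apply Rinv_le_contravar; nra. }
  assert (Hh3 : h ^ 2 <= 2 / (INR (S n) * INR (S (S n)))).
  { unfold h. rewrite (S_INR (S n)). replace ((/ INR (S n)) ^ 2) with (/ (INR (S n) * INR (S n))) by (field; lra).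
    replace (2 / (INR (S n) * (INR (S n) + 1))) with (/ (INR (S n) * ((INR (S n) + 1) / 2))) by (field; lra).
    apply Rinv_le_contravar; nra. }
  assert (Hle : l = h + e) by (unfold e, h; ring).
  assert (Hl2 : 0 <= l <= 2 * h).
  { assert (/ (INR n * INR (S n)) <= h). { unfold h. apply Rinv_le_contravar; nra. } fold h in Hl. lra. }
  assert (Hw : Cmod (- z * RtoC l)%C = A * l).
  { rewrite Cmod_mult, Cmod_opp, Cmod_R, Rabs_right by lra. easy. }
  assert (HAh : A * h <= 1 / 4).
  { unfold h. apply Rmult_le_reg_r with (INR (S n)); [lra|]. rewrite Rmult_assoc, Rinv_l by lra. lra. }
  assert (Hexp := Cexp_taylor1 (- z * RtoC l)%C ltac:(rewrite Hw; nra)). rewrite Hw in Hexp.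
  set (w := Cexp (- z * RtoC l)%C) in *.
  (* [(1+zh) w - 1 = (1+zh)(w - 1 + z l) - z e - z^2 h l] *)
  replace (gauss z n * (RtoC 1 + z * RtoC h) * w - gauss z n)%C with
    (((RtoC 1 + z * RtoC h) * (w - RtoC 1 - (- z * RtoC l)) + - (z * RtoC e) + - (z * z * RtoC h * RtoC l)) * gauss z n)%C
    by (rewrite Hle, RtoC_plus; ring).
  rewrite Cmod_mult. apply Rmult_le_compat_r; [apply Cmod_ge_0|].
  eapply Rle_trans; [apply Cmod_triangle|].
  eapply Rle_trans; [apply Rplus_le_compat_r, Cmod_triangle|].
  rewrite !Cmod_opp, !Cmod_mult, !Cmod_R, (Rabs_right h), (Rabs_right l), (Rabs_right e) by lra. fold A.
  assert (H1 : Cmod (RtoC 1 + z * RtoC h)%C <= 1 + A).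
  { eapply Rle_trans; [apply Cmod_triangle|]. rewrite Cmod_mult, !Cmod_R, Rabs_R1, (Rabs_right h) by lra. fold A. nra. }
  assert (H1p := Cmod_ge_0 (RtoC 1 + z * RtoC h)%C).
  assert (H2 : Cmod (w - RtoC 1 - (- z * RtoC l))%C <= 40 * A ^ 2 * h ^ 2).
  { eapply Rle_trans; [apply Hexp|]. rewrite Rpow_mult_distr.
    assert (l ^ 2 <= 4 * h ^ 2) by (simpl; nra). assert (0 <= A ^ 2) by (simpl; nra). nra. }
  assert (H2p := Cmod_ge_0 (w - RtoC 1 - (- z * RtoC l))%C).
  apply Rle_trans with (((1 + A) * (40 * A ^ 2) + 2 * A + 2 * A ^ 2) * h ^ 2).
  - assert (Cmod (RtoC 1 + z * RtoC h)%C * Cmod (w - RtoC 1 - (- z * RtoC l))%C <= (1 + A) * (40 * A ^ 2 * h ^ 2))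
      by now apply Rmult_le_compat.
    assert (A * e <= A * (2 * h ^ 2)) by (apply Rmult_le_compat_l; lra).
    assert (A * A * h * l <= A * A * h * (2 * h)) by (apply Rmult_le_compat_l; [nra|lra]).
    simpl in *. lra.
  - replace (2 * ((1 + A) * (40 * A ^ 2) + 2 * A + 2 * A ^ 2) / (INR (S n) * INR (S (S n)))) with
         (((1 + A) * (40 * A ^ 2) + 2 * A + 2 * A ^ 2) * (2 / (INR (S n) * INR (S (S n))))) by (unfold Rdiv; ring).
    apply Rmult_le_compat_l; [|easy]. assert (0 <= A ^ 2) by (simpl; nra). nra.
Qed.

Lemma poch_neq_0 (z : CC) n : (forall k : nat, z <> RtoC (- INR k)) -> poch z n <> RtoC 0.
Proof.
  intros H. induction n as [|n IH]; simpl.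
  - intros E; injection E; lra.
  - apply Cmult_neq_0; [exact IH|]. intros E. apply (H n).
    rewrite RtoC_opp. replace z with (z + RtoC (INR n) - RtoC (INR n))%C by ring. rewrite E. ring.
Qed.

Lemma gauss_neq_0 (z : CC) n : (forall k : nat, z <> RtoC (- INR k)) -> gauss z n <> RtoC 0.
Proof.
  intros H E. apply (poch_neq_0 z (S n) H).
  assert (Hd : (RtoC (INR (fact n)) * Cpowpos (INR n) z)%C <> RtoC 0).
  { apply Cmult_neq_0; [|apply Cexp_neq_0]. intros E'; injection E'; apply INR_fact_neq_0. }
  unfold gauss in E.
  replace (poch z (S n)) with (poch z (S n) / (RtoC (INR (fact n)) * Cpowpos (INR n) z) * (RtoC (INR (fact n)) * Cpowpos (INR n) z))%C
    by (field; split; [apply Cexp_neq_0|intros E'; injection E'; apply INR_fact_neq_0]).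
  rewrite E. ring.
Qed.

Lemma rgamma_lim_neq_0 (z : CC) :
  Clim (gauss z) (rgamma z) /\ ((forall k : nat, z <> RtoC (- INR k)) -> rgamma z <> RtoC 0).
Proof.
  destruct (gauss_ratio z) as [C [N H]]. destruct (Cprod_converges _ C N H) as [l [Hl Hnz]].
  replace (rgamma z) with l by (symmetry; apply (Clim_seq_unique (gauss z)), Hl).
  split; [exact Hl|]. intros Hz. apply Hnz. intros n _. now apply gauss_neq_0.
Qed.

Definition rgamma_lim z := proj1 (rgamma_lim_neq_0 z).
Definition rgamma_neq_0 z := proj2 (rgamma_lim_neq_0 z).

Lemma is_lim_seq_inv_INR : is_lim_seq (fun n => / INR n) 0.
Proof.
  replace (Finite 0) with (Rbar_inv p_infty) by reflexivity.
  apply is_lim_seq_inv; [apply is_lim_seq_INR|discriminate].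
Qed.

Lemma RtoC_neq_0 x : x <> 0 -> RtoC x <> RtoC 0.
Proof. intros H E; injection E; easy. Qed.

(** For [n >= 1] the Gauss terms satisfy exactly [gauss z n * (1 + (z+1)/n) = z * gauss (z+1) n];
    the extra factor tends to 1. *)
Lemma rgamma_rec (z : CC) : rgamma z = (z * rgamma (z + RtoC 1))%C.
Proof.
  assert (H1 : Clim (fun n => gauss z n * (RtoC 1 + (z + RtoC 1) * RtoC (/ INR n)))%C (rgamma z)).
  { replace (rgamma z) with (rgamma z * (RtoC 1 + (z + RtoC 1) * RtoC 0))%C by ring.
    apply Clim_mult; [apply rgamma_lim|].
    assert (Hi : Clim (fun n => (z + RtoC 1) * RtoC (/ INR n))%C ((z + RtoC 1) * RtoC 0)%C).
    { apply Clim_mult; [apply Clim_const|]. split; simpl; [apply is_lim_seq_inv_INR|apply is_lim_seq_const]. }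
    destruct Hi as [Hr Hi]. split.
    - apply (is_lim_seq_plus' (fun _ => 1) _ 1 _ (is_lim_seq_const 1) Hr).
    - apply (is_lim_seq_plus' (fun _ => 0) _ 0 _ (is_lim_seq_const 0) Hi). }
  assert (H2 : Clim (fun n => z * gauss (z + RtoC 1) n)%C (z * rgamma (z + RtoC 1))%C)
    by (apply Clim_mult; [apply Clim_const|apply rgamma_lim]).
  rewrite <- (Clim_seq_unique _ _ H1). apply Clim_seq_unique.
  eapply (Clim_ext_loc _ _ _ 1); [|exact H2]. intros n Hn. cbv beta.
  assert (Hn0 : INR n <> 0) by (apply not_0_INR; lia).
  unfold gauss.
  replace (poch (z + RtoC 1) (S n)) with (poch (z + RtoC 1) n * (z + RtoC 1 + RtoC (INR n)))%C by reflexivity.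
  rewrite poch_shift, Cpowpos_plus, Cpowpos_real, Rpower_1 by (apply lt_0_INR; lia).
  rewrite RtoC_inv by easy. field.
  repeat split; [apply RtoC_neq_0, Hn0|apply Cexp_neq_0|apply RtoC_neq_0, INR_fact_neq_0].
Qed.

Fixpoint rpoch (a : R) (n : nat) : R :=
  match n with O => 1 | S k => rpoch a k * (a + INR k) end.

Lemma poch_real a n : poch (RtoC a) n = RtoC (rpoch a n).
Proof. induction n as [|n IH]; cbn [poch rpoch]; [easy|]. now rewrite IH, RtoC_mult, RtoC_plus. Qed.

Definition rgauss (a : R) (n : nat) : R := rpoch a (S n) / (INR (fact n) * Rpower (INR n) a).

Lemma gauss_real a n : gauss (RtoC a) n = RtoC (rgauss a n).
Proof.
  unfold gauss, rgauss. rewrite poch_real, Cpowpos_real, RtoC_div, RtoC_mult; [easy|].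
  apply Rmult_integral_contrapositive_currified; [apply INR_fact_neq_0|].
  apply Rgt_not_eq, exp_pos.
Qed.

Definition rg (a : R) : R := Re (rgamma (RtoC a)).

Lemma rgamma_real a : rgamma (RtoC a) = RtoC (rg a).
Proof.
  destruct (rgamma_lim (RtoC a)) as [_ Hi].
  apply is_lim_seq_ext with (v := fun _ => 0) in Hi; [|intros n; now rewrite gauss_real].
  assert (E := is_lim_seq_unique _ _ Hi). rewrite Lim_seq_const in E.
  apply (f_equal real) in E. change (0 = Im (rgamma (RtoC a))) in E.
  unfold rg. revert E. generalize (rgamma (RtoC a)). intros [u v] E. simpl in E. now rewrite <- E.
Qed.

Lemma rg_lim a : is_lim_seq (rgauss a) (rg a).
Proof.
  destruct (rgamma_lim (RtoC a)) as [Hr _].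
  apply is_lim_seq_ext with (2 := Hr). intros n. rewrite gauss_real. reflexivity.
Qed.

Lemma rg_rec a : rg a = a * rg (a + 1).
Proof.
  assert (H := rgamma_rec (RtoC a)). rewrite <- RtoC_plus, !rgamma_real, <- RtoC_mult in H.
  now injection H.
Qed.

Lemma rpoch_pos a n : 0 < a -> 0 < rpoch a n.
Proof.
  intros Ha. induction n as [|n IH]; simpl; [lra|]. apply Rmult_lt_0_compat; [easy|].
  assert (H := pos_INR n). lra.
Qed.

Lemma rgauss_pos a n : 0 < a -> 0 < rgauss a n.
Proof.
  intros Ha. apply Rdiv_lt_0_compat; [now apply rpoch_pos|].
  apply Rmult_lt_0_compat; [apply INR_fact_lt_0|apply exp_pos].
Qed.

Lemma rg_pos a : 0 < a -> 0 < rg a.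
Proof.
  intros Ha.
  assert (H0 : 0 <= rg a).
  { apply (is_lim_seq_le (fun _ => 0) (rgauss a) 0 (rg a)); [|apply is_lim_seq_const|apply rg_lim].
    intros n. now apply Rlt_le, rgauss_pos. }
  destruct H0 as [|H0]; [easy|]. exfalso.
  apply (rgamma_neq_0 (RtoC a)).
  - intros k E. injection E as E. assert (Hk := pos_INR k). lra.
  - now rewrite rgamma_real, <- H0.
Qed.

(** * Improper integrals against exp(-z cosh u) *)

Definition is_J (f : R -> R) (l : R) : Prop := is_lim (fun b => RInt f 0 b) p_infty l.

(** The same [RInt_gen] as in [BesselK], so that [Kint_cosh] below holds by conversion. *)
Definition J (f : R -> R) : R := RInt_gen f (at_point 0) (Rbar_locally p_infty).

Lemma ex_RInt_cont (f : R -> R) a b : (forall u, continuous f u) -> ex_RInt f a b.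
Proof. intros H. apply (ex_RInt_continuous (V := R_CompleteNormedModule)). auto. Qed.

Lemma is_J_unique f l : (forall u, continuous f u) -> is_J f l -> J f = l.
Proof.
  intros Hc H. unfold J. apply is_RInt_gen_unique.
  intros P HP. specialize (H P HP).
  exists (fun a => a = 0) (fun b => P (RInt f 0 b)); [easy|exact H|].
  intros a b -> Hb. exists (RInt f 0 b). split; [|exact Hb]. simpl.
  apply (RInt_correct (V := R_CompleteNormedModule)). now apply ex_RInt_cont.
Qed.

(** The single majorant [exp (- u)] is enough, since the kernel [exp (- z cosh u)] beats every
    exponential; see [tame_dominated]. *)
Definition dominated (f : R -> R) : Prop :=
  (forall u, continuous f u) /\ exists C, forall u, 0 <= u -> Rabs (f u) <= C * exp (- u).

Lemma is_RInt_exp_opp C a b : is_RInt (fun u => C * exp (- u)) a b (C * exp (- a) - C * exp (- b)).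
Proof.
  replace (C * exp (- a) - C * exp (- b)) with (minus (- C * exp (- b)) (- C * exp (- a)))
    by (unfold minus, plus, opp; simpl; ring).
  apply (is_RInt_derive (fun u => - C * exp (- u))).
  - intros x _. auto_derive; [easy|]. ring.
  - intros x _. apply (ex_derive_continuous (fun u => C * exp (- u))). auto_derive. easy.
Qed.

Lemma dominated_RInt f C u v : (forall u, continuous f u) ->
  (forall u, 0 <= u -> Rabs (f u) <= C * exp (- u)) -> 0 <= u <= v ->
  Rabs (RInt f 0 v - RInt f 0 u) <= C * exp (- u).
Proof.
  intros Hc H Huv.
  assert (E : RInt f 0 v - RInt f 0 u = RInt f u v).
  { assert (E := RInt_Chasles f 0 u v (ex_RInt_cont f 0 u Hc) (ex_RInt_cont f u v Hc)).
    unfold plus in E; simpl in E. lra. }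
  rewrite E.
  assert (HC : 0 <= C).
  { specialize (H 0 (Rle_refl 0)). rewrite Ropp_0, exp_0, Rmult_1_r in H.
    eapply Rle_trans; [apply Rabs_pos|apply H]. }
  apply Rle_trans with (C * exp (- u) - C * exp (- v)).
  - apply (norm_RInt_le (V := R_NormedModule) f (fun u => C * exp (- u)) u v); [lra| | |].
    + intros x Hx. apply H. lra.
    + apply (RInt_correct (V := R_CompleteNormedModule)). now apply ex_RInt_cont.
    + apply is_RInt_exp_opp.
  - assert (He := exp_pos (- v)). nra.
Qed.

Lemma is_lim_exp_opp C : is_lim (fun u => C * exp (- u)) p_infty 0.
Proof.
  replace (Finite 0) with (Rbar_mult C 0) by (simpl; f_equal; ring).
  apply is_lim_scal_l.
  apply (is_lim_comp exp Ropp p_infty 0 m_infty).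
  - apply is_lim_exp_m.
  - apply (is_lim_opp (fun x => x) p_infty p_infty), is_lim_id.
  - exists 0. intros; discriminate.
Qed.

Lemma dominated_is_J f : dominated f -> is_J f (J f).
Proof.
  intros [Hc [C H]].
  assert (HC : 0 <= C).
  { specialize (H 0 (Rle_refl 0)). rewrite Ropp_0, exp_0, Rmult_1_r in H.
    eapply Rle_trans; [apply Rabs_pos|apply H]. }
  assert (Hex : exists l : R, is_J f l).
  { assert (Hcau := proj1 (filterlim_locally_cauchy (U := R_CompleteSpace) (F := Rbar_locally p_infty) (fun b => RInt f 0 b))).
    destruct Hcau as [l Hl]; [|exists l; exact Hl].
    intros eps.
    assert (Hlim := is_lim_exp_opp C). apply is_lim_spec in Hlim. specialize (Hlim eps).
    destruct Hlim as [M HM].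
    exists (fun b => Rmax 0 M < b). split; [exists (Rmax 0 M); auto|].
    assert (Hb : forall u v, Rmax 0 M < u -> u <= v -> Rabs (RInt f 0 v - RInt f 0 u) < eps).
    { intros u v Hu Huv. assert (H1 := Rmax_l 0 M). assert (H2 := Rmax_r 0 M).
      eapply Rle_lt_trans; [apply (dominated_RInt f C); auto; lra|].
      specialize (HM u ltac:(lra)). rewrite Rminus_0_r in HM.
      eapply Rle_lt_trans; [apply Rle_abs|exact HM]. }
    intros u v Hu Hv. unfold ball; simpl. unfold AbsRing_ball, abs, minus, plus, opp; simpl.
    destruct (Rle_dec u v).
    - now apply (Hb u v).
    - rewrite <- Rabs_Ropp. replace (- (RInt f 0 v + - RInt f 0 u)) with (RInt f 0 u - RInt f 0 v) by ring.
      apply Hb; lra. }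
  destruct Hex as [l Hl]. now rewrite (is_J_unique f l).
Qed.

Lemma J_ext f g : (forall u, f u = g u) -> J f = J g.
Proof.
  intros H. f_equal. now apply functional_extensionality.
Qed.

Lemma dominated_plus f g : dominated f -> dominated g -> dominated (fun u => f u + g u).
Proof.
  intros [Hc [C HC]] [Hc' [C' HC']]. split; [intros u; now apply (continuous_plus f g)|].
  exists (C + C'). intros u Hu. specialize (HC u Hu). specialize (HC' u Hu).
  eapply Rle_trans; [apply Rabs_triang|]. lra.
Qed.

Lemma dominated_scal c f : dominated f -> dominated (fun u => c * f u).
Proof.
  intros [Hc [C HC]]. split; [intros u; now apply (continuous_scal_r c f)|].
  exists (Rabs c * C). intros u Hu. rewrite Rabs_mult, Rmult_assoc. apply Rmult_le_compat_l; [apply Rabs_pos|auto].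
Qed.

Lemma J_plus f g : dominated f -> dominated g -> J (fun u => f u + g u) = J f + J g.
Proof.
  intros Hf Hg. apply is_J_unique.
  - intros u. apply (continuous_plus f g); [apply Hf|apply Hg].
  - apply is_lim_ext with (fun b => RInt f 0 b + RInt g 0 b).
    + intros b. symmetry. apply (RInt_plus f g); apply ex_RInt_cont; [apply Hf|apply Hg].
    + apply (is_lim_plus' _ _ _ (J f) (J g)); now apply dominated_is_J.
Qed.

Lemma J_scal c f : dominated f -> J (fun u => c * f u) = c * J f.
Proof.
  intros Hf. apply is_J_unique.
  - intros u. apply (continuous_scal_r c f). apply Hf.
  - apply is_lim_ext with (fun b => c * RInt f 0 b).
    + intros b. symmetry. apply (RInt_scal f). apply ex_RInt_cont. apply Hf.
    + apply (is_lim_scal_l _ c p_infty (J f)). now apply dominated_is_J.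
Qed.

Lemma J_le f g : dominated f -> dominated g -> (forall u, 0 <= u -> f u <= g u) -> J f <= J g.
Proof.
  intros Hf Hg H.
  apply (is_lim_le_loc (fun b => RInt f 0 b) (fun b => RInt g 0 b) p_infty (J f) (J g));
    try now apply dominated_is_J.
  exists 0. intros b Hb. apply RInt_le; [lra|apply ex_RInt_cont, Hf|apply ex_RInt_cont, Hg|].
  intros u Hu. apply H. lra.
Qed.

Lemma J_ftc (g f : R -> R) C : dominated f -> (forall u, is_derive g u (f u)) ->
  (forall u, 0 <= u -> Rabs (g u) <= C * exp (- u)) -> J f = - g 0.
Proof.
  intros Hf Hg HC. apply is_J_unique; [apply Hf|].
  apply is_lim_ext with (fun b => g b - g 0).
  - intros b. symmetry. apply is_RInt_unique. apply (is_RInt_derive g f).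
    + intros; apply Hg.
    + intros; apply Hf.
  - replace (Finite (- g 0)) with (Finite (0 - g 0)) by (f_equal; ring).
    apply (is_lim_minus' g (fun _ => g 0) p_infty 0 (g 0)); [|apply is_lim_const].
    apply (is_lim_le_le_loc (fun u => - (C * exp (- u))) (fun u => C * exp (- u))).
    + exists 0. intros u Hu. specialize (HC u ltac:(lra)). apply Rabs_le_between in HC. lra.
    + replace (Finite 0) with (Rbar_opp 0) by (simpl; f_equal; ring). apply is_lim_opp, is_lim_exp_opp.
    + apply is_lim_exp_opp.
Qed.

Lemma exp_le_compat x y : x <= y -> exp x <= exp y.
Proof. intros [H| ->]; [now apply Rlt_le, exp_increasing|lra]. Qed.

Lemma exp_pow_INR x n : exp x ^ n = exp (INR n * x).
Proof.
  induction n as [|n IH]; [simpl; now rewrite Rmult_0_l, exp_0|].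
  rewrite <- tech_pow_Rmult, IH, <- exp_plus, S_INR. f_equal. ring.
Qed.

(** The admissible multipliers of the kernel grow at most exponentially. The class is closed under
    products, so differentiation in [z], which inserts a factor [cosh u], stays inside it. *)
Definition tame (p : R -> R) : Prop :=
  (forall u, continuous p u) /\
  exists A N, 0 <= A /\ forall u, 0 <= u -> Rabs (p u) <= A * exp (INR N * u).

Lemma cosh_ge_half_exp u : exp u / 2 <= cosh u.
Proof. unfold cosh. assert (H := exp_pos (- u)). lra. Qed.

Lemma cosh_ge_1 u : 1 <= cosh u.
Proof.
  unfold cosh. assert (H := exp_pos u). assert (H' := exp_pos (- u)).
  assert (E : exp u * exp (- u) = 1) by (rewrite <- exp_plus, Rplus_opp_r; apply exp_0).
  assert (0 <= (exp u - exp (- u)) ^ 2) by apply pow2_ge_0. simpl in *. nra.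
Qed.

(** With [y = (z/2) exp u <= z cosh u] and [m = N + 1], the inequality [exp y >= (y/m)^m] bounds the
    kernel by a multiple of [exp (- (N+1) u)], one exponential more than has to be absorbed. *)
Lemma exp_cosh_bound z (N : nat) : 0 < z ->
  exists C, 0 <= C /\ forall u, exp (- z * cosh u) * exp (INR N * u) <= C * exp (- u).
Proof.
  intros Hz. set (m := INR (S N)). assert (Hm : 0 < m) by (apply lt_0_INR; lia).
  exists ((2 * m / z) ^ S N). split; [apply pow_le, Rlt_le, Rdiv_lt_0_compat; lra|]. intros u.
  set (y := z / 2 * exp u).
  assert (Hy : 0 < y) by (apply Rmult_lt_0_compat; [lra|apply exp_pos]).
  assert (H1 : exp (- z * cosh u) <= exp (- y)).
  { apply exp_le_compat. unfold y. assert (H := cosh_ge_half_exp u). nra. }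
  assert (H2 : (y / m) ^ S N <= exp y).
  { replace (exp y) with (exp (y / m) ^ S N).
    - apply pow_incr. split; [apply Rlt_le, Rdiv_lt_0_compat; lra|]. assert (H := exp_ineq1_le (y / m)). lra.
    - rewrite exp_pow_INR. f_equal. fold m. field. lra. }
  assert (H3 : exp (- y) <= (m / y) ^ S N).
  { rewrite exp_Ropp. replace (m / y) with (/ (y / m)) by (field; lra). rewrite pow_inv.
    apply Rinv_le_contravar; [|easy]. apply pow_lt, Rdiv_lt_0_compat; lra. }
  assert (H4 : (m / y) ^ S N * exp (INR N * u) = (2 * m / z) ^ S N * exp (- u)).
  { replace (m / y) with (2 * m / z * exp (- u)).
    - rewrite Rpow_mult_distr, Rmult_assoc. f_equal. rewrite exp_pow_INR, <- exp_plus. f_equal.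
      rewrite S_INR. ring.
    - unfold y. rewrite exp_Ropp. field. split; [|lra]. apply Rgt_not_eq, exp_pos. }
  rewrite <- H4. apply Rmult_le_compat_r; [apply Rlt_le, exp_pos|lra].
Qed.

Lemma continuous_kernel z u : continuous (fun u => exp (- z * cosh u)) u.
Proof. apply (ex_derive_continuous (fun u => exp (- z * cosh u))). unfold cosh. auto_derive. easy. Qed.

Lemma tame_dominated z p : 0 < z -> tame p -> dominated (fun u => exp (- z * cosh u) * p u).
Proof.
  intros Hz [Hc [A [N [HA H]]]]. split.
  - intros u. apply (continuous_mult (fun u => exp (- z * cosh u)) p); [apply continuous_kernel|apply Hc].
  - destruct (exp_cosh_bound z N Hz) as [C [HC HB]]. exists (A * C). intros u Hu.
    rewrite Rabs_mult, Rabs_right by (apply Rle_ge, Rlt_le, exp_pos).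
    specialize (H u Hu). specialize (HB u). assert (He := exp_pos (- z * cosh u)).
    apply Rle_trans with (exp (- z * cosh u) * (A * exp (INR N * u))); [apply Rmult_le_compat_l; lra|].
    replace (exp (- z * cosh u) * (A * exp (INR N * u))) with (A * (exp (- z * cosh u) * exp (INR N * u))) by ring.
    rewrite Rmult_assoc. now apply Rmult_le_compat_l.
Qed.

Lemma tame_plus p q : tame p -> tame q -> tame (fun u => p u + q u).
Proof.
  intros [Hp [A [N [HA H]]]] [Hq [B [M [HB H']]]]. split.
  - intros u; now apply (continuous_plus p q).
  - exists (A + B), (N + M)%nat. split; [lra|]. intros u Hu.
    specialize (H u Hu). specialize (H' u Hu).
    assert (H1 : exp (INR N * u) <= exp (INR (N + M) * u)).
    { apply exp_le_compat. apply Rmult_le_compat_r; [easy|]. apply le_INR. lia. }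
    assert (H2 : exp (INR M * u) <= exp (INR (N + M) * u)).
    { apply exp_le_compat. apply Rmult_le_compat_r; [easy|]. apply le_INR. lia. }
    eapply Rle_trans; [apply Rabs_triang|]. nra.
Qed.

Lemma tame_mult p q : tame p -> tame q -> tame (fun u => p u * q u).
Proof.
  intros [Hp [A [N [HA H]]]] [Hq [B [M [HB H']]]]. split.
  - intros u; now apply (continuous_mult p q).
  - exists (A * B), (N + M)%nat. split; [nra|]. intros u Hu.
    specialize (H u Hu). specialize (H' u Hu).
    rewrite Rabs_mult, plus_INR, Rmult_plus_distr_r, exp_plus.
    replace (A * B * (exp (INR N * u) * exp (INR M * u))) with ((A * exp (INR N * u)) * (B * exp (INR M * u))) by ring.
    apply Rmult_le_compat; auto using Rabs_pos.
Qed.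

Lemma tame_exp a : tame (fun u => exp (a * u)).
Proof.
  split.
  - intros u. apply (ex_derive_continuous (fun u => exp (a * u))). auto_derive. easy.
  - destruct (nfloor_ex (Rabs a) (Rabs_pos a)) as [N HN]. exists 1, (S N). split; [lra|].
    intros u Hu. rewrite Rabs_right by (apply Rle_ge, Rlt_le, exp_pos). rewrite Rmult_1_l. apply exp_le_compat.
    apply Rmult_le_compat_r; [easy|]. rewrite S_INR. assert (H := Rle_abs a). lra.
Qed.

Lemma tame_const c : tame (fun _ => c).
Proof.
  split; [intros u; apply continuous_const|]. exists (Rabs c), 0%nat. split; [apply Rabs_pos|].
  intros u _. simpl. rewrite Rmult_0_l, exp_0. lra.
Qed.

Lemma tame_ext p q : (forall u, p u = q u) -> tame p -> tame q.
Proof.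
  intros H [Hc [A [N [HA HB]]]]. split.
  - intros u. apply (continuous_ext p); auto.
  - exists A, N. split; [easy|]. intros u Hu. rewrite <- H. auto.
Qed.

Lemma tame_abs p : tame p -> tame (fun u => Rabs (p u)).
Proof.
  intros [Hc [A [N [HA HB]]]]. split.
  - intros u. apply (continuous_comp p Rabs); [apply Hc|apply continuous_Rabs].
  - exists A, N. split; [easy|]. intros u Hu. rewrite Rabs_Rabsolu. auto.
Qed.

Lemma tame_cosh a : tame (fun u => cosh (a * u)).
Proof.
  apply tame_ext with (fun u => / 2 * (exp (a * u) + exp (- a * u))).
  - intros u. unfold cosh. replace (- (a * u)) with (- a * u) by ring. field.
  - apply (tame_mult (fun _ => / 2)); [apply tame_const|]. apply tame_plus; apply tame_exp.
Qed.

Lemma tame_sinh a : tame (fun u => sinh (a * u)).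
Proof.
  apply tame_ext with (fun u => / 2 * (exp (a * u) + -1 * exp (- a * u))).
  - intros u. unfold sinh. replace (- (a * u)) with (- a * u) by ring. field.
  - apply (tame_mult (fun _ => / 2)); [apply tame_const|]. apply tame_plus; [apply tame_exp|].
    apply (tame_mult (fun _ => -1)); [apply tame_const|apply tame_exp].
Qed.

Lemma tame_cosh1 : tame cosh.
Proof. apply tame_ext with (fun u => cosh (1 * u)); [intros; f_equal; ring|apply tame_cosh]. Qed.

Lemma tame_sinh1 : tame sinh.
Proof. apply tame_ext with (fun u => sinh (1 * u)); [intros; f_equal; ring|apply tame_sinh]. Qed.

Definition Kint (p : R -> R) (z : R) : R := J (fun u => exp (- z * cosh u) * p u).

Lemma Kint_ext p q z : (forall u, p u = q u) -> Kint p z = Kint q z.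
Proof. intros H. apply J_ext. intros u. now rewrite H. Qed.

Lemma Kint_plus p q z : 0 < z -> tame p -> tame q -> Kint (fun u => p u + q u) z = Kint p z + Kint q z.
Proof.
  intros Hz Hp Hq. unfold Kint. rewrite <- J_plus by now apply tame_dominated.
  apply J_ext. intros; ring.
Qed.

Lemma Kint_scal c p z : 0 < z -> tame p -> Kint (fun u => c * p u) z = c * Kint p z.
Proof.
  intros Hz Hp. unfold Kint. rewrite <- J_scal by now apply tame_dominated.
  apply J_ext. intros; ring.
Qed.

Lemma Kint_le p q z : 0 < z -> tame p -> tame q -> (forall u, 0 <= u -> p u <= q u) -> Kint p z <= Kint q z.
Proof.
  intros Hz Hp Hq H. apply J_le; try now apply tame_dominated.
  intros u Hu. apply Rmult_le_compat_l; [apply Rlt_le, exp_pos|auto].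
Qed.

Lemma Kint_ge_0 p z : 0 < z -> tame p -> (forall u, 0 <= u -> 0 <= p u) -> 0 <= Kint p z.
Proof.
  intros Hz Hp H. replace 0 with (Kint (fun _ => 0 * 0) z).
  - apply Kint_le; auto. apply (tame_const (0 * 0)). intros; rewrite Rmult_0_l; auto.
  - rewrite (Kint_scal 0 (fun _ => 0)); [ring|easy|apply tame_const].
Qed.

(** A version valid for every real [x]: under the integral the argument is [- h cosh u], which is
    unbounded in [u]. *)
Lemma exp_taylor1_abs x : Rabs (exp x - 1 - x) <= x ^ 2 * exp (Rabs x).
Proof.
  assert (H1 := exp_ineq1_le x). assert (H2 := exp_ineq1_le (- x)).
  assert (Hm : exp x * exp (- x) = 1) by (rewrite <- exp_plus, Rplus_opp_r; apply exp_0).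
  assert (Hp := exp_pos x).
  assert (Hm1 : exp x * (1 - x) <= 1) by (rewrite <- Hm; apply Rmult_le_compat_l; lra).
  rewrite Rabs_right by lra.
  destruct (Rle_dec 0 x).
  - rewrite Rabs_right by lra. assert (exp x - 1 <= x * exp x) by lra. simpl; nra.
  - rewrite Rabs_left by lra.
    assert (1 <= exp (- x)) by lra.
    assert (exp x - 1 - x <= x ^ 2) by (simpl; nra). assert (0 <= x ^ 2) by (simpl; nra). nra.
Qed.

(** Differentiation under the integral sign by a quadratic remainder. For [|h| <= z/2] the factor
    [exp (|h| cosh u)] costs half of the exponent of the kernel, so the remainder is at most [h^2]
    times an integral at argument [z/2]. *)
Lemma Kint_derive p z : 0 < z -> tame p ->
  is_derive (Kint p) z (- Kint (fun u => cosh u * p u) z).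
Proof.
  intros Hz Hp.
  set (q := fun u => cosh u * cosh u * Rabs (p u)).
  assert (Hq : tame q).
  { apply tame_mult; [apply (tame_mult cosh cosh); apply tame_cosh1|now apply tame_abs]. }
  assert (Hcp : tame (fun u => cosh u * p u)) by (apply tame_mult; [apply tame_cosh1|easy]).
  set (Q := Kint q (z / 2)).
  assert (HQ : 0 <= Q).
  { apply Kint_ge_0; [lra|easy|]. intros u _. unfold q. assert (H := cosh_ge_1 u).
    apply Rmult_le_pos; [nra|apply Rabs_pos]. }
  assert (Hmain : forall h, Rabs h <= z / 2 ->
    Rabs (Kint p (z + h) - Kint p z + h * Kint (fun u => cosh u * p u) z) <= h ^ 2 * Q).
  { intros h Hh. assert (Hh' := Hh). apply Rabs_le_between in Hh'.
    set (D := fun u => exp (- (z + h) * cosh u) * p u + (-1 * (exp (- z * cosh u) * p u) + h * (exp (- z * cosh u) * (cosh u * p u)))).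
    assert (D1 : dominated (fun u => exp (- (z + h) * cosh u) * p u)).
    { split; [|].
      all: assert (0 < z + h) by lra; now apply tame_dominated. }
    assert (Dscal := dominated_scal).
    assert (Dplus := dominated_plus).
    assert (D2 := tame_dominated z p Hz Hp). assert (D3 := tame_dominated z _ Hz Hcp).
    assert (ED : J D = Kint p (z + h) - Kint p z + h * Kint (fun u => cosh u * p u) z).
    { unfold D, Kint. rewrite J_plus, J_plus, !J_scal by auto. ring. }
    assert (HD : dominated D) by (apply Dplus; auto).
    assert (Hq2 := tame_dominated (z / 2) q ltac:(lra) Hq).
    assert (Hpt : forall u, Rabs (D u) <= h ^ 2 * (exp (- (z / 2) * cosh u) * q u)).
    { intros u. assert (Hc1 := cosh_ge_1 u).
      replace (D u) with (exp (- z * cosh u) * p u * (exp (- h * cosh u) - 1 - (- h * cosh u))).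
      2:{ unfold D. replace (- (z + h) * cosh u) with (- z * cosh u + - h * cosh u) by ring. rewrite exp_plus. ring. }
      rewrite !Rabs_mult, (Rabs_right (exp (- z * cosh u))) by (apply Rle_ge, Rlt_le, exp_pos).
      assert (Ht := exp_taylor1_abs (- h * cosh u)).
      assert (He : exp (- z * cosh u) * exp (Rabs (- h * cosh u)) <= exp (- (z / 2) * cosh u)).
      { rewrite <- exp_plus. apply exp_le_compat. rewrite Rabs_mult, Rabs_Ropp, (Rabs_right (cosh u)) by lra. nra. }
      assert (Hp0 := Rabs_pos (p u)). assert (He0 := exp_pos (- z * cosh u)).
      apply Rle_trans with (exp (- z * cosh u) * Rabs (p u) * ((- h * cosh u) ^ 2 * exp (Rabs (- h * cosh u)))).
      - apply Rmult_le_compat_l; [nra|easy].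
      - replace (exp (- z * cosh u) * Rabs (p u) * ((- h * cosh u) ^ 2 * exp (Rabs (- h * cosh u)))) with
          (h ^ 2 * (cosh u * cosh u * Rabs (p u)) * (exp (- z * cosh u) * exp (Rabs (- h * cosh u)))) by ring.
        unfold q. replace (h ^ 2 * (exp (- (z / 2) * cosh u) * (cosh u * cosh u * Rabs (p u)))) with
          (h ^ 2 * (cosh u * cosh u * Rabs (p u)) * exp (- (z / 2) * cosh u)) by ring.
        apply Rmult_le_compat_l; [|easy]. apply Rmult_le_pos; [simpl; nra|]. apply Rmult_le_pos; nra. }
    rewrite <- ED. unfold Q, Kint. rewrite <- J_scal by easy. apply Rabs_le. split.
    - replace (- J (fun x => h ^ 2 * (exp (- (z / 2) * cosh x) * q x))) with
        (J (fun x => -1 * (h ^ 2 * (exp (- (z / 2) * cosh x) * q x)))) by (rewrite J_scal by auto; ring).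
      apply J_le; auto. intros u _. specialize (Hpt u). apply Rabs_le_between in Hpt. lra.
    - apply J_le; auto. intros u _. specialize (Hpt u). apply Rabs_le_between in Hpt. lra. }
  apply is_derive_Reals. intros eps Heps.
  assert (Hd : 0 < Rmin (z / 2) (eps / (Q + 1))) by (apply Rmin_pos; [lra|apply Rdiv_lt_0_compat; lra]).
  exists (mkposreal _ Hd). intros h Hh0 Hh. simpl in Hh.
  assert (H1 := Rmin_l (z / 2) (eps / (Q + 1))). assert (H2 := Rmin_r (z / 2) (eps / (Q + 1))).
  specialize (Hmain h ltac:(lra)).
  replace ((Kint p (z + h) - Kint p z) / h - - Kint (fun u => cosh u * p u) z) with
    ((Kint p (z + h) - Kint p z + h * Kint (fun u => cosh u * p u) z) / h) by (field; easy).
  unfold Rdiv. rewrite Rabs_mult, Rabs_inv.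
  assert (Hha : 0 < Rabs h) by now apply Rabs_pos_lt.
  apply Rle_lt_trans with (Rabs h * Q).
  - apply Rmult_le_reg_r with (Rabs h); [easy|]. rewrite Rmult_assoc, Rinv_l by lra.
    replace (Rabs h * Q * Rabs h) with (Rabs h ^ 2 * Q) by ring. rewrite pow2_abs. lra.
  - assert (Rabs h * (Q + 1) < eps); [|nra].
    replace eps with (eps / (Q + 1) * (Q + 1)) by (field; lra). apply Rmult_lt_compat_r; lra.
Qed.

(** * Recurrences and large-argument behaviour of K *)

Definition Oinf (u : R -> R) (l : R) : Prop :=
  exists M X, 0 < X /\ forall x, X < x -> Rabs (u x - l) <= M / x.

Lemma Oinf_const c : Oinf (fun _ => c) c.
Proof. exists 0, 1. split; [lra|]. intros. rewrite Rminus_diag, Rabs_R0. unfold Rdiv; rewrite Rmult_0_l. lra. Qed.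

Lemma Oinf_ext u v l X : (forall x, X < x -> u x = v x) -> Oinf u l -> Oinf v l.
Proof.
  intros H [M [Y [HY HM]]]. exists M, (Rmax X Y).
  assert (H1 := Rmax_l X Y). assert (H2 := Rmax_r X Y).
  split; [lra|]. intros x Hx. rewrite <- H by lra. apply HM. lra.
Qed.

Lemma Oinf_M_pos u l : Oinf u l -> exists M X, 0 <= M /\ 1 < X /\ forall x, X < x -> Rabs (u x - l) <= M / x.
Proof.
  intros [M [X [HX HM]]]. exists (Rabs M), (Rmax 2 X).
  assert (H1 := Rmax_l 2 X). assert (H2 := Rmax_r 2 X).
  split; [apply Rabs_pos|]. split; [lra|]. intros x Hx. eapply Rle_trans; [apply HM; lra|].
  apply Rmult_le_compat_r; [apply Rlt_le, Rinv_0_lt_compat; lra|apply Rle_abs].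
Qed.

Lemma Oinf_plus u v l k : Oinf u l -> Oinf v k -> Oinf (fun x => u x + v x) (l + k).
Proof.
  intros Hu Hv. destruct (Oinf_M_pos _ _ Hu) as [M [X [HM [HX H]]]], (Oinf_M_pos _ _ Hv) as [M' [X' [HM' [HX' H']]]].
  exists (M + M'), (Rmax X X'). assert (H1 := Rmax_l X X'). assert (H2 := Rmax_r X X').
  split; [lra|]. intros x Hx. specialize (H x ltac:(lra)). specialize (H' x ltac:(lra)).
  replace (u x + v x - (l + k)) with ((u x - l) + (v x - k)) by ring.
  eapply Rle_trans; [apply Rabs_triang|]. unfold Rdiv in *. lra.
Qed.

Lemma Oinf_mult u v l k : Oinf u l -> Oinf v k -> Oinf (fun x => u x * v x) (l * k).
Proof.
  intros Hu Hv. destruct (Oinf_M_pos _ _ Hu) as [M [X [HM [HX H]]]], (Oinf_M_pos _ _ Hv) as [M' [X' [HM' [HX' H']]]].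
  exists (M * (M' + Rabs k) + Rabs l * M'), (Rmax X X'). assert (H1 := Rmax_l X X'). assert (H2 := Rmax_r X X').
  split; [lra|]. intros x Hx. specialize (H x ltac:(lra)). specialize (H' x ltac:(lra)).
  assert (Hi : 0 < / x <= 1) by (split; [apply Rinv_0_lt_compat; lra|rewrite <- Rinv_1; apply Rinv_le_contravar; lra]).
  replace (u x * v x - l * k) with ((u x - l) * ((v x - k) + k) + l * (v x - k)) by ring.
  eapply Rle_trans; [apply Rabs_triang|]. rewrite !Rabs_mult.
  assert (Hb : Rabs (v x - k + k) <= M' + Rabs k).
  { eapply Rle_trans; [apply Rabs_triang|]. unfold Rdiv in H'. nra. }
  assert (Rabs (u x - l) * Rabs (v x - k + k) <= M / x * (M' + Rabs k)) by (apply Rmult_le_compat; auto using Rabs_pos).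
  assert (Rabs l * Rabs (v x - k) <= Rabs l * (M' / x)) by (apply Rmult_le_compat_l; auto using Rabs_pos).
  unfold Rdiv in *. lra.
Qed.

Lemma Oinf_inv_x : Oinf (fun x => / x) 0.
Proof.
  exists 1, 1. split; [lra|]. intros x Hx. rewrite Rminus_0_r, Rabs_right. lra.
  apply Rle_ge, Rlt_le, Rinv_0_lt_compat; lra.
Qed.

Lemma Oinf_squeeze u v l X : (forall x, X < x -> Rabs (u x - l) <= v x) -> Oinf v 0 -> Oinf u l.
Proof.
  intros H [M [Y [HY HM]]]. exists M, (Rmax X Y).
  assert (H1 := Rmax_l X Y). assert (H2 := Rmax_r X Y).
  split; [lra|]. intros x Hx. eapply Rle_trans; [apply H; lra|].
  specialize (HM x ltac:(lra)). rewrite Rminus_0_r in HM. eapply Rle_trans; [apply Rle_abs|easy].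
Qed.

Definition lim0 (u : R -> R) (l : R) : Prop :=
  forall eps, 0 < eps -> exists d, 0 < d /\ forall x, 0 < x < d -> Rabs (u x - l) <= eps.

Lemma lim0_const c : lim0 (fun _ => c) c.
Proof. intros eps He. exists 1. split; [lra|]. intros. rewrite Rminus_diag, Rabs_R0. lra. Qed.

Lemma lim0_id : lim0 (fun x => x) 0.
Proof. intros eps He. exists eps. split; [lra|]. intros. rewrite Rminus_0_r, Rabs_right; lra. Qed.

Lemma lim0_plus u v l k : lim0 u l -> lim0 v k -> lim0 (fun x => u x + v x) (l + k).
Proof.
  intros Hu Hv eps He. destruct (Hu (eps / 2) ltac:(lra)) as [d [Hd H]], (Hv (eps / 2) ltac:(lra)) as [d' [Hd' H']].
  exists (Rmin d d'). split; [now apply Rmin_pos|]. intros x Hx.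
  assert (H1 := Rmin_l d d'). assert (H2 := Rmin_r d d').
  specialize (H x ltac:(lra)). specialize (H' x ltac:(lra)).
  replace (u x + v x - (l + k)) with ((u x - l) + (v x - k)) by ring.
  eapply Rle_trans; [apply Rabs_triang|]. lra.
Qed.

Lemma lim0_mult u v l k : lim0 u l -> lim0 v k -> lim0 (fun x => u x * v x) (l * k).
Proof.
  intros Hu Hv eps He.
  set (e := Rmin 1 (eps / (Rabs k + Rabs l + 1))).
  assert (Hk := Rabs_pos k). assert (Hl := Rabs_pos l).
  assert (He0 : 0 < e) by (apply Rmin_pos; [lra|apply Rdiv_lt_0_compat; lra]).
  assert (He1 : e <= 1) by apply Rmin_l.
  assert (He2 : e * (Rabs k + Rabs l + 1) <= eps).
  { apply Rle_trans with (eps / (Rabs k + Rabs l + 1) * (Rabs k + Rabs l + 1)).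
    apply Rmult_le_compat_r; [lra|apply Rmin_r]. right. field. lra. }
  destruct (Hu e He0) as [d [Hd H]], (Hv e He0) as [d' [Hd' H']].
  exists (Rmin d d'). split; [now apply Rmin_pos|]. intros x Hx.
  assert (H1 := Rmin_l d d'). assert (H2 := Rmin_r d d').
  specialize (H x ltac:(lra)). specialize (H' x ltac:(lra)).
  replace (u x * v x - l * k) with ((u x - l) * (v x - k) + ((u x - l) * k + l * (v x - k))) by ring.
  eapply Rle_trans; [apply Rabs_triang|]. eapply Rle_trans; [apply Rplus_le_compat_l, Rabs_triang|].
  rewrite !Rabs_mult.
  assert (Rabs (u x - l) * Rabs (v x - k) <= e * 1) by (apply Rmult_le_compat; auto using Rabs_pos; lra).
  nra.
Qed.

Lemma lim0_ext u v l d : 0 < d -> (forall x, 0 < x < d -> u x = v x) -> lim0 u l -> lim0 v l.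
Proof.
  intros Hd H Hu eps He. destruct (Hu eps He) as [d' [Hd' H']].
  exists (Rmin d d'). split; [now apply Rmin_pos|]. intros x Hx.
  assert (H1 := Rmin_l d d'). assert (H2 := Rmin_r d d').
  rewrite <- H by lra. apply H'. lra.
Qed.

Lemma lim0_squeeze u v w l d : 0 < d -> (forall x, 0 < x < d -> v x <= u x <= w x) ->
  lim0 v l -> lim0 w l -> lim0 u l.
Proof.
  intros Hd0 H0 Hu Hv eps He. destruct (Hu eps He) as [d1 [Hd H]], (Hv eps He) as [d' [Hd' H']].
  exists (Rmin d (Rmin d1 d')). split; [repeat apply Rmin_pos; auto|]. intros x Hx.
  assert (H1 := Rmin_l d1 d'). assert (H2 := Rmin_r d1 d').
  assert (H3 := Rmin_l d (Rmin d1 d')). assert (H4 := Rmin_r d (Rmin d1 d')).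
  specialize (H x ltac:(lra)). specialize (H' x ltac:(lra)). specialize (H0 x ltac:(lra)).
  apply Rabs_le_between in H, H'. apply Rabs_le. lra.
Qed.

Lemma lim0_Rpower c : 0 < c -> lim0 (fun z => Rpower (z / 2) c) 0.
Proof.
  intros Hc eps He. exists (2 * exp (ln eps / c)). assert (H := exp_pos (ln eps / c)).
  split; [lra|]. intros x Hx. rewrite Rminus_0_r, Rabs_right by (apply Rle_ge, Rlt_le, exp_pos).
  unfold Rpower. rewrite <- (exp_ln eps) by easy. apply exp_le_compat.
  assert (Hl : ln (x / 2) < ln eps / c).
  { rewrite <- (ln_exp (ln eps / c)). apply ln_increasing; lra. }
  replace (ln eps) with (c * (ln eps / c)) by (field; lra). apply Rmult_le_compat_l; lra.
Qed.

(** * The functions K: recurrence in the order, derivative, positivity *)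

Local Notation K := BesselK.

Lemma sinh_sinh a u : sinh u * sinh (a * u) = / 2 * (cosh ((a + 1) * u) + -1 * cosh ((a - 1) * u)).
Proof.
  unfold sinh, cosh.
  replace ((a + 1) * u) with (a * u + u) by ring. replace ((a - 1) * u) with (a * u + - u) by ring.
  replace (- (a * u + u)) with (- (a * u) + - u) by ring. replace (- (a * u + - u)) with (- (a * u) + u) by ring.
  rewrite !exp_plus. field.
Qed.

Lemma cosh_cosh a u : cosh u * cosh (a * u) = / 2 * (cosh ((a + 1) * u) + cosh ((a - 1) * u)).
Proof.
  unfold cosh.
  replace ((a + 1) * u) with (a * u + u) by ring. replace ((a - 1) * u) with (a * u + - u) by ring.
  replace (- (a * u + u)) with (- (a * u) + - u) by ring. replace (- (a * u + - u)) with (- (a * u) + u) by ring.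
  rewrite !exp_plus. field.
Qed.

Lemma Kint_cosh a z : Kint (fun u => cosh (a * u)) z = K a z.
Proof. reflexivity. Qed.

Lemma K_neg a z : K (- a) z = K a z.
Proof.
  rewrite <- !Kint_cosh. apply Kint_ext. intros u. unfold cosh.
  replace (- a * u) with (- (a * u)) by ring. rewrite Ropp_involutive. field.
Qed.

Lemma K_comb c1 c2 a b z : 0 < z ->
  Kint (fun u => c1 * cosh (a * u) + c2 * cosh (b * u)) z = c1 * K a z + c2 * K b z.
Proof.
  intros Hz. rewrite Kint_plus, !Kint_scal; try easy; try apply tame_cosh;
    (apply (tame_mult (fun _ => _)); [apply tame_const|apply tame_cosh]).
Qed.

Lemma Kint_ftc (q p : R -> R) z : 0 < z -> tame q -> tame p ->
  (forall u, is_derive (fun u => exp (- z * cosh u) * q u) u (exp (- z * cosh u) * p u)) ->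
  Kint p z = - (exp (- z) * q 0).
Proof.
  intros Hz Hq Hp H. destruct (tame_dominated z q Hz Hq) as [_ [C HC]].
  unfold Kint. rewrite (J_ftc (fun u => exp (- z * cosh u) * q u) _ C); auto.
  - rewrite cosh_0, Rmult_1_r. reflexivity.
  - now apply tame_dominated.
Qed.

(** Integrate the derivative of [exp (- z cosh u) sinh (a u)] over the half-line: both boundary
    values are 0, and [sinh_sinh] rewrites the product that appears. *)
Lemma K_rec a z : 0 < z -> a * K a z = z / 2 * (K (a + 1) z - K (a - 1) z).
Proof.
  intros Hz.
  assert (H : Kint (fun u => a * cosh (a * u) + - z * (sinh u * sinh (a * u))) z = 0).
  { rewrite (Kint_ftc (fun u => sinh (a * u))); auto using tame_sinh.
    - rewrite Rmult_0_r, sinh_0. ring.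
    - apply tame_plus; (apply (tame_mult (fun _ => _)); [apply tame_const|]); [apply tame_cosh|].
      apply tame_mult; [apply tame_sinh1|apply tame_sinh].
    - intros u. unfold sinh, cosh. auto_derive; [easy|]. unfold Rdiv, Rminus. ring. }
  rewrite (Kint_ext _ (fun u => a * cosh (a * u) + (- z / 2) * (cosh ((a + 1) * u) + -1 * cosh ((a - 1) * u)))) in H.
  2:{ intros u. rewrite sinh_sinh. field. }
  assert (T2 : tame (fun u => cosh ((a + 1) * u) + -1 * cosh ((a - 1) * u))).
  { apply tame_plus; [apply tame_cosh|]. apply (tame_mult (fun _ => _)); [apply tame_const|apply tame_cosh]. }
  rewrite Kint_plus, !Kint_scal, Kint_plus, Kint_scal in H; auto using tame_cosh;
    try (apply (tame_mult (fun _ => _)); [apply tame_const|auto using tame_cosh]).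
  rewrite !Kint_cosh in H. lra.
Qed.

Lemma K_derive a z : 0 < z -> is_derive (K a) z (- (K (a + 1) z + K (a - 1) z) / 2).
Proof.
  intros Hz.
  replace (- (K (a + 1) z + K (a - 1) z) / 2) with (- Kint (fun u => cosh u * cosh (a * u)) z).
  - apply (Kint_derive (fun u => cosh (a * u))); auto using tame_cosh.
  - rewrite (Kint_ext _ (fun u => / 2 * cosh ((a + 1) * u) + / 2 * cosh ((a - 1) * u))).
    + rewrite K_comb by easy. field.
    + intros u. rewrite cosh_cosh. ring.
Qed.

Local Ltac exact_derive H :=
  match goal with |- is_derive _ _ ?l =>
    match type of H with is_derive _ _ ?l' => replace l with l'; [exact H|] end end.

(** Differentiating the power gives a multiple of [a K_a]; [K_rec] turns it into a difference of
    neighbours that cancels [K_(a-1)]. *)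
Lemma Ktilde_derive a z : 0 < z -> is_derive (Ktilde a) z (- (z / 2) * Ktilde (a + 1) z).
Proof.
  intros Hz.
  assert (H1 : is_derive (fun z => Rpower (z / 2) (- a)) z (- a / z * Rpower (z / 2) (- a))).
  { unfold Rpower. auto_derive; [lra|]. change (z * / 2) with (z / 2). field. lra. }
  assert (H := is_derive_mult _ _ z _ _ H1 (K_derive a z Hz) Rmult_comm).
  unfold Ktilde. unfold plus, mult in H; simpl in H.
  exact_derive H.
  assert (Hr := K_rec a z Hz).
  replace (- (a + 1)) with (- a + - (1)) by ring. rewrite Rpower_plus, (Rpower_Ropp (z / 2) 1), Rpower_1 by lra.
  replace (- a / z * Rpower (z / 2) (- a) * K a z) with (- / z * Rpower (z / 2) (- a) * (a * K a z)) by (field; lra).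
  rewrite Hr. field. lra.
Qed.

Lemma cosh_le x y : Rabs x <= y -> cosh x <= cosh y.
Proof.
  intros H. apply Rabs_le_between in H. unfold cosh.
  assert (E1 : exp (- x) * exp x = 1) by (rewrite <- exp_plus, Rplus_opp_l; apply exp_0).
  assert (E2 : exp (- y) * exp y = 1) by (rewrite <- exp_plus, Rplus_opp_l; apply exp_0).
  assert (H1 : exp x <= exp y) by (apply exp_le_compat; lra).
  assert (H2 : exp (- y) <= exp x) by (apply exp_le_compat; lra).
  assert (P1 := exp_pos x). assert (P2 := exp_pos y). assert (P3 := exp_pos (- x)). assert (P4 := exp_pos (- y)).
  (* [(e^y - e^x)(1 - e^{-x-y}) >= 0] *)
  assert (0 <= (exp y - exp x) * (1 - exp (- x) * exp (- y))).
  { apply Rmult_le_pos; [lra|]. assert (exp (- x) * exp (- y) <= exp (- x) * exp x) by (apply Rmult_le_compat_l; lra). lra. }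
  nra.
Qed.

Lemma K_mono a b z : 0 < z -> Rabs a <= b -> K a z <= K b z.
Proof.
  intros Hz H. rewrite <- !Kint_cosh. apply Kint_le; auto using tame_cosh.
  intros u Hu. apply cosh_le. rewrite Rabs_mult, (Rabs_right u) by lra. now apply Rmult_le_compat_r.
Qed.

Lemma Kint_sinh z : 0 < z -> Kint sinh z = exp (- z) / z.
Proof.
  intros Hz. rewrite (Kint_ftc (fun _ => - / z)); auto using tame_const, tame_sinh1.
  - unfold Rdiv; ring.
  - intros u. unfold sinh, cosh. auto_derive; [easy|]. unfold Rdiv, Rminus. field. lra.
Qed.

Lemma sinh_le_cosh u : sinh u <= cosh u.
Proof. unfold sinh, cosh. assert (H := exp_pos (- u)). lra. Qed.

(** By [K_mono] the order 0 gives the smallest value, and there the pointwise bound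
    [z sinh u exp (- z cosh u) <= 1] leads to [exp (- z cosh u) >= z sinh u exp (- 2 z cosh u)],
    whose integral is explicit. *)
Lemma K_pos a z : 0 < z -> 0 < K a z.
Proof.
  intros Hz. apply Rlt_le_trans with (K 0 z).
  2:{ destruct (Rle_dec 0 a).
      - apply K_mono; [easy|]. rewrite Rabs_R0. lra.
      - rewrite <- (K_neg a). apply K_mono; [easy|]. rewrite Rabs_R0. lra. }
  apply Rlt_le_trans with (z * Kint sinh (2 * z)).
  - rewrite Kint_sinh by lra. apply Rmult_lt_0_compat; [easy|]. apply Rdiv_lt_0_compat; [apply exp_pos|lra].
  - unfold Kint. rewrite <- J_scal by (apply tame_dominated; [lra|apply tame_sinh1]).
    rewrite (J_ext _ (fun u => exp (- (2 * z) * cosh u) * (z * sinh u))) by (intros; ring).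
    apply J_le.
    + apply tame_dominated; [lra|]. apply (tame_mult (fun _ => z)); [apply tame_const|apply tame_sinh1].
    + apply (tame_dominated z (fun u => cosh (0 * u)) Hz (tame_cosh 0)).
    + intros u Hu. rewrite Rmult_0_l, cosh_0, Rmult_1_r.
      replace (- (2 * z) * cosh u) with (- z * cosh u + - z * cosh u) by ring. rewrite exp_plus.
      assert (H1 := exp_ineq1_le (z * cosh u)). assert (H2 := sinh_le_cosh u).
      assert (E : exp (- z * cosh u) * exp (z * cosh u) = 1).
      { rewrite <- exp_plus. replace (- z * cosh u + z * cosh u) with 0 by ring. apply exp_0. }
      assert (P := exp_pos (- z * cosh u)).
      assert (exp (- z * cosh u) * (z * sinh u) <= 1).
      { rewrite <- E. apply Rmult_le_compat_l; [lra|]. nra. }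
      rewrite Rmult_assoc. nra.
Qed.

(** * Large-argument behaviour of K *)

Definition nK (a z : R) : R := Rpower z (1 / 2) * exp z * K a z.
(** The number sqrt(pi/2), in the guise of a value that [nK_half] shows to be independent of the
    argument. *)
Definition kappa : R := nK (1 / 2) 1.

Lemma kappa_pos : 0 < kappa.
Proof.
  unfold kappa, nK. apply Rmult_lt_0_compat; [|apply K_pos; lra].
  apply Rmult_lt_0_compat; apply exp_pos.
Qed.

(** At order 1/2 the lower neighbour [-1/2] gives the same function by evenness, so [K_rec] and
    [K_derive] close up into a first-order equation, and [nK (1/2)] has derivative zero. *)
Lemma nK_half z : 0 < z -> nK (1 / 2) z = kappa.
Proof.
  assert (D : forall z, 0 < z -> is_derive (nK (1 / 2)) z 0).
  { intros y Hy.
    assert (H1 : is_derive (fun z => Rpower z (1 / 2) * exp z) y ((1 / 2 / y + 1) * (Rpower y (1 / 2) * exp y))).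
    { unfold Rpower. auto_derive; [lra|]. field. lra. }
    assert (H := is_derive_mult _ _ y _ _ H1 (K_derive (1 / 2) y Hy) Rmult_comm).
    unfold nK. unfold plus, mult in H; simpl in H.
    exact_derive H.
    assert (Hr := K_rec (1 / 2) y Hy).
    replace (1 / 2 - 1) with (- (1 / 2)) in * by lra. rewrite K_neg in *.
    replace (K (1 / 2 + 1) y) with (K (1 / 2) y + K (1 / 2) y / y).
    - field. lra.
    - apply Rmult_eq_reg_l with (y / 2); [|lra].
      replace (y / 2 * K (1 / 2 + 1) y) with (1 / 2 * K (1 / 2) y + y / 2 * K (1 / 2) y) by lra. field. lra. }
  intros Hz. unfold kappa.
  destruct (Rtotal_order z 1) as [H|[->|H]]; [|easy|].
  - apply (eq_is_derive (nK (1 / 2)) z 1); [|easy]. intros t Ht. apply D. lra.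
  - symmetry. apply (eq_is_derive (nK (1 / 2)) 1 z); [|easy]. intros t Ht. apply D. lra.
Qed.

Lemma nK_rec a z : 0 < z -> nK (a + 1) z = nK (a - 1) z + 2 * a * (/ z * nK a z).
Proof.
  intros Hz. unfold nK. assert (H := K_rec a z Hz).
  replace (2 * a * (/ z * (Rpower z (1 / 2) * exp z * K a z))) with
    (2 * / z * (Rpower z (1 / 2) * exp z) * (a * K a z)) by ring.
  rewrite H. field. lra.
Qed.

(** Two neighbouring orders are carried together through the three-term recurrence, in which the
    middle term has a factor [1/x] and leaves the limit unchanged. *)
Lemma nK_half_int (n : nat) : Oinf (nK (INR n + 1 / 2)) kappa /\ Oinf (nK (INR n - 1 / 2)) kappa.
Proof.
  induction n as [|n [IH1 IH2]].
  - simpl. replace (0 + 1 / 2) with (1 / 2) by lra. replace (0 - 1 / 2) with (- (1 / 2)) by lra.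
    split; (apply Oinf_ext with (fun _ => kappa) 0; [|apply Oinf_const]); intros x Hx.
    + now rewrite nK_half.
    + unfold nK. rewrite K_neg. symmetry. now apply nK_half.
  - rewrite S_INR. split.
    + apply Oinf_ext with (fun x => nK (INR n - 1 / 2) x + 2 * (INR n + 1 / 2) * (/ x * nK (INR n + 1 / 2) x)) 0.
      * intros x Hx. replace (INR n + 1 + 1 / 2) with (INR n + 1 / 2 + 1) by ring. rewrite (nK_rec (INR n + 1 / 2)) by easy.
        do 2 f_equal. lra.
      * replace kappa with (kappa + 2 * (INR n + 1 / 2) * (0 * kappa)) by ring.
        apply Oinf_plus; [easy|]. apply (Oinf_mult (fun _ => _)); [apply Oinf_const|].
        apply Oinf_mult; [apply Oinf_inv_x|easy].
    + replace (INR n + 1 - 1 / 2) with (INR n + 1 / 2) by lra. easy.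
Qed.

Lemma sinh_pos_le a b : 0 <= a <= b -> 0 <= sinh a <= sinh b.
Proof.
  intros H. unfold sinh.
  assert (exp a <= exp b) by (apply exp_le_compat; lra).
  assert (exp (- b) <= exp (- a)) by (apply exp_le_compat; lra).
  assert (exp (- a) <= exp a) by (apply exp_le_compat; lra). lra.
Qed.

(** Trades the frequency [n] for a factor [sinh v] independent of it; that factor carries the zero
    at [v = 0] needed in [cosh_diff_bound]. *)
Lemma sinh_mult_le (n : nat) v : 0 <= v -> sinh (INR n * v) <= INR n * (sinh v * cosh (INR n * v)).
Proof.
  intros Hv. induction n as [|n IH].
  - simpl. rewrite Rmult_0_l, sinh_0. lra.
  - rewrite S_INR. replace ((INR n + 1) * v) with (INR n * v + v) by ring.
    assert (E : sinh (INR n * v + v) = sinh (INR n * v) * cosh v + cosh (INR n * v) * sinh v).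
    { unfold sinh, cosh. rewrite Ropp_plus_distr, !exp_plus. field. }
    assert (E2 : cosh (INR n * v + v) = cosh (INR n * v) * cosh v + sinh (INR n * v) * sinh v).
    { unfold sinh, cosh. rewrite Ropp_plus_distr, !exp_plus. field. }
    rewrite E, E2.
    assert (Hn := pos_INR n).
    assert (S1 : 0 <= sinh v) by (apply (sinh_pos_le v v); lra).
    assert (S2 : 0 <= sinh (INR n * v)).
    { assert (0 <= INR n * v) by (apply Rmult_le_pos; lra). apply (sinh_pos_le (INR n * v) (INR n * v)); lra. }
    assert (C1 := cosh_ge_1 v). assert (C2 := cosh_ge_1 (INR n * v)).
    assert (sinh (INR n * v) * cosh v <= INR n * (sinh v * cosh (INR n * v)) * cosh v) by (apply Rmult_le_compat_r; lra).
    assert (0 <= sinh v * (sinh (INR n * v) * sinh v)) by (apply Rmult_le_pos; [easy|now apply Rmult_le_pos]).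
    assert (cosh (INR n * v) * sinh v <= cosh (INR n * v) * sinh v * cosh v).
    { rewrite <- (Rmult_1_r (cosh (INR n * v) * sinh v)) at 1. apply Rmult_le_compat_l; [nra|easy]. }
    nra.
Qed.

(* [cosh (a u) - cosh (b u)] vanishes to second order at [u = 0], like [cosh u - 1]. *)
Lemma cosh_diff_bound a b : exists (M : nat), forall u, 0 <= u ->
  Rabs (cosh (a * u) - cosh (b * u)) <= INR M ^ 2 * ((cosh u - 1) * cosh ((INR M + 1 / 2) * u)).
Proof.
  destruct (nfloor_ex (Rabs (a + b) + Rabs (a - b))) as [n Hn].
  { assert (H1 := Rabs_pos (a + b)). assert (H2 := Rabs_pos (a - b)). lra. }
  exists (S n). intros u Hu. set (m := INR (S n)).
  assert (Hm : Rabs (a + b) <= m /\ Rabs (a - b) <= m).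
  { unfold m. rewrite S_INR. assert (H1 := Rabs_pos (a + b)). assert (H2 := Rabs_pos (a - b)). lra. }
  (* The difference is a product of two hyperbolic sines in [u/2]; each is at most
     [m sinh (u/2) cosh (m u/2)], and the two factors [sinh (u/2)] recombine into
     [(cosh u - 1)/2]. *)
  assert (E : cosh (a * u) - cosh (b * u) = 2 * (sinh ((a + b) * (u / 2)) * sinh ((a - b) * (u / 2)))).
  { set (p := (a + b) * (u / 2)). set (q := (a - b) * (u / 2)).
    replace (a * u) with (p + q) by (unfold p, q; field). replace (b * u) with (p + - q) by (unfold p, q; field).
    unfold sinh, cosh. replace (- (p + - q)) with (- p + q) by ring. rewrite Ropp_plus_distr, !exp_plus. field. }
  assert (Hs : forall c, Rabs c <= m -> Rabs (sinh (c * (u / 2))) <= m * (sinh (u / 2) * cosh (m * (u / 2)))).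
  { intros c Hc. apply Rle_trans with (sinh (m * (u / 2))); [|apply sinh_mult_le; lra].
    assert (Hpos : forall d, 0 <= d <= m -> Rabs (sinh (d * (u / 2))) <= sinh (m * (u / 2))).
    { intros d Hd. destruct (sinh_pos_le (d * (u / 2)) (m * (u / 2))) as [H1 H2].
      split; [apply Rmult_le_pos; lra|apply Rmult_le_compat_r; lra]. now rewrite Rabs_right by lra. }
    destruct (Rle_dec 0 c).
    - apply Hpos. rewrite Rabs_right in Hc by lra. lra.
    - rewrite <- Rabs_Ropp. replace (- sinh (c * (u / 2))) with (sinh (- c * (u / 2))).
      + apply Hpos. rewrite Rabs_left in Hc by lra. lra.
      + unfold sinh. replace (- c * (u / 2)) with (- (c * (u / 2))) by ring. rewrite Ropp_involutive. field. }
  rewrite E, !Rabs_mult, (Rabs_right 2) by lra.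
  assert (H1 := Hs _ (proj1 Hm)). assert (H2 := Hs _ (proj2 Hm)).
  assert (Hprod := Rmult_le_compat _ _ _ _ (Rabs_pos _) (Rabs_pos _) H1 H2).
  assert (Ec : cosh u - 1 = 2 * (sinh (u / 2) * sinh (u / 2))).
  { assert (Hh := exp_plus (u / 2) (u / 2)). assert (Hh' := exp_plus (- (u / 2)) (- (u / 2))).
    replace (u / 2 + u / 2) with u in Hh by field. replace (- (u / 2) + - (u / 2)) with (- u) in Hh' by field.
    assert (E1 : exp (u / 2) * exp (- (u / 2)) = 1) by (rewrite <- exp_plus, Rplus_opp_r; apply exp_0).
    unfold sinh, cosh. rewrite Hh, Hh'. nra. }
  assert (E2 : cosh (m * (u / 2)) * cosh (m * (u / 2)) = / 2 * (cosh (m * u) + 1)).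
  { unfold cosh.
    assert (Hh := exp_plus (m * (u / 2)) (m * (u / 2))). assert (Hh' := exp_plus (- (m * (u / 2))) (- (m * (u / 2)))).
    replace (m * (u / 2) + m * (u / 2)) with (m * u) in Hh by field.
      replace (- (m * (u / 2)) + - (m * (u / 2))) with (- (m * u)) in Hh' by field.
    assert (E1 : exp (m * (u / 2)) * exp (- (m * (u / 2))) = 1) by (rewrite <- exp_plus, Rplus_opp_r; apply exp_0).
    rewrite Hh, Hh'. nra. }
  assert (Hm0 : 0 <= m) by (unfold m; apply pos_INR).
  (* The frequency is raised to the half-integer [m + 1/2], where the asymptotics of K are known. *)
  assert (E3 : / 2 * (cosh (m * u) + 1) <= cosh ((m + 1 / 2) * u)).
  { apply Rle_trans with (cosh (m * u)).
    - assert (H3 := cosh_ge_1 (m * u)). lra.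
    - apply cosh_le. assert (0 <= m * u) by (apply Rmult_le_pos; lra). rewrite Rabs_right; nra. }
  rewrite Ec.
  apply Rle_trans with (2 * (m * (sinh (u / 2) * cosh (m * (u / 2))) * (m * (sinh (u / 2) * cosh (m * (u / 2)))))); [lra|].
  replace (2 * (m * (sinh (u / 2) * cosh (m * (u / 2))) * (m * (sinh (u / 2) * cosh (m * (u / 2)))))) with
    (m ^ 2 * (2 * (sinh (u / 2) * sinh (u / 2))) * (cosh (m * (u / 2)) * cosh (m * (u / 2)))) by ring.
  rewrite E2, Rmult_assoc. apply Rmult_le_compat_l; [simpl; nra|].
  apply Rmult_le_compat_l; [|easy]. assert (0 <= sinh (u / 2) * sinh (u / 2)) by nra. lra.
Qed.

(** By [cosh_cosh], the majorant [(cosh u - 1) cosh (b u)] of [cosh_diff_bound] integrates to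
    [K_(b+1)/2 + K_(b-1)/2 - K_b]. These orders are half-integers with the common limit [kappa], so
    the normalised combination is [O(1/x)] and [nK a] inherits the limit of [nK (1/2)]. *)
Lemma nK_Oinf a : Oinf (nK a) kappa.
Proof.
  destruct (cosh_diff_bound a (1 / 2)) as [M HM]. set (b := INR M + 1 / 2).
  apply Oinf_squeeze with (fun x => INR M ^ 2 * (/ 2 * nK (b + 1) x + (/ 2 * nK (b - 1) x + -1 * nK b x))) 0.
  - intros x Hx.
    rewrite <- (nK_half x Hx). unfold nK.
    assert (Hpos : 0 < Rpower x (1 / 2) * exp x) by (apply Rmult_lt_0_compat; apply exp_pos).
    rewrite <- Rmult_minus_distr_l, Rabs_mult, (Rabs_right (_ * exp x)) by lra.
    replace (INR M ^ 2 * (/ 2 * (Rpower x (1 / 2) * exp x * K (b + 1) x) + (/ 2 * (Rpower x (1 / 2) * exp x * K (b - 1) x) +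
      -1 * (Rpower x (1 / 2) * exp x * K b x)))) with
      (Rpower x (1 / 2) * exp x * (INR M ^ 2 * (/ 2 * K (b + 1) x + / 2 * K (b - 1) x + -1 * K b x))) by ring.
    apply Rmult_le_compat_l; [lra|].
    set (q := fun u => INR M ^ 2 * (/ 2 * cosh ((b + 1) * u) + / 2 * cosh ((b - 1) * u) + -1 * cosh (b * u))).
    assert (Tc : forall c d, tame (fun u => c * cosh (d * u))).
    { intros c d. apply (tame_mult (fun _ => c)); [apply tame_const|apply tame_cosh]. }
    assert (Ts : tame (fun u => / 2 * cosh ((b + 1) * u) + / 2 * cosh ((b - 1) * u) + -1 * cosh (b * u))).
    { apply tame_plus; [apply tame_plus|]; apply Tc. }
    assert (Tq : tame q) by (apply (tame_mult (fun _ => INR M ^ 2)); [apply tame_const|easy]).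
    assert (Eq : Kint q x = INR M ^ 2 * (/ 2 * K (b + 1) x + / 2 * K (b - 1) x + -1 * K b x)).
    { unfold q. rewrite Kint_scal, Kint_plus, K_comb, Kint_scal by (easy || apply tame_cosh || apply Tc || apply tame_plus; apply Tc).
      reflexivity. }
    assert (Hq : forall u, 0 <= u -> Rabs (cosh (a * u) - cosh (1 / 2 * u)) <= q u).
    { intros u Hu. eapply Rle_trans; [now apply HM|]. right. unfold q. fold b.
      rewrite Rmult_minus_distr_r, cosh_cosh. ring. }
    assert (Ed : K a x - K (1 / 2) x = Kint (fun u => 1 * cosh (a * u) + -1 * cosh (1 / 2 * u)) x)
      by (rewrite K_comb by easy; ring).
    rewrite <- Eq, Ed. apply Rabs_le. split.
    + replace (- Kint q x) with (Kint (fun u => -1 * q u) x) by (rewrite Kint_scal by easy; ring).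
      apply Kint_le; [easy| |apply tame_plus; apply Tc|].
      * apply (tame_mult (fun _ => -1)); [apply tame_const|easy].
      * intros u Hu. specialize (Hq u Hu). apply Rabs_le_between in Hq. lra.
    + apply Kint_le; [easy|apply tame_plus; apply Tc|easy|].
      intros u Hu. specialize (Hq u Hu). apply Rabs_le_between in Hq. lra.
  - replace 0 with (INR M ^ 2 * (/ 2 * kappa + (/ 2 * kappa + -1 * kappa))) by field.
    assert (H1 := proj1 (nK_half_int (S M))). assert (H2 := proj1 (nK_half_int M)). assert (H3 := proj2 (nK_half_int M)).
    rewrite S_INR in H1. replace (INR M + 1 + 1 / 2) with (b + 1) in H1 by (unfold b; ring).
    replace (INR M - 1 / 2) with (b - 1) in H3 by (unfold b; lra). fold b in H2.
    repeat first [apply Oinf_plus | apply (Oinf_mult (fun _ => _)); [apply Oinf_const|]]; assumption.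
Qed.

(** * Small-argument behaviour of K *)

Definition nB (b z : R) : R := Rpower (z / 2) b * BesselK b z.

Lemma nB_pos b z : 0 < z -> 0 < nB b z.
Proof. intros Hz. apply Rmult_lt_0_compat; [apply exp_pos|now apply K_pos]. Qed.

(* [nB b] is the [b]-th moment of the measure of [exp v = (z/2) exp (+-u)], so pointwise
   inequalities between the functions [exp (b v)] carry over. *)
Lemma nB_comb c1 b1 c2 b2 c3 b3 z : 0 < z ->
  (forall v, 0 <= c1 * exp (b1 * v) + c2 * exp (b2 * v) + c3 * exp (b3 * v)) ->
  0 <= c1 * nB b1 z + c2 * nB b2 z + c3 * nB b3 z.
Proof.
  intros Hz H. set (L := ln (z / 2)).
  assert (Tc : forall c d, tame (fun u => c * cosh (d * u))).
  { intros c d. apply (tame_mult (fun _ => c)); [apply tame_const|apply tame_cosh]. }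
  assert (E : c1 * nB b1 z + c2 * nB b2 z + c3 * nB b3 z =
    Kint (fun u => c1 * exp (b1 * L) * cosh (b1 * u) + c2 * exp (b2 * L) * cosh (b2 * u) + c3 * exp (b3 * L) * cosh (b3 * u)) z).
  { rewrite Kint_plus, K_comb, Kint_scal by (easy || apply tame_cosh || apply Tc || apply tame_plus; apply Tc).
    rewrite Kint_cosh. unfold nB, Rpower. fold L. ring. }
  rewrite E. apply Kint_ge_0; [easy|repeat apply tame_plus; apply Tc|].
  intros u _. assert (H1 := H (L + u)). assert (H2 := H (L - u)).
  unfold Rminus in H2. rewrite !Rmult_plus_distr_l, !exp_plus in H1, H2.
  rewrite <- !Ropp_mult_distr_r in H2. unfold cosh. lra.
Qed.

(** From [cosh u = sinh u + exp (- u)]: the first part integrates to [exp (- z)/z], the second lies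
    between 0 and 1. *)
Lemma nB_1_bound z : 0 < z -> / 2 * (1 + - z) <= nB 1 z <= / 2 * (1 + z).
Proof.
  intros Hz. unfold nB. rewrite Rpower_1 by lra. rewrite <- Kint_cosh.
  assert (T : tame (fun u => exp (-1 * u))) by apply tame_exp.
  assert (Hj : Kint (fun u => exp (-1 * u)) z <= 1).
  { unfold Kint. replace 1 with (- (-1 * exp (- 0))) by (rewrite Ropp_0, exp_0; ring).
    assert (D : dominated (fun u => exp (- u))).
    { split; [intros u; apply (ex_derive_continuous (fun u => exp (- u))); auto_derive; easy|].
      exists 1. intros u _. rewrite Rabs_right by (apply Rle_ge, Rlt_le, exp_pos). lra. }
    rewrite <- (J_ftc (fun u => -1 * exp (- u)) (fun u => exp (- u)) 1).
    - apply J_le; [now apply tame_dominated; [lra|]|easy|].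
      intros u Hu. replace (-1 * u) with (- u) by ring. assert (P := exp_pos (- u)).
      assert (exp (- z * cosh u) <= 1).
      { rewrite <- exp_0. apply exp_le_compat. assert (Hc := cosh_ge_1 u). nra. }
      nra.
    - easy.
    - intros u. auto_derive; [easy|]. ring.
    - intros u _. rewrite Rabs_mult, Rabs_left by lra. rewrite Rabs_right by (apply Rle_ge, Rlt_le, exp_pos). lra. }
  assert (E : Kint (fun u => cosh (1 * u)) z = exp (- z) / z + Kint (fun u => exp (-1 * u)) z).
  { rewrite <- Kint_sinh, <- Kint_plus by (lra || apply tame_sinh1 || easy). apply Kint_ext.
    intros u. rewrite Rmult_1_l. unfold sinh, cosh. replace (-1 * u) with (- u) by ring. field. }
  rewrite E.
  assert (exp (- z) <= 1) by (rewrite <- exp_0; apply exp_le_compat; lra).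
  assert (Hx := exp_ineq1_le (- z)).
  assert (0 <= Kint (fun u => exp (-1 * u)) z).
  { apply Kint_ge_0; [lra|easy|]. intros; apply Rlt_le, exp_pos. }
  set (k := Kint (fun u => exp (-1 * u)) z) in *.
  assert (0 <= z * k <= z * 1) by (split; [apply Rmult_le_pos; lra|apply Rmult_le_compat_l; lra]).
  replace (z / 2 * (exp (- z) / z + k)) with (exp (- z) / 2 + z * k / 2) by (field; lra). lra.
Qed.

(** For [1 <= b <= 2] the inequality [y^b <= y + y^2] interpolates between the moments of orders 1
    and 2. Larger orders follow upwards by [K_rec], and [0 < b < 1] downwards from [b + 1], since
    [b K_b <= (z/2) K_(b+1)]. *)
Lemma nB_bounded b : 0 < b -> exists C, forall z, 0 < z < 1 -> nB b z <= C.
Proof.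
  assert (Hstep : forall b, 1 <= b -> (exists C, forall z, 0 < z < 1 -> nB b z <= C) ->
    exists C, forall z, 0 < z < 1 -> nB (b + 1) z <= C).
  { intros a Ha [C HC]. exists ((1 + a) * C). intros z Hz. specialize (HC z Hz).
    assert (H := K_rec a z ltac:(lra)). assert (Hp := nB_pos a z ltac:(lra)).
    assert (Hm : BesselK (a - 1) z <= BesselK a z) by (apply K_mono; [lra|apply Rabs_le; lra]).
    apply Rle_trans with ((1 + a) * nB a z); [|apply Rmult_le_compat_l; lra].
    unfold nB in *. rewrite Rpower_plus, Rpower_1 by lra.
    replace (Rpower (z / 2) a * (z / 2) * BesselK (a + 1) z) with
      (Rpower (z / 2) a * (a * BesselK a z + z / 2 * BesselK (a - 1) z)) by (rewrite H; ring).
    assert (P := exp_pos (a * ln (z / 2))). fold (Rpower (z / 2) a) in P.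
    assert (PK := K_pos (a - 1) z ltac:(lra)).
    replace ((1 + a) * (Rpower (z / 2) a * BesselK a z)) with (Rpower (z / 2) a * ((1 + a) * BesselK a z)) by ring.
    apply Rmult_le_compat_l; [lra|]. nra. }
  assert (H1 : exists C, forall z, 0 < z < 1 -> nB 1 z <= C).
  { exists 1. intros z Hz. assert (H := nB_1_bound z ltac:(lra)). lra. }
  assert (H2 : forall b, 1 <= b <= 2 -> exists C, forall z, 0 < z < 1 -> nB b z <= C).
  { intros a Ha. destruct H1 as [C1 HC1], (Hstep 1 ltac:(lra) (ex_intro _ C1 HC1)) as [C2 HC2].
    exists (C1 + C2). intros z Hz. specialize (HC1 z Hz). specialize (HC2 z Hz).
    assert (H := nB_comb 1 1 1 2 (-1) a z ltac:(lra)). replace (1 + 1) with 2 in HC2 by ring.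
    cut (0 <= 1 * nB 1 z + 1 * nB 2 z + -1 * nB a z); [lra|]. apply H. intros v.
    assert (P1 := exp_pos (1 * v)). assert (P2 := exp_pos (2 * v)).
    destruct (Rle_dec 0 v).
    - assert (exp (a * v) <= exp (2 * v)) by (apply exp_le_compat; nra). lra.
    - assert (exp (a * v) <= exp (1 * v)) by (apply exp_le_compat; nra). lra. }
  assert (H3 : forall n, 1 <= b <= INR n + 1 -> exists C, forall z, 0 < z < 1 -> nB b z <= C).
  { intros n. revert b. induction n as [|n IH]; intros b Hb.
    - simpl in Hb. apply H2. lra.
    - rewrite S_INR in Hb. destruct (Rle_dec b 2) as [Hb2|Hb2]; [apply H2; lra|].
      replace b with (b - 1 + 1) by ring. apply Hstep; [lra|]. apply IH. lra. }
  intros Hb. destruct (Rle_dec 1 b) as [Hb1|Hb1].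
  - destruct (nfloor_ex b ltac:(lra)) as [n Hn]. apply (H3 n). lra.
  - destruct (H2 (b + 1) ltac:(lra)) as [C HC]. exists (C / b). intros z Hz. specialize (HC z Hz).
    apply Rmult_le_reg_l with b; [easy|]. replace (b * (C / b)) with C by (field; lra).
    eapply Rle_trans; [|apply HC]. assert (H := K_rec b z ltac:(lra)). unfold nB.
    rewrite Rpower_plus, Rpower_1 by lra.
    replace (b * (Rpower (z / 2) b * BesselK b z)) with (Rpower (z / 2) b * (b * BesselK b z)) by ring.
    rewrite H. assert (P := exp_pos (b * ln (z / 2))). fold (Rpower (z / 2) b) in P.
    assert (PK := K_pos (b - 1) z ltac:(lra)). rewrite Rmult_assoc.
    apply Rmult_le_compat_l; [lra|]. apply Rmult_le_compat_l; lra.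
Qed.

(** An order [e] strictly between [|d|] and [c] dominates [K_d] while [(z/2)^e K_e] stays bounded,
    which leaves the positive power [(z/2)^(c-e)]. *)
Lemma K_negligible c d : Rabs d < c -> lim0 (fun z => Rpower (z / 2) c * BesselK d z) 0.
Proof.
  intros H. assert (Hd := Rabs_pos d). set (e := (c + Rabs d) / 2).
  destruct (nB_bounded e) as [C HC]; [unfold e; lra|].
  apply lim0_squeeze with (fun _ => 0) (fun z => C * Rpower (z / 2) (c - e)) 1; [lra| |apply lim0_const|].
  - intros x Hx. specialize (HC x Hx). assert (PK := K_pos d x ltac:(lra)).
    assert (P := exp_pos (c * ln (x / 2))). fold (Rpower (x / 2) c) in P. split; [nra|].
    apply Rle_trans with (Rpower (x / 2) (c - e) * nB e x).
    + unfold nB. rewrite <- Rmult_assoc, <- Rpower_plus. replace (c - e + e) with c by ring.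
      apply Rmult_le_compat_l; [lra|]. apply K_mono; [lra|unfold e; lra].
    + rewrite Rmult_comm. apply Rmult_le_compat_r; [apply Rlt_le, exp_pos|easy].
  - replace 0 with (C * 0) by ring. apply (lim0_mult (fun _ => C)); [apply lim0_const|].
    apply lim0_Rpower. unfold e; lra.
Qed.

(** The functional equation of Gamma in the limit: [K_rec] leaves the error [(z/2)^(b+1) K_(b-1)],
    negligible because [|b - 1| < b + 1]. *)
Lemma nB_step b : 0 < b -> lim0 (fun z => nB (b + 1) z + - b * nB b z) 0.
Proof.
  intros Hb. apply lim0_ext with (fun z => Rpower (z / 2) (b + 1) * BesselK (b - 1) z) 1; [lra| |].
  - intros x Hx. unfold nB. rewrite !Rpower_plus, Rpower_1 by lra.
    assert (H := K_rec b x ltac:(lra)).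
    replace (- b * (Rpower (x / 2) b * BesselK b x)) with (- Rpower (x / 2) b * (b * BesselK b x)) by ring.
    rewrite H. ring.
  - apply K_negligible. apply Rabs_def1; lra.
Qed.

Lemma nB_1 : lim0 (nB 1) (1 / 2).
Proof.
  apply lim0_squeeze with (fun z => / 2 * (1 + -1 * z)) (fun z => / 2 * 1 + / 2 * (z * 1)) 1; [lra| | |].
  - intros z Hz. assert (H := nB_1_bound z ltac:(lra)). lra.
  - replace (1 / 2) with (/ 2 * (1 + -1 * 0)) by field.
    apply (lim0_mult (fun _ => / 2)); [apply lim0_const|]. apply lim0_plus; [apply lim0_const|].
    apply (lim0_mult (fun _ => -1)); [apply lim0_const|apply lim0_id].
  - replace (1 / 2) with (/ 2 * 1 + / 2 * (0 * 1)) by field.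
    apply lim0_plus; [apply lim0_const|]. apply (lim0_mult (fun _ => / 2)); [apply lim0_const|].
    apply lim0_mult; [apply lim0_id|apply lim0_const].
Qed.

Lemma nB_nat n : lim0 (nB (INR n + 1)) (INR (fact n) / 2).
Proof.
  induction n as [|n IH].
  - simpl. rewrite Rplus_0_l. apply nB_1.
  - assert (Hn := pos_INR n).
    apply lim0_ext with (fun z => (nB (INR n + 1 + 1) z + - (INR n + 1) * nB (INR n + 1) z) + (INR n + 1) * nB (INR n + 1) z) 1; [lra| |].
    + intros x Hx. rewrite S_INR. ring.
    + replace (INR (fact (S n)) / 2) with (0 + (INR n + 1) * (INR (fact n) / 2))
        by (rewrite fact_simpl, mult_INR, S_INR; field).
      apply lim0_plus; [apply nB_step; lra|]. apply (lim0_mult (fun _ => _)); [apply lim0_const|easy].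
Qed.

Lemma nB_rpoch b n : 0 < b -> lim0 (fun z => nB (b + INR n) z + - rpoch b n * nB b z) 0.
Proof.
  intros Hb. induction n as [|n IH].
  - apply lim0_ext with (fun _ => 0) 1; [lra| |apply lim0_const].
    intros x Hx. simpl. rewrite Rplus_0_r. ring.
  - assert (Hn := pos_INR n).
    apply lim0_ext with (fun z => (nB (b + INR n + 1) z + - (b + INR n) * nB (b + INR n) z) +
      (b + INR n) * (nB (b + INR n) z + - rpoch b n * nB b z)) 1; [lra| |].
    + intros x Hx. rewrite S_INR, <- Rplus_assoc. cbn [rpoch]. ring.
    + replace 0 with (0 + (b + INR n) * 0) by ring.
      apply lim0_plus; [apply nB_step; lra|]. apply (lim0_mult (fun _ => _)); [apply lim0_const|easy].
Qed.

(** The sum, with weights [1 - th] and [th], of [1 + w <= exp w] at [w = - th v] and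
    [w = (1 - th) v], multiplied by [exp (th v)]. *)
Lemma exp_tangent_upper th v : 0 <= th <= 1 -> exp (th * v) <= 1 - th + th * exp v.
Proof.
  intros H. assert (H1 := exp_ineq1_le ((1 - th) * v)). assert (H2 := exp_ineq1_le (- th * v)).
  assert (P := exp_pos (th * v)).
  assert (E1 : exp v = exp (th * v) * exp ((1 - th) * v)) by (rewrite <- exp_plus; f_equal; ring).
  assert (E2 : exp (th * v) * exp (- th * v) = 1).
  { rewrite <- exp_plus. replace (th * v + - th * v) with 0 by ring. apply exp_0. }
  rewrite E1.
  assert (H3 : exp (th * v) * 1 <= exp (th * v) * ((1 - th) * exp (- th * v) + th * exp ((1 - th) * v)))
    by (apply Rmult_le_compat_l; [lra|nra]).
  replace (exp (th * v) * ((1 - th) * exp (- th * v) + th * exp ((1 - th) * v))) with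
    ((1 - th) * (exp (th * v) * exp (- th * v)) + th * (exp (th * v) * exp ((1 - th) * v))) in H3 by ring.
  rewrite E2 in H3. lra.
Qed.

Lemma exp_tangent_lower ph v : 0 <= ph -> 1 + ph - ph * exp v <= exp (- ph * v).
Proof.
  intros H. assert (H1 := exp_ineq1_le v). assert (H2 := exp_ineq1_le (- ph * v)). nra.
Qed.

(* With [y = exp v], [N = n + 1] and [th] in [0,1], the tangent lines at [y = N] of the concave [y^th]
   and of the convex [y^(th-1)] bound [nB (N + th)] by moments of integral order. *)
Lemma nB_upper (n : nat) th z : 0 <= th <= 1 -> 0 < z -> let N := INR n + 1 in
  nB (N + 1 + th) z <= Rpower N th * ((1 - th) * nB (N + 1) z + th / N * nB (N + 2) z).
Proof.
  intros Hth Hz N. assert (Hn := pos_INR n). assert (HN : 0 < N) by (unfold N; lra).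
  set (r := Rpower N th).
  assert (H := nB_comb (r * (1 - th)) (N + 1) (r * th / N) (N + 2) (-1) (N + 1 + th) z Hz).
  cut (0 <= r * (1 - th) * nB (N + 1) z + r * th / N * nB (N + 2) z + -1 * nB (N + 1 + th) z).
  { unfold Rdiv. lra. }
  apply H. intros v.
  assert (Ht := exp_tangent_upper th (v - ln N) Hth).
  replace (th * (v - ln N)) with (th * v + - (th * ln N)) in Ht by ring.
  replace (v - ln N) with (v + - ln N) in Ht by ring. rewrite !exp_plus, !exp_Ropp, exp_ln in Ht by easy.
  change (exp (th * ln N)) with r in Ht.
  assert (Hr : 0 < r) by apply exp_pos.
  replace ((N + 1 + th) * v) with ((N + 1) * v + th * v) by ring.
  replace ((N + 2) * v) with ((N + 1) * v + v) by ring. rewrite !exp_plus.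
  assert (P := exp_pos ((N + 1) * v)).
  replace (r * (1 - th) * exp ((N + 1) * v) + r * th / N * (exp ((N + 1) * v) * exp v) + -1 * (exp ((N + 1) * v) * exp (th * v)))
    with (exp ((N + 1) * v) * (r * (1 - th + th * (exp v * / N)) - r * (exp (th * v) * / r))) by (field; lra).
  apply Rmult_le_pos; [lra|]. rewrite <- Rmult_minus_distr_l. apply Rmult_le_pos; lra.
Qed.

Lemma nB_lower (n : nat) th z : 0 <= th <= 1 -> 0 < z -> let N := INR n + 1 in
  Rpower N th / N * ((2 - th) * nB (N + 2) z - (1 - th) / N * nB (N + 3) z) <= nB (N + 1 + th) z.
Proof.
  intros Hth Hz N. assert (Hn := pos_INR n). assert (HN : 0 < N) by (unfold N; lra).
  set (r := Rpower N th). assert (Hr : 0 < r) by apply exp_pos.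
  assert (H := nB_comb (- (r / N * (2 - th))) (N + 2) (r / N * ((1 - th) / N)) (N + 3) 1 (N + 1 + th) z Hz).
  cut (0 <= - (r / N * (2 - th)) * nB (N + 2) z + r / N * ((1 - th) / N) * nB (N + 3) z + 1 * nB (N + 1 + th) z).
  { lra. }
  apply H. intros v.
  assert (Ht := exp_tangent_lower (1 - th) (v - ln N) ltac:(lra)).
  replace (- (1 - th) * (v - ln N)) with (th * v + (- v + (ln N + - (th * ln N)))) in Ht by ring.
  replace (v - ln N) with (v + - ln N) in Ht by ring. rewrite !exp_plus, !exp_Ropp, exp_ln in Ht by easy.
  change (exp (th * ln N)) with r in Ht.
  replace ((N + 1 + th) * v) with ((N + 1) * v + th * v) by ring.
  replace ((N + 2) * v) with ((N + 1) * v + v) by ring.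
  replace ((N + 3) * v) with ((N + 1) * v + (v + v)) by ring. rewrite !exp_plus.
  assert (P := exp_pos ((N + 1) * v)). assert (Pv := exp_pos v).
  replace (- (r / N * (2 - th)) * (exp ((N + 1) * v) * exp v) + r / N * ((1 - th) / N) * (exp ((N + 1) * v) * (exp v * exp v)) +
     1 * (exp ((N + 1) * v) * exp (th * v))) with
    (exp ((N + 1) * v) * (exp v * (r / N)) * (exp (th * v) * (/ exp v * (N * / r)) - (1 + (1 - th) - (1 - th) * (exp v * / N)))).
  2:{ field. lra. }
  apply Rmult_le_pos; [|lra]. apply Rmult_le_pos; [lra|]. apply Rmult_le_pos; [lra|].
  apply Rlt_le, Rdiv_lt_0_compat; lra.
Qed.

(** The limits are taken one after the other: [n] is fixed first so that [l n] and [m n] are close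
    to [L], then [z] is made small for that [n]; the convergence in [z] may depend on [n]. *)
Lemma lim0_sandwich (f : R -> R) (u w : nat -> R -> R) (l m : nat -> R) (L : R) :
  (forall n, lim0 (u n) (l n)) -> (forall n, lim0 (w n) (m n)) ->
  (forall n z, 0 < z -> u n z <= f z <= w n z) ->
  is_lim_seq l L -> is_lim_seq m L -> lim0 f L.
Proof.
  intros Hu Hw H Hl Hm eps He.
  destruct (proj2 (is_lim_seq_spec _ _) Hl (mkposreal (eps / 2) ltac:(lra))) as [N1 H1].
  destruct (proj2 (is_lim_seq_spec _ _) Hm (mkposreal (eps / 2) ltac:(lra))) as [N2 H2].
  simpl in H1, H2. set (n := max N1 N2).
  specialize (H1 n ltac:(lia)). specialize (H2 n ltac:(lia)).
  destruct (Hu n (eps / 2) ltac:(lra)) as [d1 [Hd1 H3]], (Hw n (eps / 2) ltac:(lra)) as [d2 [Hd2 H4]].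
  exists (Rmin d1 d2). split; [now apply Rmin_pos|]. intros x Hx.
  assert (H5 := Rmin_l d1 d2). assert (H6 := Rmin_r d1 d2).
  specialize (H3 x ltac:(lra)). specialize (H4 x ltac:(lra)). specialize (H n x ltac:(lra)).
  apply Rlt_le, Rabs_le_between in H1, H2. apply Rabs_le_between in H3, H4. apply Rabs_le. lra.
Qed.

Lemma lim_INR_plus_1 c : is_lim_seq (fun n => 1 + c * / (INR n + 1)) 1.
Proof.
  replace (Finite 1) with (Finite (1 + c * 0)) by (f_equal; ring).
  apply is_lim_seq_plus'; [apply is_lim_seq_const|]. apply is_lim_seq_mult'; [apply is_lim_seq_const|].
  apply is_lim_seq_ext with (fun n => / INR (S n)); [intros n; now rewrite S_INR|].
  apply (is_lim_seq_incr_1 (fun n => / INR n)), is_lim_seq_inv_INR.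
Qed.

(** [nB_rpoch] relates [nB th] to [nB (th + n + 2)] up to an error vanishing with [z], and
    [nB_lower], [nB_upper] enclose the latter between moments of integral order, whose limits are
    factorials. After division by [(th)_(n+2)] both limits are half the reciprocal of a Gauss term,
    times factors [1 + O(1/n)]. *)
Lemma nB_Gamma_unit th : 0 < th <= 1 -> lim0 (nB th) (/ (2 * rg th)).
Proof.
  intros Hth. assert (Hrg := rg_pos th ltac:(lra)).
  set (N := fun n : nat => INR n + 1).
  assert (HN : forall n, 0 < N n) by (intros n; unfold N; assert (H := pos_INR n); lra).
  (* The numerator of the Gauss term of index [n + 1], which is why [S n] appears in [Hg]. *)
  set (rp := fun n => rpoch th (S (S n))).
  assert (Hrp : forall n, 0 < rp n) by (intros n; apply rpoch_pos; lra).
  set (D := fun n z => nB (N n + 1 + th) z + - rp n * nB th z).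
  assert (HD : forall n, lim0 (D n) 0).
  { intros n. apply lim0_ext with (fun z => nB (th + INR (S (S n))) z + - rp n * nB th z) 1; [lra| |].
    - intros x Hx. unfold D. do 2 f_equal. unfold N. rewrite !S_INR. ring.
    - apply nB_rpoch. lra. }
  assert (Hg : forall n, rgauss th (S n) = rp n / (INR (fact (S n)) * Rpower (N n) th)).
  { intros n. unfold rgauss, rp, N. now rewrite <- S_INR. }
  assert (H1 : forall n, lim0 (nB (N n + 1)) (INR (fact (S n)) / 2)).
  { intros n. unfold N. rewrite <- S_INR. apply nB_nat. }
  assert (H2 : forall n, lim0 (nB (N n + 2)) ((N n + 1) * INR (fact (S n)) / 2)).
  { intros n. replace (N n + 2) with (INR (S (S n)) + 1) by (unfold N; rewrite !S_INR; ring).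
    replace ((N n + 1) * INR (fact (S n)) / 2) with (INR (fact (S (S n))) / 2); [apply nB_nat|].
    rewrite (fact_simpl (S n)), mult_INR. unfold N. now rewrite <- !S_INR. }
  assert (H3 : forall n, lim0 (nB (N n + 3)) ((N n + 2) * (N n + 1) * INR (fact (S n)) / 2)).
  { intros n. replace (N n + 3) with (INR (S (S (S n))) + 1) by (unfold N; rewrite !S_INR; ring).
    replace ((N n + 2) * (N n + 1) * INR (fact (S n)) / 2) with (INR (fact (S (S (S n)))) / 2); [apply nB_nat|].
    rewrite (fact_simpl (S (S n))), mult_INR, (fact_simpl (S n)), mult_INR. unfold N.
      rewrite (S_INR (S (S n))), (S_INR (S n)), (S_INR n). field. }
  assert (Hlim : is_lim_seq (fun n => / (2 * rgauss th (S n))) (/ (2 * rg th))).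
  { apply (is_lim_seq_inv _ (Finite (2 * rg th))); [|intros E; injection E; lra].
    apply is_lim_seq_mult'; [apply is_lim_seq_const|]. apply (is_lim_seq_incr_1 (rgauss th)), rg_lim. }
  assert (Hfact : forall n, 0 < INR (fact (S n))) by (intros; apply INR_fact_lt_0).
  assert (HR : forall n, 0 < Rpower (N n) th) by (intros; apply exp_pos).
  apply (lim0_sandwich _
    (fun n z => / rp n * (Rpower (N n) th / N n * ((2 - th) * nB (N n + 2) z + - ((1 - th) / N n) * nB (N n + 3) z) + -1 * D n z))
    (fun n z => / rp n * (Rpower (N n) th * ((1 - th) * nB (N n + 1) z + th / N n * nB (N n + 2) z) + -1 * D n z))
    (fun n => (1 + 1 * / (INR n + 1)) * (1 + -2 * (1 - th) * / (INR n + 1)) * / (2 * rgauss th (S n)))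
    (fun n => (1 + th * / (INR n + 1)) * / (2 * rgauss th (S n)))).
  - intros n. fold (N n).
    replace ((1 + 1 * / N n) * (1 + -2 * (1 - th) * / N n) * / (2 * rgauss th (S n))) with
      (/ rp n * (Rpower (N n) th / N n * ((2 - th) * ((N n + 1) * INR (fact (S n)) / 2) + - ((1 - th) / N n) * ((N n + 2) * (N n
        + 1) * INR (fact (S n)) / 2)) + -1 * 0)).
    2:{ rewrite Hg. specialize (HN n). specialize (Hrp n). specialize (Hfact n). specialize (HR n). field. repeat split; lra. }
    repeat first [apply HD | apply H2 | apply H3 | apply lim0_plus | apply (lim0_mult (fun _ => _)); [apply lim0_const|]].
  - intros n. fold (N n).
    replace ((1 + th * / N n) * / (2 * rgauss th (S n))) with
      (/ rp n * (Rpower (N n) th * ((1 - th) * (INR (fact (S n)) / 2) + th / N n * ((N n + 1) * INR (fact (S n)) / 2)) + -1 * 0)).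
    2:{ rewrite Hg. specialize (HN n). specialize (Hrp n). specialize (Hfact n). specialize (HR n). field. repeat split; lra. }
    repeat first [apply HD | apply H1 | apply H2 | apply lim0_plus | apply (lim0_mult (fun _ => _)); [apply lim0_const|]].
  - intros n z Hz. assert (Hu := nB_upper n th z ltac:(lra) Hz). assert (Hl := nB_lower n th z ltac:(lra) Hz).
    cbv zeta in Hu, Hl. fold (N n) in Hu, Hl.
    assert (E : nB th z = / rp n * (nB (N n + 1 + th) z + -1 * D n z)).
    { unfold D. specialize (Hrp n). field. lra. }
    assert (Hi : 0 < / rp n) by now apply Rinv_0_lt_compat.
    rewrite E. split; apply Rmult_le_compat_l; lra.
  - replace (Finite (/ (2 * rg th))) with (Finite (1 * 1 * / (2 * rg th))) by (f_equal; ring).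
    apply is_lim_seq_mult'; [apply is_lim_seq_mult'; apply lim_INR_plus_1|exact Hlim].
  - replace (Finite (/ (2 * rg th))) with (Finite (1 * / (2 * rg th))) by (f_equal; ring).
    apply is_lim_seq_mult'; [apply lim_INR_plus_1|exact Hlim].
Qed.

Lemma nB_Gamma b : 0 < b -> lim0 (nB b) (/ (2 * rg b)).
Proof.
  assert (H : forall n b, 0 < b <= INR n + 1 -> lim0 (nB b) (/ (2 * rg b))).
  { induction n as [|n IH]; intros a Ha.
    - apply nB_Gamma_unit. simpl in Ha. lra.
    - destruct (Rle_dec a 1) as [Ha1|Ha1]; [apply nB_Gamma_unit; lra|].
      rewrite S_INR in Ha. specialize (IH (a - 1) ltac:(lra)).
      assert (Hr := rg_rec (a - 1)). replace (a - 1 + 1) with a in Hr by ring.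
      assert (Hp := rg_pos a ltac:(lra)).
      apply lim0_ext with (fun z => (nB (a - 1 + 1) z + - (a - 1) * nB (a - 1) z) + (a - 1) * nB (a - 1) z) 1; [lra| |].
      + intros x Hx. replace (a - 1 + 1) with a by ring. ring.
      + replace (/ (2 * rg a)) with (0 + (a - 1) * / (2 * rg (a - 1))) by (rewrite Hr; field; lra).
        apply lim0_plus; [apply nB_step; lra|]. apply (lim0_mult (fun _ => _)); [apply lim0_const|easy]. }
  intros Hb. destruct (nfloor_ex b ltac:(lra)) as [n Hn]. apply (H n). lra.
Qed.

(** Put [y = (x/2) exp u], so that [x cosh u = y + (x/2) exp (- u)] lies between [y] and [y + x/2].
    The bounds [(1 - y)/(1 + y)^2 <= exp (- y) <= 1/(1 + y)] replace the kernel by rational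
    functions of [exp u] with elementary primitives; the lower one equals
    [1/(1 + y) - 2 y/(1 + y)^2], and the integral of [y/(1 + y)^2] is at most 1, whence the constant
    2. *)
Lemma K_0_bounds x : 0 < x -> let L := - ln (x / 2) in
  exp (- (x / 2)) * (ln (1 + exp L) - 2) <= BesselK 0 x <= ln (1 + exp L).
Proof.
  intros Hx L.
  assert (HL : exp L = 2 / x).
  { unfold L. rewrite exp_Ropp, exp_ln by lra. field. lra. }
  set (y := fun u => exp (u - L)).
  assert (Hy : forall u, y u = x / 2 * exp u).
  { intros u. unfold y, Rminus. rewrite exp_plus, exp_Ropp, HL. field. lra. }
  assert (Py : forall u, 0 < y u) by (intros; apply exp_pos).
  assert (Pi : forall u, 0 < / (1 + y u)) by (intros u; apply Rinv_0_lt_compat; specialize (Py u); lra).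
  assert (Ebound : forall u, / (1 + y u) <= exp L * exp (- u)).
  { intros u. replace (exp L * exp (- u)) with (/ y u).
    - apply Rinv_le_contravar; [apply Py|lra].
    - unfold y, Rminus. rewrite <- exp_plus, <- exp_Ropp. f_equal. ring. }
  assert (D1 : dominated (fun u => / (1 + y u))).
  { split.
    - intros u. apply (ex_derive_continuous (fun u => / (1 + y u))). unfold y. auto_derive. repeat split. specialize (Py u).
      unfold y, Rminus in Py. lra.
    - exists (exp L). intros u _. rewrite Rabs_right by (apply Rle_ge, Rlt_le, Pi). apply Ebound. }
  assert (D2 : dominated (fun u => y u / (1 + y u) ^ 2)).
  { split.
    - intros u. apply (ex_derive_continuous (fun u => y u / (1 + y u) ^ 2)). unfold y. auto_derive. repeat split.
      specialize (Py u). unfold y, Rminus in *. apply Rgt_not_eq, Rmult_lt_0_compat; lra.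
    - exists (exp L). intros u _. specialize (Py u). specialize (Pi u).
      replace (y u / (1 + y u) ^ 2) with (/ (1 + y u) * (y u * / (1 + y u))) by (field; lra).
      assert (0 < y u * / (1 + y u) <= 1).
      { split; [nra|]. apply Rmult_le_reg_r with (1 + y u); [lra|]. rewrite Rmult_assoc, Rinv_l; lra. }
      rewrite Rabs_right by nra. specialize (Ebound u). nra. }
  assert (J1 : J (fun u => / (1 + y u)) = ln (1 + exp L)).
  { rewrite (J_ftc (fun u => - ln (1 + exp (L - u))) _ (exp L)); auto.
    - rewrite Rminus_0_r. ring.
    - intros u. assert (P := exp_pos (L - u)). auto_derive; [unfold Rminus in P; lra|].
      unfold y. replace (u - L) with (- (L - u)) by ring. rewrite exp_Ropp. unfold Rminus in *. field. lra.
    - intros u _. assert (P := exp_pos (L - u)).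
      assert (0 <= ln (1 + exp (L - u)) <= exp (L - u)).
      { split; [rewrite <- ln_1; apply ln_le; lra|].
        rewrite <- (ln_exp (exp (L - u))) at 2. apply ln_le; [lra|]. apply exp_ineq1_le. }
      rewrite Rabs_Ropp, Rabs_right by lra. rewrite <- exp_plus. apply H. }
  assert (J2 : J (fun u => y u / (1 + y u) ^ 2) <= 1).
  { rewrite (J_ftc (fun u => - / (1 + y u)) _ (exp L)); auto.
    - rewrite Ropp_involutive. specialize (Py 0). rewrite <- Rinv_1. apply Rinv_le_contravar; lra.
    - intros u. specialize (Py u). unfold y, Rminus in *. auto_derive; [lra|]. field. lra.
    - intros u _. rewrite Rabs_Ropp, Rabs_right by (apply Rle_ge, Rlt_le, Pi). apply Ebound. }
  assert (D0 := tame_dominated x (fun u => cosh (0 * u)) Hx (tame_cosh 0)).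
  assert (Dscal := dominated_scal).
  assert (Dplus := dominated_plus).
  split.
  - apply Rle_trans with (exp (- (x / 2)) * (J (fun u => / (1 + y u)) + -2 * J (fun u => y u / (1 + y u) ^ 2))).
    + apply Rmult_le_compat_l; [apply Rlt_le, exp_pos|]. lra.
    + rewrite <- (J_scal (-2)), <- J_plus, <- J_scal by auto. apply J_le; auto.
      intros u Hu. rewrite Rmult_0_l, cosh_0, Rmult_1_r.
      apply Rle_trans with (exp (- (x / 2)) * exp (- y u)).
      * apply Rmult_le_compat_l; [apply Rlt_le, exp_pos|].
        specialize (Py u). assert (He := exp_ineq1_le (- y u)). assert (Pe := exp_pos (- y u)).
        replace (/ (1 + y u) + -2 * (y u / (1 + y u) ^ 2)) with ((1 - y u) / (1 + y u) ^ 2) by (field; lra).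
        assert (0 < (1 + y u) ^ 2) by (simpl; nra).
        apply Rmult_le_reg_r with ((1 + y u) ^ 2); [easy|].
        replace ((1 - y u) / (1 + y u) ^ 2 * (1 + y u) ^ 2) with (1 - y u) by (field; lra).
        apply Rle_trans with (exp (- y u)); [lra|].
        rewrite <- (Rmult_1_r (exp (- y u))) at 1. apply Rmult_le_compat_l; [lra|]. simpl. nra.
      * rewrite <- exp_plus. apply exp_le_compat. rewrite Hy. unfold cosh.
        assert (exp (- u) <= 1) by (rewrite <- exp_0; apply exp_le_compat; lra). nra.
  - rewrite <- J1. apply J_le; auto. intros u _. rewrite Rmult_0_l, cosh_0, Rmult_1_r.
    apply Rle_trans with (exp (- y u)).
    + apply exp_le_compat. rewrite Hy. assert (H := cosh_ge_half_exp u). nra.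
    + rewrite exp_Ropp. apply Rinv_le_contravar; [specialize (Py u); lra|apply exp_ineq1_le].
Qed.

Lemma lim0_inv_ln : lim0 (fun x => / - ln (x / 2)) 0.
Proof.
  intros eps He. exists (2 * exp (- / eps)). assert (P := exp_pos (- / eps)).
  split; [lra|]. intros x Hx. rewrite Rminus_0_r.
  assert (Hi : 0 < / eps) by now apply Rinv_0_lt_compat.
  assert (Hl : ln (x / 2) < - / eps).
  { rewrite <- (ln_exp (- / eps)). apply ln_increasing; lra. }
  rewrite Rabs_right by (apply Rle_ge, Rlt_le, Rinv_0_lt_compat; lra).
  rewrite <- (Rinv_inv eps). apply Rinv_le_contravar; lra.
Qed.

Lemma K_0_log : lim0 (fun x => BesselK 0 x / - ln (x / 2)) 1.
Proof.
  assert (HLpos : forall x, 0 < x < 2 -> 0 < - ln (x / 2)).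
  { intros x Hx. assert (ln (x / 2) < 0) by (rewrite <- ln_1; apply ln_increasing; lra). lra. }
  assert (B : forall x, 0 < x < 2 -> - ln (x / 2) <= ln (1 + exp (- ln (x / 2))) <= - ln (x / 2) + x / 2).
  { intros x Hx. assert (P := exp_pos (- ln (x / 2))). split.
    - rewrite <- (ln_exp (- ln (x / 2))) at 1. apply ln_le; lra.
    - rewrite <- (ln_exp (- ln (x / 2) + x / 2)). apply ln_le; [lra|].
      rewrite exp_plus, exp_Ropp, exp_ln by lra. assert (H := exp_ineq1_le (x / 2)).
      apply Rmult_le_reg_l with (x / 2); [lra|]. rewrite Rmult_plus_distr_l, <- Rmult_assoc, Rinv_r by lra. lra. }
  (* The radius [2 exp (-2)] ensures [- ln (x/2) > 2], so that the factor [L - 2] of the lower bound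
     is positive when [exp (- x/2)] is replaced by [1 - x/2]. *)
  apply lim0_squeeze with (fun x => (1 + - / 2 * x) * (1 + -2 * / - ln (x / 2))) (fun x => 1 + / 2 * (x * / - ln (x / 2))) (2 * exp (-2)).
  - assert (P := exp_pos (-2)). lra.
  - intros x Hx.
    assert (He : exp (-2) < 1) by (rewrite <- exp_0; apply exp_increasing; lra).
    assert (HLp := HLpos x ltac:(lra)). specialize (B x ltac:(lra)).
    assert (HK := K_0_bounds x ltac:(lra)). cbv zeta in HK.
    assert (HL2 : 2 < - ln (x / 2)).
    { assert (ln (x / 2) < -2) by (rewrite <- (ln_exp (-2)); apply ln_increasing; lra). lra. }
    set (L := - ln (x / 2)) in *.
    assert (Hex := exp_ineq1_le (- (x / 2))).
    split.
    + apply Rmult_le_reg_r with L; [lra|]. unfold Rdiv. rewrite (Rmult_assoc (BesselK 0 x)), Rinv_l by lra.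
      replace ((1 + - / 2 * x) * (1 + -2 * / L) * L) with ((1 + - (x / 2)) * (L - 2)) by (field; lra).
      rewrite Rmult_1_r. eapply Rle_trans; [|apply HK].
      apply Rle_trans with (exp (- (x / 2)) * (L - 2)); [apply Rmult_le_compat_r; lra|].
      apply Rmult_le_compat_l; [apply Rlt_le, exp_pos|lra].
    + apply Rmult_le_reg_r with L; [lra|]. unfold Rdiv. rewrite (Rmult_assoc (BesselK 0 x)), Rinv_l by lra.
      replace ((1 + / 2 * (x * / L)) * L) with (L + x / 2) by (field; lra). lra.
  - refine (eq_ind ((1 + - / 2 * 0) * (1 + -2 * 0)) (lim0 _) _ 1 _); [|field].
    repeat first [apply lim0_inv_ln | apply lim0_id | apply lim0_const | apply lim0_mult | apply lim0_plus].
  - refine (eq_ind (1 + / 2 * (0 * 0)) (lim0 _) _ 1 _); [|field].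
    repeat first [apply lim0_inv_ln | apply lim0_id | apply lim0_const | apply lim0_mult | apply lim0_plus].
Qed.

(** * The function I *)

Lemma Cmod_ge_sub (a b : CC) : Cmod b - Cmod a <= Cmod (a + b)%C.
Proof.
  assert (H := Cmod_triangle (a + b)%C (- a)%C). rewrite Cmod_opp in H.
  replace (a + b + - a)%C with b in H by ring. lra.
Qed.

(** Once [n > |al|], the relation [rgamma w = w * rgamma (w + 1)] with [|w| >= 1] makes the moduli
    nonincreasing in [n]; finitely many terms remain. *)
Lemma rgamma_shift_bounded (al : CC) :
  exists B, 0 <= B /\ forall n : nat, Cmod (rgamma (al + RtoC (INR n + 1))%C) <= B.
Proof.
  destruct (nfloor_ex (Cmod al) (Cmod_ge_0 al)) as [N0 HN].
  set (N := S N0). assert (HN' : INR N = INR N0 + 1) by apply S_INR.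
  set (u := fun n : nat => Cmod (rgamma (al + RtoC (INR n + 1))%C)).
  assert (Hdec : forall k, u (N + k)%nat <= u N).
  { induction k as [|k IH]; [rewrite Nat.add_0_r; lra|].
    apply Rle_trans with (2 := IH). unfold u.
    rewrite (rgamma_rec (al + RtoC (INR (N + k) + 1))%C), Cmod_mult.
    replace (al + RtoC (INR (N + k) + 1) + RtoC 1)%C with (al + RtoC (INR (N + S k) + 1))%C.
    2:{ rewrite Nat.add_succ_r, S_INR, !RtoC_plus. ring. }
    assert (Hm := Cmod_ge_sub al (RtoC (INR (N + k) + 1))). rewrite Cmod_R, Rabs_right in Hm.
    2:{ assert (H := pos_INR (N + k)). lra. }
    assert (Hk := pos_INR k).
    assert (Hg := Cmod_ge_0 (rgamma (al + RtoC (INR (N + S k) + 1))%C)).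
    rewrite <- (Rmult_1_l (Cmod (rgamma (al + RtoC (INR (N + S k) + 1))%C))) at 1.
    apply Rmult_le_compat_r; [easy|].
    rewrite plus_INR in *. lra. }
  assert (HF : forall M, exists B, 0 <= B /\ forall n, (n < M)%nat -> u n <= B).
  { induction M as [|M [B [HB0 HB]]]. exists 0; split; [lra|]; intros; lia.
    exists (Rmax B (u M)). split; [eapply Rle_trans; [apply HB0|apply Rmax_l]|]. intros k Hk.
    destruct (Nat.eq_dec k M) as [->|]; [apply Rmax_r|].
    eapply Rle_trans; [apply HB; lia|apply Rmax_l]. }
  destruct (HF (S N)) as [B [HB0 HB]]. exists B. split; [easy|]. intros n.
  destruct (Nat.lt_ge_cases n (S N)) as [Hn|Hn]; [now apply HB|].
  replace n with (N + (n - N))%nat by lia. eapply Rle_trans; [apply Hdec|]. apply HB. lia.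
Qed.

(* Coefficients of [Itilde al] as a power series in [(z/2)^2]. *)
Definition cI (al : CC) (n : nat) : CC :=
  (RtoC (/ INR (fact n)) * rgamma (al + RtoC (INR n + 1)))%C.

Lemma cI_bound (al : CC) : exists B, 0 <= B /\
  forall n, Rabs (Re (cI al n)) <= B * / INR (fact n) /\ Rabs (Im (cI al n)) <= B * / INR (fact n).
Proof.
  destruct (rgamma_shift_bounded al) as [B [HB H]]. exists B. split; [easy|]. intros n.
  assert (Hf : 0 < / INR (fact n)) by (apply Rinv_0_lt_compat, INR_fact_lt_0).
  assert (Hc : Cmod (cI al n) <= B * / INR (fact n)).
  { unfold cI. rewrite Cmod_mult, Cmod_R, Rabs_right by lra. rewrite Rmult_comm.
    apply Rmult_le_compat_r; [lra|apply H]. }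
  split; (eapply Rle_trans; [|exact Hc]); [apply Re_le_Cmod|apply Im_le_Cmod].
Qed.

Lemma Itilde_Re al z : Re (Itilde al z) = Series (fun n => Re (cI al n) * ((z / 2) ^ 2) ^ n).
Proof.
  unfold Itilde, Cseries. apply Series_ext. intros n.
  unfold cI. rewrite pow_mult. unfold Re; simpl. unfold Rdiv. ring.
Qed.

Lemma Itilde_Im al z : Im (Itilde al z) = Series (fun n => Im (cI al n) * ((z / 2) ^ 2) ^ n).
Proof.
  unfold Itilde, Cseries. apply Series_ext. intros n.
  unfold cI. rewrite pow_mult. unfold Im; simpl. unfold Rdiv. ring.
Qed.

Lemma ex_series_fact (a : nat -> R) B w : (forall n, Rabs (a n) <= B * / INR (fact n)) ->
  ex_series (fun n => Rabs (a n * w ^ n)).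
Proof.
  intros H.
  apply (ex_series_le (K := R_AbsRing) (V := R_CompleteNormedModule) _ (fun n => B * (/ INR (fact n) * Rabs w ^ n))).
  - intros n. unfold norm; simpl; unfold abs; simpl. rewrite Rabs_Rabsolu, Rabs_mult, <- RPow_abs.
    rewrite <- Rmult_assoc. apply Rmult_le_compat_r; [apply pow_le, Rabs_pos|apply H].
  - apply (ex_series_scal (K := R_AbsRing) (V := R_NormedModule) B). exists (exp (Rabs w)).
    apply is_pseries_R. apply is_exp_Reals.
Qed.

(** [Lc] works with powers of [z] itself, so the series in [(z/2)^2] is rewritten with vanishing odd
    coefficients and the factor [4^(-k)]. *)
Definition even_coef (a : nat -> CC) (k : nat) : CC :=
  if Nat.even k then (RtoC (/ 4 ^ Nat.div2 k) * a (Nat.div2 k))%C else RtoC 0.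

Lemma even_coef_0 a : even_coef a 0 = a O.
Proof. unfold even_coef; simpl. rewrite Rinv_1. ring. Qed.

Lemma cpsum_even a n z : cpsum (even_coef a) (2 * n) z = cpsum a n ((z / 2) ^ 2).
Proof.
  induction n as [|n IH]; [reflexivity|].
  replace (2 * S n)%nat with (S (S (2 * n))) by lia.
  cbn [cpsum]. rewrite IH.
  assert (E1 : even_coef a (2 * n) = (RtoC (/ 4 ^ n) * a n)%C).
  { unfold even_coef. rewrite Nat.div2_double, Nat.even_mul. reflexivity. }
  assert (E2 : even_coef a (S (2 * n)) = RtoC 0).
  { unfold even_coef. rewrite Nat.even_succ, <- Nat.negb_even, Nat.even_mul. reflexivity. }
  rewrite E1, E2.
  replace (((z / 2) ^ 2) ^ n) with (/ 4 ^ n * z ^ (2 * n)).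
  - rewrite RtoC_mult. ring.
  - rewrite pow_mult. replace ((z / 2) ^ 2) with (/ 4 * z ^ 2) by field.
    rewrite Rpow_mult_distr, pow_inv. reflexivity.
Qed.

Lemma Itilde_expands al n : expands (Itilde al) (even_coef (cI al)) n.
Proof.
  (* [cpsum_even] covers only even truncation orders; the expansion to order [2 n] contains the one
     to order [n]. *)
  apply expands_le with (2 * n)%nat; [lia|].
  destruct (cI_bound al) as [B [HB H]].
  assert (Hf : forall k, B * / INR (fact k) <= B * 1 ^ k).
  { intros k. rewrite pow1. apply Rmult_le_compat_l; [easy|]. rewrite <- Rinv_1.
    apply Rinv_le_contravar; [lra|]. apply (le_INR 1). apply lt_O_fact. }
  exists (4 * B), 1. split; [lra|]. intros z Hz. rewrite cpsum_even.
  set (w := (z / 2) ^ 2). assert (Hw : 0 <= w <= 1 / 2 /\ w <= z ^ 2) by (unfold w; simpl; nra).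
  assert (Hwn : (1 * w) ^ n <= z ^ (2 * n)) by (rewrite Rmult_1_l, pow_mult; apply pow_incr; lra).
  eapply Rle_trans; [apply Cmod_le_Re_Im|].
  replace (Re (Itilde al z - cpsum (cI al) n w)%C) with (Re (Itilde al z) - Re (cpsum (cI al) n w)) by reflexivity.
  replace (Im (Itilde al z - cpsum (cI al) n w)%C) with (Im (Itilde al z) - Im (cpsum (cI al) n w)) by reflexivity.
  rewrite Re_cpsum, Im_cpsum, Itilde_Re, Itilde_Im. fold w.
  assert (T1 := pseries_tail (fun k => Re (cI al k)) B 1 w (Series (fun n => Re (cI al n) * w ^ n)) n).
  assert (T2 := pseries_tail (fun k => Im (cI al k)) B 1 w (Series (fun n => Im (cI al n) * w ^ n)) n).
  assert (H1 : Rabs (Series (fun n => Re (cI al n) * w ^ n) - psum (fun k => Re (cI al k)) n w) <= 2 * B * (1 * w) ^ n).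
  { apply T1; try lra. intros k; eapply Rle_trans; [apply H|apply Hf].
    apply Series_correct, ex_series_Rabs. apply ex_series_fact with B. intros; apply H. }
  assert (H2 : Rabs (Series (fun n => Im (cI al n) * w ^ n) - psum (fun k => Im (cI al k)) n w) <= 2 * B * (1 * w) ^ n).
  { apply T2; try lra. intros k; eapply Rle_trans; [apply H|apply Hf].
    apply Series_correct, ex_series_Rabs. apply ex_series_fact with B. intros; apply H. }
  assert (2 * B * (1 * w) ^ n <= 2 * B * z ^ (2 * n)) by (apply Rmult_le_compat_l; lra). lra.
Qed.

Definition rcI (a : R) (n : nat) : R := / INR (fact n) * rg (a + (INR n + 1)).

(** The real form of [Itilde], phrased through [PSeries] to make termwise differentiation
    available. *)
Definition rI (a z : R) : R := PSeries (rcI a) ((z / 2) ^ 2).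

Lemma cI_real a n : cI (RtoC a) n = RtoC (rcI a n).
Proof. unfold cI, rcI. now rewrite <- RtoC_plus, rgamma_real, <- RtoC_mult. Qed.

Lemma Series_zero : Series (fun _ => 0) = 0.
Proof.
  rewrite (Series_ext _ (fun _ => 0 * 0)) by (intros; ring). rewrite Series_scal_l. ring.
Qed.

Lemma Itilde_real a z : Itilde (RtoC a) z = RtoC (rI a z).
Proof.
  rewrite (surjective_pairing (Itilde (RtoC a) z)).
  change (fst (Itilde (RtoC a) z)) with (Re (Itilde (RtoC a) z)).
  change (snd (Itilde (RtoC a) z)) with (Im (Itilde (RtoC a) z)).
  rewrite Itilde_Re, Itilde_Im. change (RtoC (rI a z)) with (rI a z, 0). unfold rI, PSeries. f_equal.
  - apply Series_ext. intros n. now rewrite cI_real.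
  - rewrite (Series_ext _ (fun _ => 0)).
    + apply Series_zero.
    + intros n. rewrite cI_real. simpl. ring.
Qed.

Lemma rcI_bound a : exists B, forall n, Rabs (rcI a n) <= B * / INR (fact n).
Proof.
  destruct (cI_bound (RtoC a)) as [B [_ H]]. exists B. intros n. specialize (H n). rewrite cI_real in H. apply H.
Qed.

Lemma rcI_radius a x : Rbar_lt (Rabs x) (CV_radius (rcI a)).
Proof.
  destruct (rcI_bound a) as [B H].
  apply Rbar_lt_le_trans with (Rabs (Rabs x + 1)).
  - simpl. assert (Hx := Rabs_pos x). rewrite (Rabs_right (Rabs x + 1)) by lra. lra.
  - destruct (Rbar_lt_le_dec (CV_radius (rcI a)) (Rabs (Rabs x + 1))) as [Hlt|]; [|easy].
    exfalso. apply (CV_disk_outside _ _ Hlt). apply ex_series_lim_0, ex_series_Rabs.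
    now apply ex_series_fact with B.
Qed.

Lemma rI_derive a z : is_derive (rI a) z (z / 2 * rI (a + 1) z).
Proof.
  unfold rI.
  assert (H := is_derive_PSeries (rcI a) ((z / 2) ^ 2) (rcI_radius a _)).
  assert (H2 : is_derive (fun z => (z / 2) ^ 2) z (z / 2)) by (auto_derive; [easy|field]).
  assert (H3 := is_derive_comp (PSeries (rcI a)) (fun z => (z / 2) ^ 2) z _ _ H H2).
  unfold scal in H3; simpl in H3. unfold mult in H3; simpl in H3.
  replace (PSeries (rcI (a + 1)) ((z / 2) ^ 2)) with (PSeries (PS_derive (rcI a)) ((z / 2) ^ 2)); [exact H3|].
  apply PSeries_ext. intros n. unfold PS_derive, rcI.
  rewrite fact_simpl, mult_INR, S_INR.
  replace (a + (INR n + 1 + 1)) with (a + 1 + (INR n + 1)) by ring.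
  field. split; [apply INR_fact_neq_0|]. assert (Hn := pos_INR n). lra.
Qed.

(** The contiguity [I_a - I_(a+2) = (2 (a+1)/z) I_(a+1)] in normalised form; on coefficients it is
    the functional equation of Gamma. *)
Lemma rI_rec a z : rI a z = (a + 1) * rI (a + 1) z + (z / 2) ^ 2 * rI (a + 2) z.
Proof.
  unfold rI. set (w := (z / 2) ^ 2).
  assert (Hex : forall b, ex_pseries (rcI b) w) by (intros b; apply CV_radius_inside, rcI_radius).
  rewrite <- PSeries_incr_1, <- PSeries_scal, <- PSeries_plus.
  - apply PSeries_ext. intros [|n]; unfold PS_plus, PS_scal, PS_incr_1, plus, scal, zero; simpl;
      unfold mult; simpl; unfold rcI.
    + simpl. rewrite rg_rec. replace (a + (0 + 1) + 1) with (a + 1 + (0 + 1)) by ring. field.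
    + change (INR (fact n + n * fact n)) with (INR (fact (S n))).
      rewrite (rg_rec (a + (_ + 1))). change (match n with O => 1 | S _ => INR n + 1 end) with (INR (S n)).
      rewrite fact_simpl, mult_INR, S_INR.
      replace (a + (INR n + 1 + 1) + 1) with (a + 1 + (INR n + 1 + 1)) by ring.
      replace (a + 2 + (INR n + 1)) with (a + 1 + (INR n + 1 + 1)) by ring.
      field. split; [apply INR_fact_neq_0|]. assert (Hn := pos_INR n). lra.
  - apply ex_pseries_scal; [apply Rmult_comm|apply Hex].
  - apply ex_pseries_incr_1, Hex.
Qed.

Lemma incr_of_derive (f g : R -> R) a b : a <= b -> (forall x, a <= x <= b -> is_derive f x (g x)) ->
  (forall x, a < x < b -> 0 <= g x) -> f a <= f b.
Proof.
  intros [Hab| ->] Hd Hg; [|lra].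
  destruct (MVT_cor2 f g a b Hab) as [c [Hc Hc2]].
  - intros x Hx. apply is_derive_Reals, Hd, Hx.
  - specialize (Hg c Hc2). nra.
Qed.

(** For [a > -1] all series coefficients are positive. Lower orders, where signs may vary, are
    reached by descent: the derivative of [rI a] is [(z/2) rI (a+1)], eventually bounded below, so
    [rI a] grows at least linearly. *)
Lemma rI_eventually_pos a : exists X d, 0 < X /\ 0 < d /\ forall x, X < x -> d <= rI a x.
Proof.
  assert (Hbase : forall a, -1 < a -> exists X d, 0 < X /\ 0 < d /\ forall x, X < x -> d <= rI a x).
  { intros b Hb. exists 1, (rg (b + 1)). split; [lra|]. split; [apply rg_pos; lra|]. intros x Hx.
    unfold rI. set (w := (x / 2) ^ 2).
    assert (Hw : 0 <= w) by (unfold w; simpl; nra).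
    rewrite PSeries_decr_1 by (apply CV_radius_inside, rcI_radius).
    assert (E0 : rcI b 0 = rg (b + 1)) by (unfold rcI; simpl; rewrite Rplus_0_l; field).
    rewrite E0.
    assert (Hp : forall n, 0 <= rcI b n).
    { intros n. unfold rcI. assert (Hn := pos_INR n). apply Rmult_le_pos.
      apply Rlt_le, Rinv_0_lt_compat, INR_fact_lt_0. apply Rlt_le, rg_pos. lra. }
    assert (0 <= PSeries (PS_decr_1 (rcI b)) w).
    { unfold PSeries. rewrite <- Series_zero. apply Series_le.
      - intros n. split; [lra|]. apply Rmult_le_pos; [apply Hp|now apply pow_le].
      - apply (ex_pseries_R (PS_decr_1 (rcI b)) w).
        apply CV_radius_inside. rewrite CV_radius_decr_1. apply rcI_radius. }
    nra. }
  assert (Hstep : forall a, (exists X d, 0 < X /\ 0 < d /\ forall x, X < x -> d <= rI (a + 1) x) ->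
     exists X d, 0 < X /\ 0 < d /\ forall x, X < x -> d <= rI a x).
  { intros b [X [d [HX [Hd H]]]]. set (x0 := X + 2).
    (* Beyond [x0 = X + 2] one has [x/2 >= 1] and the derivative is at least [d]; the further
       distance [(1 + |rI b x0|)/d] makes up for a negative starting value. *)
    exists (x0 + (1 + Rabs (rI b x0)) / d), 1.
    assert (HA := Rabs_pos (rI b x0)).
    assert (Hq : 0 < (1 + Rabs (rI b x0)) / d) by (apply Rdiv_lt_0_compat; lra).
    assert (Hx0 : 0 < x0) by (unfold x0; lra). split; [lra|]. split; [lra|]. intros x Hx.
    assert (Hinc : rI b x0 - d * x0 <= rI b x - d * x).
    { apply (incr_of_derive (fun x => rI b x - d * x) (fun x => x / 2 * rI (b + 1) x - d)); [lra| |].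
      - intros y Hy. apply (is_derive_minus (rI b) (fun x => d * x)); [apply rI_derive|].
        auto_derive; [easy|ring].
      - intros y Hy. unfold x0 in Hy. specialize (H y ltac:(lra)). nra. }
    assert (d * ((1 + Rabs (rI b x0)) / d) <= d * (x - x0)) by (apply Rmult_le_compat_l; lra).
    replace (d * ((1 + Rabs (rI b x0)) / d)) with (1 + Rabs (rI b x0)) in H0 by (field; lra).
    assert (H1 := Rle_abs (- rI b x0)). rewrite Rabs_Ropp in H1. lra. }
  assert (Hall : forall n a, - INR n - 1 < a -> exists X d, 0 < X /\ 0 < d /\ forall x, X < x -> d <= rI a x).
  { induction n as [|n IH]; intros b Hb; [apply Hbase; simpl in Hb; lra|].
    apply Hstep, IH. rewrite S_INR in Hb. lra. }
  destruct (nfloor_ex (Rabs a) (Rabs_pos a)) as [n Hn]. apply (Hall n).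
  assert (H := Rle_abs (- a)). rewrite Rabs_Ropp in H. lra.
Qed.

(* [rho a = I_(a+1) / I_a] *)
Definition rho (a z : R) : R := z / 2 * rI (a + 1) z / rI a z.

Definition riccati_err (a z : R) : R := rho a z + (a + 1 / 2) / z - 1.

(* The Riccati equation of [1 + riccati_err a], the logarithmic derivative of [sqrt z * I_a(z)]. *)
Lemma riccati_err_derive a z : 0 < z -> rI a z <> 0 ->
  is_derive (riccati_err a) z (- riccati_err a z * (2 + riccati_err a z) + (a ^ 2 - 1 / 4) / z ^ 2).
Proof.
  intros Hz H0.
  assert (H1 : is_derive (fun z => z / 2) z (/ 2)) by (auto_derive; [easy|field]).
  assert (H2 := is_derive_mult _ _ z _ _ H1 (rI_derive (a + 1) z) Rmult_comm).
  assert (H3 := is_derive_div _ _ z _ _ H2 (rI_derive a z) H0).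
  assert (H4 : is_derive (fun z => (a + 1 / 2) / z - 1) z (- (a + 1 / 2) / z ^ 2)).
  { auto_derive; [lra|]. field. lra. }
  assert (H5 := is_derive_plus _ _ z _ _ H3 H4).
  eapply is_derive_ext; [|exact_derive H5].
  - intros t. unfold riccati_err, rho, plus; simpl. unfold mult; simpl. ring.
  - unfold plus; simpl. unfold mult; simpl. unfold riccati_err, rho.
    replace (a + 1 + 1) with (a + 2) by ring.
    assert (Hr := rI_rec a z). set (P := rI a z) in *. set (Q := rI (a + 1) z) in *. set (R2 := rI (a + 2) z) in *.
    assert (E : R2 = (4 / z ^ 2) * (P - (a + 1) * Q)) by (rewrite Hr; field; lra).
    rewrite E. field. split; [lra|exact H0].
Qed.

(** Writing [e] for the error and [c = a^2 - 1/4], the equation [e' = - e (2 + e) + c/z^2] contracts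
    as soon as [2 + e >= 1/2], which [rho >= 0] guarantees for large [z]. Then [phi = z^4 e^2]
    satisfies [phi' <= - phi/2 + 4 c^2], a Gronwall inequality that keeps [phi] bounded. *)
Lemma riccati_err_bound a : exists M X, 0 < X /\ 0 <= M /\ (forall z, X < z -> 0 < rI a z) /\
  forall z, X < z -> Rabs (riccati_err a z) <= M / z ^ 2.
Proof.
  destruct (rI_eventually_pos a) as [X1 [d1 [HX1 [Hd1 H1]]]].
  destruct (rI_eventually_pos (a + 1)) as [X2 [d2 [HX2 [Hd2 H2]]]].
  set (c := a ^ 2 - 1 / 4).
  (* [X1] and [X2] give positivity of both functions, [2 |a + 1/2|] gives [|a + 1/2|/z <= 1/2] and
     hence [e >= - 3/2], and 16 absorbs the term [4 z^3 e^2] into [z^4 e^2/4]. *)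
  set (X := X1 + X2 + 16 + 2 * Rabs (a + 1 / 2)).
  assert (Ha := Rabs_pos (a + 1 / 2)).
  assert (HX : 16 <= X) by (unfold X; lra).
  assert (Hpos : forall z, X <= z -> 0 < rI a z).
  { intros z Hz. specialize (H1 z). unfold X in Hz. lra. }
  assert (Hge : forall z, X <= z -> - (3 / 2) <= riccati_err a z).
  { intros z Hz. unfold riccati_err.
    assert (0 <= rho a z).
    { unfold rho. specialize (Hpos z Hz). specialize (H2 z). unfold X in Hz. apply Rle_mult_inv_pos; [|easy].
      apply Rmult_le_pos; lra. }
    assert (- (1 / 2) <= (a + 1 / 2) / z).
    { apply Rmult_le_reg_r with z; [lra|]. unfold Rdiv at 2. rewrite Rmult_assoc, Rinv_l by lra.
      assert (H' := Rle_abs (- (a + 1 / 2))). rewrite Rabs_Ropp in H'. unfold X in Hz. lra. }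
    lra. }
  set (phi := fun z => z ^ 4 * riccati_err a z ^ 2).
  (* With the integrating factor [exp (z/2)], the signed distance of [phi] from the equilibrium
     [8 c^2] becomes nonincreasing. *)
  set (Phi := fun z => (phi z + - (8 * c ^ 2)) * exp (z / 2)).
  set (phi' := fun z => 4 * z ^ 3 * riccati_err a z ^ 2 + z ^ 4 * (2 * riccati_err a z * (- riccati_err a z * (2 + riccati_err a
    z) + c / z ^ 2))).
  assert (Dphi : forall z, X <= z -> is_derive phi z (phi' z)).
  { intros z Hz. assert (Hd := riccati_err_derive a z ltac:(lra) (Rgt_not_eq _ _ (Hpos z Hz))). fold c in Hd.
    assert (Hp4 : is_derive (fun z => z ^ 4) z (4 * z ^ 3)) by (auto_derive; [easy|ring]).
    assert (Hp2 := is_derive_pow (riccati_err a) 2 z _ Hd).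
    assert (H := is_derive_mult _ _ z _ _ Hp4 Hp2 Rmult_comm).
    unfold phi. exact_derive H.
    unfold phi', plus, mult; simpl. unfold mult; simpl. ring. }
  assert (Hphi : forall z, X <= z -> phi' z <= - phi z / 2 + 4 * c ^ 2).
  { intros z Hz. specialize (Hge z Hz). unfold phi', phi.
    set (e := riccati_err a z) in *.
    replace (z ^ 4 * (2 * e * (- e * (2 + e) + c / z ^ 2))) with (- (2 * (z ^ 2 * e) ^ 2 * (2 + e)) + 2 * (c * (z ^ 2 * e))) by
      (field; lra).
    assert (Hq : 4 * z ^ 3 * e ^ 2 <= (z ^ 2 * e) ^ 2 / 4).
    { replace (4 * z ^ 3 * e ^ 2) with (4 * (z ^ 3 * e ^ 2)) by ring.
      replace ((z ^ 2 * e) ^ 2 / 4) with (z / 4 * (z ^ 3 * e ^ 2)) by field.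
      apply Rmult_le_compat_r; [|lra]. apply Rmult_le_pos; [apply pow_le; lra|apply pow2_ge_0]. }
    replace (z ^ 4 * e ^ 2) with ((z ^ 2 * e) ^ 2) by ring.
    set (f := z ^ 2 * e) in *.
    assert (0 <= f ^ 2) by apply pow2_ge_0.
    assert (f ^ 2 <= 2 * f ^ 2 * (2 + e)) by nra.
    assert (0 <= (f / 2 - 2 * c) ^ 2) by apply pow2_ge_0.
    simpl in *. nra. }
  assert (Hdec : forall z, X < z -> Phi z <= Phi X).
  { intros z Hz. cut (- Phi X <= - Phi z); [lra|].
    apply (incr_of_derive (fun z => - Phi z) (fun z => - (phi' z * exp (z / 2) + (phi z + - (8 * c ^ 2)) * (exp (z / 2) / 2)))); [lra| |].
    - intros y Hy. apply (is_derive_opp Phi).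
      assert (D1 : is_derive (fun z => phi z + - (8 * c ^ 2)) y (phi' y)).
      { replace (phi' y) with (plus (phi' y) 0) by (unfold plus; simpl; ring).
        apply (is_derive_plus phi (fun _ => - (8 * c ^ 2))); [apply Dphi; lra|auto_derive; [easy|ring]]. }
      assert (D2 : is_derive (fun z => exp (z / 2)) y (exp (y / 2) / 2)) by (auto_derive; [easy|unfold Rdiv; field]).
      apply (is_derive_mult _ _ y _ _ D1 D2 Rmult_comm).
    - intros y Hy. specialize (Hphi y ltac:(lra)). assert (P := exp_pos (y / 2)). nra. }
  exists (1 + 8 * c ^ 2 + Rabs (Phi X)), X.
  assert (Hc2 : 0 <= c ^ 2) by apply pow2_ge_0. assert (HPX := Rabs_pos (Phi X)).
  split; [lra|]. split; [lra|]. split; [intros z Hz; apply Hpos; lra|].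
  intros z Hz. specialize (Hdec z Hz).
  assert (Hb : phi z <= 8 * c ^ 2 + Rabs (Phi X)).
  { assert (P : 1 <= exp (z / 2)) by (rewrite <- exp_0; apply exp_le_compat; lra).
    assert (HA := Rle_abs (Phi X)). unfold Phi at 1 in Hdec.
    destruct (Rle_dec (phi z) (8 * c ^ 2)); nra. }
  assert (Hf : Rabs (z ^ 2 * riccati_err a z) <= 1 + 8 * c ^ 2 + Rabs (Phi X)).
  { assert (Hsq : Rabs (z ^ 2 * riccati_err a z) ^ 2 <= 8 * c ^ 2 + Rabs (Phi X)).
    { rewrite pow2_abs. unfold phi in Hb. replace ((z ^ 2 * riccati_err a z) ^ 2) with (z ^ 4 * riccati_err a z ^ 2) by ring. easy. }
    assert (HA := Rabs_pos (z ^ 2 * riccati_err a z)). assert (H2q := pow2_ge_0 (Rabs (z ^ 2 * riccati_err a z) - 1)). lra. }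
  assert (Hz2 : 0 < z ^ 2) by (apply pow_lt; lra).
  rewrite Rabs_mult, (Rabs_right (z ^ 2)) in Hf by lra.
  apply Rmult_le_reg_l with (z ^ 2); [easy|].
  replace (z ^ 2 * ((1 + 8 * c ^ 2 + Rabs (Phi X)) / z ^ 2)) with (1 + 8 * c ^ 2 + Rabs (Phi X)) by (field; lra). easy.
Qed.

Lemma rho_Oinf a : Oinf (rho a) 1.
Proof.
  destruct (riccati_err_bound a) as [M [X [HX [HM [_ H]]]]].
  apply Oinf_ext with (fun x => (1 + riccati_err a x) + - (a + 1 / 2) * / x) 0.
  { intros x Hx. unfold riccati_err. field. lra. }
  refine (eq_ind ((1 + 0) + - (a + 1 / 2) * 0) (Oinf _) _ 1 _); [|ring].
  apply Oinf_plus; [apply Oinf_plus; [apply Oinf_const|]|apply Oinf_mult; [apply Oinf_const|apply Oinf_inv_x]].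
  exists M, (X + 1). split; [lra|]. intros x Hx. rewrite Rminus_0_r. eapply Rle_trans; [apply H; lra|].
  apply Rmult_le_compat_l; [easy|]. apply Rinv_le_contravar; [lra|]. simpl. nra.
Qed.

(** Since [M/z] has derivative [- M/z^2], the function [f - M/z] increases and [f + M/z] decreases;
    [l] is the supremum of the first, and no value of the first exceeds one of the second. *)
Lemma Oinf_of_derive (f g : R -> R) M X : 0 < X -> 0 <= M ->
  (forall z, X < z -> is_derive f z (g z)) -> (forall z, X < z -> Rabs (g z) <= M / z ^ 2) ->
  exists l, forall z, X < z -> Rabs (f z - l) <= M / z.
Proof.
  intros HX HM Hd Hg.
  assert (Hlow : forall x y, X < x -> x <= y -> f x - M / x <= f y - M / y).
  { intros x y Hx Hxy. apply (incr_of_derive (fun z => f z - M / z) (fun z => g z - (- M / z ^ 2))); [easy| |].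
    - intros z Hz. apply (is_derive_minus f (fun z => M / z)); [apply Hd; lra|]. auto_derive; [lra|]. field. lra.
    - intros z Hz. specialize (Hg z ltac:(lra)). apply Rabs_le_between in Hg. lra. }
  assert (Hup : forall x y, X < x -> x <= y -> f y + M / y <= f x + M / x).
  { intros x y Hx Hxy. cut (- (f x + M / x) <= - (f y + M / y)); [lra|].
    apply (incr_of_derive (fun z => - (f z + M / z)) (fun z => - (g z + - M / z ^ 2))); [easy| |].
    - intros z Hz. apply (is_derive_opp (fun z => f z + M / z)).
      apply (is_derive_plus f (fun z => M / z)); [apply Hd; lra|]. auto_derive; [lra|]. field. lra.
    - intros z Hz. specialize (Hg z ltac:(lra)). apply Rabs_le_between in Hg. lra. }
  assert (Hcross : forall x y, X < x -> X < y -> f x - M / x <= f y + M / y).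
  { intros x y Hx Hy. assert (H1 := Rmax_l x y). assert (H2 := Rmax_r x y).
    assert (A := Hlow x (Rmax x y) Hx H1). assert (B := Hup y (Rmax x y) Hy H2).
    assert (0 <= M / Rmax x y) by (apply Rle_mult_inv_pos; lra). lra. }
  destruct (completeness (fun v => exists x, X < x /\ v = f x - M / x)) as [l [Hl1 Hl2]].
  - exists (f (X + 1) + M / (X + 1)). intros v [x [Hx ->]]. apply Hcross; lra.
  - exists (f (X + 1) - M / (X + 1)), (X + 1). split; [lra|easy].
  - exists l. intros z Hz. apply Rabs_le. split.
    + assert (l <= f z + M / z); [|lra]. apply Hl2. intros v [x [Hx ->]]. now apply Hcross.
    + assert (f z - M / z <= l); [|lra]. apply Hl1. now exists z.
Qed.

(** The logarithm of [rI a z * z^(a + 1/2) * exp (- z)] has derivative [riccati_err a], which is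
    [O(1/z^2)]; it converges to some [l] with rate [1/z], and [k = exp l]. *)
Lemma rI_asymp a : exists k, 0 < k /\
  Oinf (fun z => rI a z / (k * (Rpower z (- a - 1 / 2) * exp z))) 1.
Proof.
  destruct (riccati_err_bound a) as [M [X [HX [HM [Hpos H]]]]].
  destruct (Oinf_of_derive (fun z => ln (rI a z) + (- z + (a + 1 / 2) * ln z)) (riccati_err a) M X HX HM) as [l Hl]; [|easy|].
  - intros z Hz. specialize (Hpos z Hz).
    assert (D1 : is_derive (fun z => ln (rI a z)) z (rho a z)).
    { assert (D := is_derive_comp ln (rI a) z _ _ (is_derive_ln _ Hpos) (rI_derive a z)).
      unfold scal in D; simpl in D; unfold mult in D; simpl in D.
      replace (rho a z) with (z / 2 * rI (a + 1) z * / rI a z) by (unfold rho, Rdiv; ring). exact D. }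
    assert (D2 : is_derive (fun z => - z + (a + 1 / 2) * ln z) z (-1 + (a + 1 / 2) / z)) by (auto_derive; [lra|field; lra]).
    assert (D := is_derive_plus _ _ z _ _ D1 D2). unfold plus in D; simpl in D.
    replace (riccati_err a z) with (rho a z + (-1 + (a + 1 / 2) / z)) by (unfold riccati_err; ring). exact D.
  - exists (exp l). split; [apply exp_pos|].
    exists (2 * M), (X + 2 * M + 1). split; [lra|]. intros z Hz. specialize (Hl z ltac:(lra)). specialize (Hpos z ltac:(lra)).
    set (d := ln (rI a z) + (- z + (a + 1 / 2) * ln z) - l) in *.
    assert (E : rI a z / (exp l * (Rpower z (- a - 1 / 2) * exp z)) = exp d).
    { unfold d, Rpower. rewrite <- !exp_plus. unfold Rdiv. rewrite <- exp_Ropp.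
      rewrite <- (exp_ln (rI a z)) at 1 by easy. rewrite <- exp_plus. f_equal. field. }
    rewrite E.
    assert (Hd : M / z <= 1 / 2).
    { apply Rmult_le_reg_r with z; [lra|]. unfold Rdiv at 1. rewrite Rmult_assoc, Rinv_l by lra. lra. }
    assert (Ht := exp_taylor1 d ltac:(lra)).
    replace (exp d - 1) with ((exp d - 1 - d) + d) by ring.
    eapply Rle_trans; [apply Rabs_triang|].
    assert (d ^ 2 <= Rabs d * (1 / 2)).
    { rewrite <- pow2_abs. assert (HA := Rabs_pos d). simpl. nra. }
    unfold Rdiv in *. lra.
Qed.

(** * Expansion coefficients along a ladder *)

Definition Clim0 (u : R -> CC) (l : CC) : Prop :=
  forall eps, 0 < eps -> exists d, 0 < d /\ forall x, 0 < x < d -> Cmod (u x - l)%C <= eps.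

Lemma Clim0_RtoC u l : lim0 u l -> Clim0 (fun x => RtoC (u x)) (RtoC l).
Proof.
  intros H eps He. destruct (H eps He) as [d [Hd Hx]]. exists d. split; [easy|]. intros x Hx'.
  rewrite <- RtoC_minus, Cmod_R. auto.
Qed.

Lemma lim0_of_RtoC u l : Clim0 (fun x => RtoC (u x)) (RtoC l) -> lim0 u l.
Proof.
  intros H eps He. destruct (H eps He) as [d [Hd Hx]]. exists d. split; [easy|]. intros x Hx'.
  rewrite <- Cmod_R, RtoC_minus. auto.
Qed.

Lemma lim0_Cmod u l : Clim0 u l <-> lim0 (fun x => Cmod (u x - l)%C) 0.
Proof.
  split; intros H eps He; destruct (H eps He) as [d [Hd Hx]]; exists d; (split; [easy|]); intros x Hx';
    specialize (Hx x Hx').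
  - rewrite Rminus_0_r, Rabs_right; [easy|]. apply Rle_ge, Cmod_ge_0.
  - rewrite Rminus_0_r, Rabs_right in Hx; [easy|]. apply Rle_ge, Cmod_ge_0.
Qed.

Lemma Clim0_ext u v l d : 0 < d -> (forall x, 0 < x < d -> u x = v x) -> Clim0 u l -> Clim0 v l.
Proof.
  intros Hd H Hu. apply lim0_Cmod. apply lim0_Cmod in Hu.
  eapply lim0_ext; [exact Hd| |exact Hu]. intros x Hx. simpl. now rewrite H.
Qed.

Lemma Clim0_const c : Clim0 (fun _ => c) c.
Proof.
  intros eps He. exists 1. split; [lra|]. intros. replace (c - c)%C with (RtoC 0) by ring. rewrite Cmod_0. lra.
Qed.

Lemma Clim0_plus u v l k : Clim0 u l -> Clim0 v k -> Clim0 (fun x => u x + v x)%C (l + k)%C.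
Proof.
  rewrite !lim0_Cmod. intros Hu Hv.
  apply lim0_squeeze with (fun _ => 0) (fun x => Cmod (u x - l)%C + Cmod (v x - k)%C) 1; [lra| |apply lim0_const|].
  - intros x _. split; [apply Cmod_ge_0|].
    replace (u x + v x - (l + k))%C with ((u x - l) + (v x - k))%C by ring. apply Cmod_triangle.
  - replace 0 with (0 + 0) by ring. now apply lim0_plus.
Qed.

Lemma Clim0_mult u v l k : Clim0 u l -> Clim0 v k -> Clim0 (fun x => u x * v x)%C (l * k)%C.
Proof.
  rewrite !lim0_Cmod. intros Hu Hv.
  apply lim0_squeeze with (fun _ => 0)
    (fun x => Cmod (u x - l)%C * Cmod (v x - k)%C + (Cmod (u x - l)%C * Cmod k + Cmod l * Cmod (v x - k)%C)) 1;
    [lra| |apply lim0_const|].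
  - intros x _. split; [apply Cmod_ge_0|]. rewrite <- !Cmod_mult.
    replace (u x * v x - l * k)%C with ((u x - l) * (v x - k) + ((u x - l) * k + l * (v x - k)))%C by ring.
    eapply Rle_trans; [apply Cmod_triangle|]. apply Rplus_le_compat_l, Cmod_triangle.
  - replace 0 with (0 * 0 + (0 * Cmod k + Cmod l * 0)) by ring.
    repeat first [assumption | apply lim0_const | apply lim0_mult | apply lim0_plus].
Qed.

Lemma Clim0_unique u l k : Clim0 u l -> Clim0 u k -> l = k.
Proof.
  intros H1 H2.
  assert (E : Cmod (l - k)%C = 0).
  { destruct (Rle_lt_or_eq_dec _ _ (Cmod_ge_0 (l - k)%C)) as [Hp|]; [|easy]. exfalso.
    destruct (H1 (Cmod (l - k)%C / 4) ltac:(lra)) as [d [Hd H]], (H2 (Cmod (l - k)%C / 4) ltac:(lra)) as [d' [Hd' H']].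
    assert (A := Rmin_l d d'). assert (B := Rmin_r d d'). assert (Hm : 0 < Rmin d d') by now apply Rmin_pos.
    specialize (H (Rmin d d' / 2) ltac:(lra)). specialize (H' (Rmin d d' / 2) ltac:(lra)).
    set (w := u (Rmin d d' / 2)) in *.
    assert (T : Cmod (l - k)%C <= Cmod (w - k)%C + Cmod (w - l)%C).
    { replace (l - k)%C with ((w - k) + - (w - l))%C by ring. eapply Rle_trans; [apply Cmod_triangle|]. rewrite Cmod_opp. lra. }
    lra. }
  apply Cmod_eq_0 in E. replace l with ((l - k) + k)%C by ring. rewrite E. ring.
Qed.

Lemma expands_Clim0 g a : expands g a 1 -> Clim0 g (a O).
Proof.
  intros [M [d [Hd H]]]. apply lim0_Cmod.
  apply lim0_squeeze with (fun _ => 0) (fun x => M * x) d; [easy| |apply lim0_const|].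
  - intros x Hx. split; [apply Cmod_ge_0|]. specialize (H x Hx). simpl in H. rewrite Rmult_1_r in H.
    replace (g x - a O)%C with (g x - (RtoC 0 + a O * RtoC 1))%C by ring. easy.
  - replace 0 with (M * 0) by ring. apply (lim0_mult (fun _ => M)); [apply lim0_const|apply lim0_id].
Qed.

Definition COinf (u : R -> CC) (l : CC) : Prop := Oinf (fun x => Cmod (u x - l)%C) 0.

Lemma COinf_RtoC u l : Oinf u l -> COinf (fun x => RtoC (u x)) (RtoC l).
Proof.
  intros [M [X [HX H]]]. exists M, X. split; [easy|]. intros x Hx.
  rewrite Rminus_0_r, <- RtoC_minus, Cmod_R, Rabs_Rabsolu. auto.
Qed.

Lemma COinf_ext u v l X : (forall x, X < x -> u x = v x) -> COinf u l -> COinf v l.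
Proof. intros H. apply Oinf_ext with X. intros x Hx. now rewrite H. Qed.

Lemma COinf_const c : COinf (fun _ => c) c.
Proof.
  apply Oinf_ext with (fun _ => 0) 0; [|apply Oinf_const]. intros x _.
  replace (c - c)%C with (RtoC 0) by ring. now rewrite Cmod_0.
Qed.

Lemma COinf_plus u v l k : COinf u l -> COinf v k -> COinf (fun x => u x + v x)%C (l + k)%C.
Proof.
  intros Hu Hv. apply Oinf_squeeze with (fun x => Cmod (u x - l)%C + Cmod (v x - k)%C) 0.
  - intros x _. rewrite Rminus_0_r, Rabs_right by apply Rle_ge, Cmod_ge_0.
    replace (u x + v x - (l + k))%C with ((u x - l) + (v x - k))%C by ring. apply Cmod_triangle.
  - replace 0 with (0 + 0) by ring. now apply Oinf_plus.
Qed.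

Lemma COinf_mult u v l k : COinf u l -> COinf v k -> COinf (fun x => u x * v x)%C (l * k)%C.
Proof.
  intros Hu Hv.
  apply Oinf_squeeze with
    (fun x => Cmod (u x - l)%C * Cmod (v x - k)%C + (Cmod (u x - l)%C * Cmod k + Cmod l * Cmod (v x - k)%C)) 0.
  - intros x _. rewrite Rminus_0_r, Rabs_right by apply Rle_ge, Cmod_ge_0. rewrite <- !Cmod_mult.
    replace (u x * v x - l * k)%C with ((u x - l) * (v x - k) + ((u x - l) * k + l * (v x - k)))%C by ring.
    eapply Rle_trans; [apply Cmod_triangle|]. apply Rplus_le_compat_l, Cmod_triangle.
  - replace 0 with (0 * 0 + (0 * Cmod k + Cmod l * 0)) by ring.
    repeat first [exact Hu | exact Hv | apply Oinf_const | apply Oinf_mult | apply Oinf_plus].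
Qed.

(* [bc sg e s k m] is the coefficient of [t^k] in [(1 - t)^(-s) eta_m (x / (1 - t))] for a ladder
   [x eta_m' = 2 m eta_m + 2 sg eta_(m+1)] with [eta_m x = e m]. *)
Fixpoint bc (sg : R) (e : nat -> R) (s : CC) (k m : nat) : CC :=
  match k with
  | O => RtoC (e m)
  | S j => (((RtoC (INR j) + s + RtoC (2 * INR m)) * bc sg e s j m + RtoC (2 * sg) * bc sg e s j (S m))
            * RtoC (/ INR (S j)))%C
  end.

(* [Lc sg e x f s k] is the coefficient of [t^k] in [(1 - t)^(-s) F (t x / (1 - t)) eta_0 (x / (1 - t))],
   [f] being the coefficients of [F]; the recursion is Horner's rule in [F]. *)
Fixpoint Lc (sg : R) (e : nat -> R) (x : R) (f : nat -> CC) (s : CC) (k : nat) : CC :=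
  match k with
  | O => (f O * bc sg e s 0 0)%C
  | S j => (f O * bc sg e s (S j) 0 + RtoC x * Lc sg e x (fun n => f (S n)) (s + RtoC 1) j)%C
  end.

Definition ladder (sg : R) (eta : nat -> R -> R) : Prop :=
  forall m x, 0 < x -> is_derive (eta m) x ((2 * INR m * eta m x + 2 * sg * eta (S m) x) / x).

Lemma Cpowpos_opp_eq b (s : CC) :
  Cpowpos b (- s)%C = (exp (- Re s * ln b) * cos (- Im s * ln b), exp (- Re s * ln b) * sin (- Im s * ln b)).
Proof.
  destruct s as [p q]. unfold Cpowpos, Cexp, Cmult, Copp, RtoC, Re, Im; simpl.
  replace (- p * ln b - - q * 0) with (- p * ln b) by ring.
  replace (- p * 0 + - q * ln b) with (- q * ln b) by ring. reflexivity.
Qed.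

Section Ladder.

Variables (sg : R) (eta : nat -> R -> R) (x : R).
Hypothesis (Hlad : ladder sg eta) (Hx : 0 < x).

Let B (s : CC) (m : nat) (t : R) : CC := (Cpowpos (1 - t) (- s) * RtoC (eta m (x / (1 - t))))%C.

Lemma eta_comp_derive m t : t < 1 -> is_derive (fun t => eta m (x / (1 - t))) t
  ((2 * INR m * eta m (x / (1 - t)) + 2 * sg * eta (S m) (x / (1 - t))) / (1 - t)).
Proof.
  intros Ht. assert (Hy : 0 < x / (1 - t)) by (apply Rdiv_lt_0_compat; lra).
  assert (H1 : is_derive (fun t => x / (1 - t)) t (x / (1 - t) ^ 2)) by (auto_derive; [lra|field; lra]).
  assert (H2 := is_derive_comp (eta m) (fun t => x / (1 - t)) t _ _ (Hlad m _ Hy) H1).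
  unfold scal in H2; simpl in H2. unfold mult in H2; simpl in H2.
  exact_derive H2.
  field. lra.
Qed.

Lemma ladder_term_Re s m t : Re (B s m t) = exp (- Re s * ln (1 - t)) * cos (- Im s * ln (1 - t)) * eta m (x / (1 - t)).
Proof. unfold B. rewrite Cpowpos_opp_eq. unfold Re; simpl. ring. Qed.

Lemma ladder_term_Im s m t : Im (B s m t) = exp (- Re s * ln (1 - t)) * sin (- Im s * ln (1 - t)) * eta m (x / (1 - t)).
Proof. unfold B. rewrite Cpowpos_opp_eq. unfold Im; simpl. ring. Qed.

(** Both [(1 - t)^(-s)] and [x/(1 - t)] contribute a factor [1/(1 - t)] to the derivative; isolating
    it gives [(1 - t) B' = h] with [h] again a combination of ladder terms, the situation of
    [rexpands_ode]. *)
Let h (s : CC) (m : nat) (t : R) : CC := ((s + RtoC (2 * INR m)) * B s m t + RtoC (2 * sg) * B s (S m) t)%C.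

Lemma ladder_term_derive s m t : t < 1 ->
  is_derive (fun t => Re (B s m t)) t (Re (h s m t) / (1 - t)) /\
  is_derive (fun t => Im (B s m t)) t (Im (h s m t) / (1 - t)).
Proof.
  intros Ht. assert (HE := eta_comp_derive m t Ht).
  assert (Hre : forall t, Re (h s m t) = Re s * Re (B s m t) - Im s * Im (B s m t) + 2 * INR m * Re (B s m t) + 2 * sg * Re (B s (S m) t))
    by (intros; unfold h, Re, Im; simpl; ring).
  assert (Him : forall t, Im (h s m t) = Re s * Im (B s m t) + Im s * Re (B s m t) + 2 * INR m * Im (B s m t) + 2 * sg * Im (B s (S m) t))
    by (intros; unfold h, Re, Im; simpl; ring).
  rewrite Hre, Him, !ladder_term_Re, !ladder_term_Im. split.
  - apply is_derive_ext with (fun t => exp (- Re s * ln (1 - t)) * cos (- Im s * ln (1 - t)) * eta m (x / (1 - t))).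
    { intros; now rewrite ladder_term_Re. }
    assert (Hu : is_derive (fun t => exp (- Re s * ln (1 - t)) * cos (- Im s * ln (1 - t))) t
      ((Re s * (exp (- Re s * ln (1 - t)) * cos (- Im s * ln (1 - t))) - Im s * (exp (- Re s * ln (1 - t)) * sin (- Im s * ln (1
        - t)))) / (1 - t))).
    { auto_derive; [lra|]. unfold Rminus. field. lra. }
    assert (H := is_derive_mult _ _ t _ _ Hu HE Rmult_comm). unfold plus, mult in H; simpl in H.
    exact_derive H.
    field. lra.
  - apply is_derive_ext with (fun t => exp (- Re s * ln (1 - t)) * sin (- Im s * ln (1 - t)) * eta m (x / (1 - t))).
    { intros; now rewrite ladder_term_Im. }
    assert (Hu : is_derive (fun t => exp (- Re s * ln (1 - t)) * sin (- Im s * ln (1 - t))) t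
      ((Re s * (exp (- Re s * ln (1 - t)) * sin (- Im s * ln (1 - t))) + Im s * (exp (- Re s * ln (1 - t)) * cos (- Im s * ln (1
        - t)))) / (1 - t))).
    { auto_derive; [lra|]. unfold Rminus. field. lra. }
    assert (H := is_derive_mult _ _ t _ _ Hu HE Rmult_comm). unfold plus, mult in H; simpl in H.
    exact_derive H.
    field. lra.
Qed.

Lemma ladder_term_0 s m : B s m 0 = RtoC (eta m x).
Proof.
  unfold B, Cpowpos. rewrite Rminus_0_r, ln_1, Cmult_0_r, Cexp_0, Rdiv_1_r. ring.
Qed.

Lemma Re_scal r z : Re (RtoC r * z)%C = r * Re z.
Proof. unfold Re; simpl; ring. Qed.

Lemma Im_scal r z : Im (RtoC r * z)%C = r * Im z.
Proof. unfold Im; simpl; ring. Qed.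

(** Induction on the order, for all levels at once: order [N] of [h], which involves levels [m] and
    [m + 1], gives order [N + 1] of [B]. The recursion defining [bc] is the one required by
    [rexpands_ode]; order 0 is mere boundedness near 0. *)
Lemma ladder_expands N : forall s m, expands (B s m) (fun k => bc sg (fun j => eta j x) s k m) N.
Proof.
  set (e := fun j => eta j x).
  induction N as [|N IH]; intros s m.
  - destruct (ladder_term_derive s m 0 Rlt_0_1) as [H1 H2].
    apply expands_Re_Im; eapply rexpands_O; eassumption.
  - assert (Hh : expands (h s m) (fun k => (s + RtoC (2 * INR m)) * bc sg e s k m + RtoC (2 * sg) * bc sg e s k (S m))%C N)
      by (apply expands_plus; apply expands_scal; apply IH).
    assert (Hrec : forall k, (RtoC (INR (S k)) * bc sg e s (S k) m = RtoC (INR k) * bc sg e s k m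
        + ((s + RtoC (2 * INR m)) * bc sg e s k m + RtoC (2 * sg) * bc sg e s k (S m)))%C).
    { intros k. cbn [bc]. assert (Hk : INR (S k) <> 0) by (apply not_0_INR; lia).
      rewrite RtoC_inv by easy. field. now apply RtoC_neq_0. }
    apply expands_Re_Im.
    + apply rexpands_ode with (h := fun t => Re (h s m t)) (b := fun k => Re ((s + RtoC (2 * INR m)) * bc sg e s k m + RtoC (2 *
      sg) * bc sg e s k (S m))%C).
      * intros t Ht. apply ladder_term_derive. lra.
      * now rewrite ladder_term_0.
      * intros k. specialize (Hrec k). apply (f_equal Re) in Hrec.
        rewrite Re_scal in Hrec. rewrite Hrec, <- Re_scal. reflexivity.
      * now apply expands_Re in Hh.
    + apply rexpands_ode with (h := fun t => Im (h s m t)) (b := fun k => Im ((s + RtoC (2 * INR m)) * bc sg e s k m + RtoC (2 *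
      sg) * bc sg e s k (S m))%C).
      * intros t Ht. apply ladder_term_derive. lra.
      * now rewrite ladder_term_0.
      * intros k. specialize (Hrec k). apply (f_equal Im) in Hrec.
        rewrite Im_scal in Hrec. rewrite Hrec, <- Im_scal. reflexivity.
      * now apply expands_Im in Hh.
Qed.

Lemma cpsum_horner f N z : cpsum f (S N) z = (f O + RtoC z * cpsum (fun n => f (S n)) N z)%C.
Proof.
  induction N as [|N IH]; [simpl; ring|].
  change (cpsum f (S (S N)) z) with (cpsum f (S N) z + f (S N) * RtoC (z ^ S N))%C.
  rewrite IH. cbn [cpsum]. rewrite <- tech_pow_Rmult, RtoC_mult. ring.
Qed.

(** One Horner step: a factor [z = t x/(1 - t)] pulled out of the polynomial costs a factor [x] and
    a shift in [t], and [s] becomes [s + 1]. *)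
Lemma poly_ladder_expands N : forall f s,
  expands (fun t => Cpowpos (1 - t) (- s) * (cpsum f N (t * x / (1 - t)) * RtoC (eta 0 (x / (1 - t)))))%C
          (Lc sg (fun j => eta j x) x f s) N.
Proof.
  induction N as [|N IH]; intros f s.
  - exists 0, 1. split; [lra|]. intros t Ht. simpl.
    match goal with |- Cmod ?z <= _ => replace z with (RtoC 0) by ring end. rewrite Cmod_0. lra.
  - set (e := fun j => eta j x).
    eapply (expands_ext (fun t => f O * B s 0 t + RtoC x * (RtoC t * (Cpowpos (1 - t) (- (s + RtoC 1)) *
        (cpsum (fun n => f (S n)) N (t * x / (1 - t)) * RtoC (eta 0 (x / (1 - t)))))))%C _
      (fun k => f O * bc sg e s k 0 + RtoC x * cshift (Lc sg e x (fun n => f (S n)) (s + RtoC 1)) k)%C _ _ 1); [lra| | |].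
    + intros t Ht. unfold B. rewrite cpsum_horner.
      replace (- (s + RtoC 1))%C with (- s + RtoC (- (1)))%C by (rewrite RtoC_opp; ring).
      rewrite Cpowpos_plus, Cpowpos_real, Rpower_Ropp, Rpower_1 by lra.
      replace (t * x / (1 - t)) with (t * x * / (1 - t)) by reflexivity.
      rewrite !RtoC_mult. ring.
    + intros [|k] _; cbn [cshift Lc]; [ring|reflexivity].
    + apply expands_plus; apply expands_scal; [apply ladder_expands|]. apply expands_shift, IH.
Qed.

(** For [t <= 1/2] one has [z <= 2 x t], so replacing [F] by its partial sum costs
    [O(z^N) = O(t^N)]; the remaining factor is bounded by [ladder_expands] at order 0. *)
Lemma Lc_expands F f s N : (forall n, expands F f n) ->
  expands (fun t => Cpowpos (1 - t) (- s) * (F (t * x / (1 - t))%R * RtoC (eta 0 (x / (1 - t)))))%C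
          (Lc sg (fun j => eta j x) x f s) N.
Proof.
  intros HF. destruct (HF N) as [M [d [Hd H]]].
  destruct (ladder_expands 0 s 0) as [M0 [d0 [Hd0 H0]]]. simpl in H0.
  set (r := Rmin (Rmin (1 / 2) d0) (d / (2 * x))).
  assert (Hr : 0 < r) by (repeat apply Rmin_pos; try lra; apply Rdiv_lt_0_compat; lra).
  apply expands_perturb with (3 := poly_ladder_expands N f s)
    (M := M0 * (Rabs M * (2 * x) ^ N)) (d := r); [exact Hr|].
  intros t Ht.
  assert (R1 := Rmin_l (Rmin (1 / 2) d0) (d / (2 * x))). assert (R2 := Rmin_r (Rmin (1 / 2) d0) (d / (2 * x))).
  assert (R3 := Rmin_l (1 / 2) d0). assert (R4 := Rmin_r (1 / 2) d0). fold r in R1, R2.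
  set (z := t * x / (1 - t)).
  assert (Hz : 0 < z <= 2 * x * t).
  { unfold z. split; [apply Rdiv_lt_0_compat; nra|].
    replace (t * x / (1 - t)) with (x * t * / (1 - t)) by (unfold Rdiv; ring).
    assert (/ (1 - t) <= 2) by (rewrite <- (Rinv_inv 2); apply Rinv_le_contravar; lra).
    assert (0 < x * t) by nra. nra. }
  assert (Hzd : z < d).
  { apply Rle_lt_trans with (1 := proj2 Hz). replace d with (2 * x * (d / (2 * x))) by (field; lra).
    apply Rmult_lt_compat_l; lra. }
  specialize (H z ltac:(lra)). specialize (H0 t ltac:(lra)).
  replace (Cpowpos (1 - t) (- s) * (F z * RtoC (eta 0 (x / (1 - t)))) - Cpowpos (1 - t) (- s) * (cpsum f N z * RtoC (eta 0 (x /
    (1 - t)))))%C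
    with ((B s 0 t - RtoC 0) * (F z - cpsum f N z))%C by (unfold B; ring).
  rewrite Cmod_mult.
  replace (M0 * (Rabs M * (2 * x) ^ N) * t ^ N) with (M0 * 1 * (Rabs M * (2 * x * t) ^ N)) by (rewrite (Rpow_mult_distr (2 * x) t); ring).
  apply Rmult_le_compat; try apply Cmod_ge_0; [easy|].
  eapply Rle_trans; [apply H|].
  apply Rle_trans with (Rabs M * z ^ N).
  - apply Rmult_le_compat_r; [apply pow_le; lra|apply Rle_abs].
  - apply Rmult_le_compat_l; [apply Rabs_pos|apply pow_incr; lra].
Qed.

End Ladder.

(** * Asymptotics of the coefficients *)

(** The coefficient of [t^k] in [(1 - t)^(-s)]. *)
Definition pochf (s : CC) (k : nat) : CC := (poch s k / RtoC (INR (fact k)))%C.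

Lemma pochf_S s k : pochf s (S k) = (pochf s k * (s + RtoC (INR k)) * RtoC (/ INR (S k)))%C.
Proof.
  unfold pochf. cbn [poch]. rewrite fact_simpl, mult_INR, RtoC_mult.
  assert (INR (S k) <> 0) by (apply not_0_INR; lia).
  rewrite RtoC_inv by easy. field. split; apply RtoC_neq_0; [easy|apply INR_fact_neq_0].
Qed.

(** The relation on [e] says that [e_m x^(-2a)] solves the ladder equation exactly; the leading part
    of the generating function is then [e_m g(x) (1 - t)^(2a - s)], with coefficients
    [pochf (s - 2a)]. In the recursion the contributions of [m] cancel. *)
Lemma bc_lim0 sg (eta : nat -> R -> R) (g : R -> R) (e : nat -> R) (a : R) :
  (forall m, lim0 (fun x => eta m x * / g x) (e m)) ->
  (forall m, sg * e (S m) = - (a + INR m) * e m) ->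
  forall k s m, Clim0 (fun x => bc sg (fun j => eta j x) s k m * RtoC (/ g x))%C
                      (RtoC (e m) * pochf (s - RtoC (2 * a)) k)%C.
Proof.
  intros Hl He. induction k as [|k IH]; intros s m.
  - replace (RtoC (e m) * pochf (s - RtoC (2 * a)) 0)%C with (RtoC (e m)).
    + apply Clim0_ext with (fun x => RtoC (eta m x * / g x)) 1; [lra| |now apply Clim0_RtoC].
      intros x _. cbn [bc]. apply RtoC_mult.
    + unfold pochf. simpl. field.
  - apply Clim0_ext with (fun x => ((RtoC (INR k) + s + RtoC (2 * INR m)) * (bc sg (fun j => eta j x) s k m * RtoC (/ g x)) +
       RtoC (2 * sg) * (bc sg (fun j => eta j x) s k (S m) * RtoC (/ g x))) * RtoC (/ INR (S k)))%C 1; [lra| |].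
    { intros x _. cbn [bc]. ring. }
    replace (RtoC (e m) * pochf (s - RtoC (2 * a)) (S k))%C with
      (((RtoC (INR k) + s + RtoC (2 * INR m)) * (RtoC (e m) * pochf (s - RtoC (2 * a)) k) +
        RtoC (2 * sg) * (RtoC (e (S m)) * pochf (s - RtoC (2 * a)) k)) * RtoC (/ INR (S k)))%C.
    + apply Clim0_mult; [|apply Clim0_const].
      apply Clim0_plus; (apply Clim0_mult; [apply Clim0_const|apply IH]).
    + assert (E : (RtoC (2 * sg) * RtoC (e (S m)))%C = RtoC (- (2 * a * e m) - 2 * INR m * e m)).
      { rewrite <- RtoC_mult. f_equal. rewrite Rmult_assoc, He. ring. }
      rewrite pochf_S, (Cmult_assoc (RtoC (2 * sg))), E.
      rewrite RtoC_minus, RtoC_opp, !RtoC_mult. ring.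
Qed.

(** The terms with [f n], [n >= 1], carry a factor [x] and disappear, so only [f 0] survives. For
    the shifted sequence the existence of a limit is enough, as it is multiplied by 0. *)
Lemma Lc_lim0 sg (eta : nat -> R -> R) (g : R -> R) (e : nat -> R) (a : R) :
  (forall m, lim0 (fun x => eta m x * / g x) (e m)) ->
  (forall m, sg * e (S m) = - (a + INR m) * e m) ->
  forall k f s, Clim0 (fun x => Lc sg (fun j => eta j x) x f s k * RtoC (/ g x))%C
                      (f O * (RtoC (e O) * pochf (s - RtoC (2 * a)) k))%C.
Proof.
  intros Hl He k f s.
  assert (Hb := fun k => bc_lim0 sg eta g e a Hl He k s 0).
  assert (H : exists l, Clim0 (fun x => Lc sg (fun j => eta j x) x f s k * RtoC (/ g x))%C l /\
      l = (f O * (RtoC (e O) * pochf (s - RtoC (2 * a)) k))%C).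
  { revert f s Hb. induction k as [|k IH]; intros f s Hb.
    - eexists. split; [|reflexivity].
      apply Clim0_ext with (fun x => f O * (bc sg (fun j => eta j x) s 0 0 * RtoC (/ g x)))%C 1; [lra| |].
      { intros x _. cbn [Lc]. ring. }
      apply Clim0_mult; [apply Clim0_const|apply Hb].
    - destruct (IH (fun n => f (S n)) (s + RtoC 1)%C) as [l [Hl' _]].
      { intros j. apply (bc_lim0 sg eta g e a Hl He). }
      exists (f O * (RtoC (e O) * pochf (s - RtoC (2 * a)) (S k)) + RtoC 0 * l)%C. split; [|ring].
      apply Clim0_ext with (fun x => f O * (bc sg (fun j => eta j x) s (S k) 0 * RtoC (/ g x)) +
        RtoC x * (Lc sg (fun j => eta j x) x (fun n => f (S n)) (s + RtoC 1) k * RtoC (/ g x)))%C 1; [lra| |].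
      { intros x _. cbn [Lc]. ring. }
      apply Clim0_plus; apply Clim0_mult; [apply Clim0_const|apply Hb| |easy].
      apply Clim0_RtoC, lim0_id. }
  destruct H as [l [H1 ->]]. exact H1.
Qed.

(** The weight of level [m + 1] exceeds that of level [m] by [x/2], so the raising term
    [2 sg eta_(m+1)] gains a power of [x] at each step, while the diagonal term is [O(1/x)] relative
    to it. Hence only [sg^k x^k / k!] remains. *)
Lemma bc_inf sg (eta : nat -> R -> R) (g : R -> R) :
  (forall m, Oinf (fun x => eta m x * / (g x * (x / 2) ^ m)) 1) ->
  forall k s m, COinf (fun x => bc sg (fun j => eta j x) s k m * RtoC (/ (g x * (x / 2) ^ m * x ^ k)))%C
                      (RtoC (sg ^ k / INR (fact k))).
Proof.
  intros Hl. induction k as [|k IH]; intros s m.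
  - replace (sg ^ 0 / INR (fact 0)) with 1 by (simpl; field).
    apply COinf_ext with (fun x => RtoC (eta m x * / (g x * (x / 2) ^ m))) 0; [|now apply COinf_RtoC].
    intros x _. cbn [bc]. rewrite pow_O, Rmult_1_r. apply RtoC_mult.
  - apply COinf_ext with (fun x => ((RtoC (INR k) + s + RtoC (2 * INR m)) *
       ((bc sg (fun j => eta j x) s k m * RtoC (/ (g x * (x / 2) ^ m * x ^ k))) * RtoC (/ x)) +
       RtoC sg * (bc sg (fun j => eta j x) s k (S m) * RtoC (/ (g x * (x / 2) ^ S m * x ^ k)))) * RtoC (/ INR (S k)))%C 0.
    { intros x Hx. cbn [bc].
      assert (E1 : / (g x * (x / 2) ^ m * x ^ S k) = / (g x * (x / 2) ^ m * x ^ k) * / x).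
      { rewrite <- Rinv_mult. f_equal. simpl. ring. }
      assert (E2 : / (g x * (x / 2) ^ S m * x ^ k) = 2 * / (g x * (x / 2) ^ m * x ^ S k)).
      { replace (g x * (x / 2) ^ S m * x ^ k) with (/ 2 * (g x * (x / 2) ^ m * x ^ S k)) by (simpl; field).
        now rewrite Rinv_mult, Rinv_inv. }
      rewrite E2, RtoC_mult, E1, !RtoC_mult. ring. }
    replace (RtoC (sg ^ S k / INR (fact (S k)))) with
      (((RtoC (INR k) + s + RtoC (2 * INR m)) * (RtoC (sg ^ k / INR (fact k)) * RtoC 0) +
        RtoC sg * RtoC (sg ^ k / INR (fact k))) * RtoC (/ INR (S k)))%C.
    + apply COinf_mult; [|apply COinf_const].
      apply COinf_plus; (apply COinf_mult; [apply COinf_const|]); [|apply IH].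
      apply COinf_mult; [apply IH|apply COinf_RtoC, Oinf_inv_x].
    + rewrite !Cmult_0_r, Cplus_0_l, <- !RtoC_mult. f_equal.
      rewrite fact_simpl, mult_INR. simpl pow. field.
      split; [apply INR_fact_neq_0|apply not_0_INR; lia].
Qed.

(* Coefficients of [exp (sg z) * sum_n f_n z^n]. *)
Fixpoint gam (sg : R) (f : nat -> CC) (k : nat) : CC :=
  match k with
  | O => f O
  | S j => (f O * RtoC (sg ^ S j / INR (fact (S j))) + gam sg (fun n => f (S n)) j)%C
  end.

(** Both terms of the Horner recursion have the same order [x^k], so, in contrast with the limit at
    0, all coefficients of [F] up to the index contribute. *)
Lemma Lc_inf sg (eta : nat -> R -> R) (g : R -> R) :
  (forall m, Oinf (fun x => eta m x * / (g x * (x / 2) ^ m)) 1) ->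
  forall k f s, COinf (fun x => Lc sg (fun j => eta j x) x f s k * RtoC (/ (g x * x ^ k)))%C (gam sg f k).
Proof.
  intros Hl. assert (Hb := fun k s => bc_inf sg eta g Hl k s 0).
  assert (Hb' : forall k s, COinf (fun x => bc sg (fun j => eta j x) s k 0 * RtoC (/ (g x * x ^ k)))%C (RtoC (sg ^ k / INR (fact k)))).
  { intros k s. eapply COinf_ext with (X := 0); [|apply (Hb k s)]. intros x _. cbv beta. rewrite pow_O, Rmult_1_r. reflexivity. }
  induction k as [|k IH]; intros f s.
  - apply COinf_ext with (fun x => f O * (bc sg (fun j => eta j x) s 0 0 * RtoC (/ (g x * x ^ 0))))%C 0.
    { intros x _. cbn [Lc]. ring. }
    replace (gam sg f 0) with (f O * RtoC (sg ^ 0 / INR (fact 0)))%C.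
    + apply COinf_mult; [apply COinf_const|apply Hb'].
    + simpl. replace (1 / 1) with 1 by field. ring.
  - apply COinf_ext with (fun x => f O * (bc sg (fun j => eta j x) s (S k) 0 * RtoC (/ (g x * x ^ S k))) +
        Lc sg (fun j => eta j x) x (fun n => f (S n)) (s + RtoC 1) k * RtoC (/ (g x * x ^ k)))%C 0.
    { intros x Hx. cbn [Lc].
      assert (E : / (g x * x ^ k) = x * / (g x * x ^ S k)).
      { replace (g x * x ^ k) with (/ x * (g x * x ^ S k)) by (simpl; field; lra).
        now rewrite Rinv_mult, Rinv_inv. }
      rewrite E, (RtoC_mult x). ring. }
    apply COinf_plus; [|apply IH]. apply COinf_mult; [apply COinf_const|apply Hb'].
Qed.

Lemma gam_ext sg f h k : (forall n, f n = h n) -> gam sg f k = gam sg h k.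
Proof.
  revert f h. induction k as [|k IH]; intros f h H; cbn [gam]; rewrite H; [easy|].
  f_equal. apply IH. intros; apply H.
Qed.

Lemma gam_plus sg f h k : gam sg (fun n => f n + h n)%C k = (gam sg f k + gam sg h k)%C.
Proof.
  revert f h. induction k as [|k IH]; intros f h; cbn [gam]; [easy|]. rewrite IH. ring.
Qed.

Lemma gam_scal sg c f k : gam sg (fun n => c * f n)%C k = (c * gam sg f k)%C.
Proof.
  revert f. induction k as [|k IH]; intros f; cbn [gam]; [easy|]. rewrite IH. ring.
Qed.

Definition theta (f : nat -> CC) (n : nat) : CC := (RtoC (INR n) * f n)%C.

(* Leibniz' rule for [z d/dz]. *)
Lemma gam_theta sg f k :
  (RtoC (INR (S k)) * gam sg f (S k) = RtoC sg * gam sg f k + gam sg (theta f) (S k))%C.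
Proof.
  revert f. induction k as [|k IH]; intros f.
  - unfold theta. cbn [gam]. simpl. replace (sg * 1 / 1) with sg by field. ring.
  - change (gam sg f (S (S k))) with (f O * RtoC (sg ^ S (S k) / INR (fact (S (S k)))) + gam sg (fun n => f (S n)) (S k))%C.
    change (gam sg (theta f) (S (S k))) with
      (theta f O * RtoC (sg ^ S (S k) / INR (fact (S (S k)))) + gam sg (fun n => theta f (S n)) (S k))%C.
    rewrite (gam_ext sg (fun n => theta f (S n)) (fun n => theta (fun n => f (S n)) n + f (S n))%C).
    2:{ intros n. unfold theta. rewrite S_INR, RtoC_plus. ring. }
    rewrite gam_plus. specialize (IH (fun n => f (S n))).
    rewrite (S_INR (S k)), RtoC_plus.
    replace ((RtoC (INR (S k)) + RtoC 1) * (f O * RtoC (sg ^ S (S k) / INR (fact (S (S k)))) + gam sg (fun n => f (S n)) (S k)))%C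
      with (f O * ((RtoC (INR (S k)) + RtoC 1) * RtoC (sg ^ S (S k) / INR (fact (S (S k))))) +
       (RtoC (INR (S k)) * gam sg (fun n => f (S n)) (S k) + gam sg (fun n => f (S n)) (S k)))%C by ring.
    rewrite IH.
    replace ((RtoC (INR (S k)) + RtoC 1) * RtoC (sg ^ S (S k) / INR (fact (S (S k)))))%C
      with (RtoC sg * RtoC (sg ^ S k / INR (fact (S k))))%C.
    + cbn [gam]. unfold theta at 3. simpl INR. ring.
    + rewrite <- RtoC_plus, <- !RtoC_mult. f_equal. rewrite (fact_simpl (S k)), mult_INR, (S_INR (S k)). simpl pow.
      field. split; [apply INR_fact_neq_0|]. assert (H := pos_INR (S k)). lra.
Qed.

(** The conditions on [f] are the equation [theta^2 F + mu theta F = z^2 F] for [F = sum f_n z^n].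
    For [exp (sg z) F] it would give a three-term recursion, but [sg^2 = 1] cancels the [z^2] terms;
    the two-term recursion left has the factor [2 k - 1 + mu], nonzero unless [mu] is a negative odd
    integer. *)
Lemma gam_neq_0 sg f (mu : CC) : sg ^ 2 = 1 -> f O <> RtoC 0 -> f 1%nat = RtoC 0 ->
  (forall n, RtoC (INR (S (S n))) * (RtoC (INR (S (S n))) + mu) * f (S (S n)) = f n)%C ->
  (forall n : nat, mu <> RtoC (- INR (S n))) -> forall k, gam sg f k <> RtoC 0.
Proof.
  intros Hsg H0 H1 Hrec Hmu.
  assert (Hsg0 : sg <> 0) by (intros E; rewrite E in Hsg; simpl in Hsg; lra).
  (* Multiplication of the series by [z^2]; it turns the hypotheses on [f] into the coefficientwise
     equation [Ht]. *)
  set (f2 := cshift (cshift f)).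
  assert (Ht : forall n, theta (theta f) n = (- mu * theta f n + f2 n)%C).
  { intros [|[|n]]; unfold theta, f2, cshift.
    - simpl; ring.
    - rewrite H1. ring.
    - rewrite <- (Hrec n). ring. }
  assert (Hstep : forall k, (RtoC (INR (S k)) * (RtoC (INR (S k)) + mu) * gam sg f (S k) =
     RtoC sg * (RtoC (2 * INR (S k) - 1) + mu) * gam sg f k)%C).
  { intros [|k].
    - cbn [gam]. rewrite H1. simpl. replace (sg * 1 / 1) with sg by field. replace (2 * 1 - 1) with 1 by ring. ring.
    - assert (E1 := gam_theta sg f (S k)). assert (E2 := gam_theta sg (theta f) (S k)).
      assert (E3 := gam_theta sg f k).
      rewrite (gam_ext sg (theta (theta f)) (fun n => - mu * theta f n + f2 n)%C _ Ht) in E2.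
      rewrite gam_plus, gam_scal in E2.
      assert (E4 : gam sg f2 (S (S k)) = gam sg f k).
      { unfold f2. cbn [gam cshift]. change (fun n => f n) with f. ring. }
      rewrite E4 in E2.
      set (g2 := gam sg f (S (S k))) in *. set (g1 := gam sg f (S k)) in *. set (g0 := gam sg f k) in *.
      set (t2 := gam sg (theta f) (S (S k))) in *. set (t1 := gam sg (theta f) (S k)) in *.
      assert (E1' : t2 = (RtoC (INR (S (S k))) * g2 - RtoC sg * g1)%C) by (rewrite E1; ring).
      assert (E3' : t1 = (RtoC (INR (S k)) * g1 - RtoC sg * g0)%C) by (rewrite E3; ring).
      rewrite E1', E3' in E2.
      assert (Hsgc : (RtoC sg * RtoC sg)%C = RtoC 1) by (rewrite <- RtoC_mult; f_equal; simpl in Hsg; lra).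
      rewrite (S_INR (S k)) in *. set (N := INR (S k)) in *.
      replace (RtoC (2 * (N + 1) - 1)) with (RtoC N + RtoC N + RtoC 1)%C by (rewrite <- !RtoC_plus; f_equal; ring).
      rewrite RtoC_plus in *.
      assert (E5 : ((RtoC N + RtoC 1) * ((RtoC N + RtoC 1) * g2 - RtoC sg * g1) -
        (RtoC sg * (RtoC N * g1 - RtoC sg * g0) + (- mu * ((RtoC N + RtoC 1) * g2 - RtoC sg * g1) + g0)) = RtoC 0)%C)
        by (rewrite E2; ring).
      assert (E6 : ((RtoC N + RtoC 1) * (RtoC N + RtoC 1 + mu) * g2 =
        RtoC sg * (RtoC N + RtoC N + RtoC 1 + mu) * g1 + (RtoC 1 - RtoC sg * RtoC sg) * g0 +
        ((RtoC N + RtoC 1) * ((RtoC N + RtoC 1) * g2 - RtoC sg * g1) -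
        (RtoC sg * (RtoC N * g1 - RtoC sg * g0) + (- mu * ((RtoC N + RtoC 1) * g2 - RtoC sg * g1) + g0))))%C) by ring.
      rewrite E6, E5, Hsgc. ring. }
  induction k as [|k IH]; [exact H0|].
  intros E. specialize (Hstep k). rewrite E, Cmult_0_r in Hstep.
  symmetry in Hstep. revert Hstep. apply Cmult_neq_0; [|exact IH].
  apply Cmult_neq_0; [now apply RtoC_neq_0|].
  (* The excluded value is [mu = - (2 k + 1)]. *)
  intros E2. apply (Hmu (2 * k)%nat).
  replace mu with ((RtoC (2 * INR (S k) - 1) + mu) - RtoC (2 * INR (S k) - 1))%C by ring.
  rewrite E2, !S_INR, mult_INR, <- RtoC_minus. f_equal. simpl. ring.
Qed.

(** * The ladders of I and K *)

Definition etaI (a : R) (m : nat) (x : R) : R := (x / 2) ^ (2 * m) * rI (a + INR m) x.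
Definition etaK (a : R) (m : nat) (x : R) : R := (x / 2) ^ (2 * m) * Ktilde (a + INR m) x.

Lemma is_derive_pow_half (m : nat) x : 0 < x ->
  is_derive (fun x => (x / 2) ^ (2 * m)) x (2 * INR m / x * (x / 2) ^ (2 * m)).
Proof.
  intros Hx.
  assert (H1 : is_derive (fun x => x / 2) x (/ 2)) by (auto_derive; [easy|field]).
  assert (H := is_derive_pow _ (2 * m) x _ H1).
  replace (2 * INR m / x * (x / 2) ^ (2 * m)) with (INR (2 * m) * / 2 * (x / 2) ^ pred (2 * m)); [exact H|].
  rewrite mult_INR. simpl (INR 2). destruct m as [|m]; [simpl; field; lra|].
  replace (2 * S m)%nat with (S (2 * m + 1)) by lia. cbn [pred pow]. field. lra.
Qed.

Lemma etaI_ladder a : ladder 1 (etaI a).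
Proof.
  intros m x Hx. unfold etaI.
  assert (H := is_derive_mult _ _ x _ _ (is_derive_pow_half m x Hx) (rI_derive (a + INR m) x) Rmult_comm).
  unfold plus, mult in H; simpl in H.
  exact_derive H.
  replace (a + INR (S m)) with (a + INR m + 1) by (rewrite S_INR; ring).
  replace (2 * S m)%nat with (S (S (2 * m))) by lia.
  change (m + (m + 0))%nat with (2 * m)%nat. cbn [pow]. field. lra.
Qed.

Lemma etaK_ladder a : ladder (-1) (etaK a).
Proof.
  intros m x Hx. unfold etaK.
  assert (H := is_derive_mult _ _ x _ _ (is_derive_pow_half m x Hx) (Ktilde_derive (a + INR m) x Hx) Rmult_comm).
  unfold plus, mult in H; simpl in H.
  exact_derive H.
  replace (a + INR (S m)) with (a + INR m + 1) by (rewrite S_INR; ring).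
  replace (2 * S m)%nat with (S (S (2 * m))) by lia.
  change (m + (m + 0))%nat with (2 * m)%nat. cbn [pow]. field. lra.
Qed.

Lemma etaK_eq a m x : 0 < x -> etaK a m x = Rpower (x / 2) (INR m - a) * BesselK (a + INR m) x.
Proof.
  intros Hx. unfold etaK, Ktilde. rewrite <- Rmult_assoc, <- Rpower_pow, <- Rpower_plus by lra.
  f_equal. f_equal. rewrite mult_INR. simpl (INR 2). ring.
Qed.

Lemma rI_lim0 a : lim0 (rI a) (rg (a + 1)).
Proof.
  apply lim0_of_RtoC.
  assert (H := expands_Clim0 _ _ (Itilde_expands (RtoC a) 1)).
  rewrite even_coef_0, cI_real in H.
  replace (rcI a 0) with (rg (a + 1)) in H by (unfold rcI; simpl; rewrite Rplus_0_l; field).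
  apply Clim0_ext with (Itilde (RtoC a)) 1; [lra| |exact H]. intros x _. apply Itilde_real.
Qed.

(** All levels [m >= 1] vanish, so the relation of [bc_lim0] holds with [a = 0] there; the factor
    [/ 1] exhibits the weight [g = 1]. *)
Lemma etaI_lim0 a m : lim0 (fun x => etaI a m x * / 1) (match m with O => rg (a + 1) | S _ => 0 end).
Proof.
  rewrite Rinv_1. destruct m as [|m].
  - apply lim0_ext with (rI a) 1; [lra| |apply rI_lim0]. intros x _. unfold etaI. simpl. rewrite Rplus_0_r. ring.
  - apply lim0_ext with (fun x => / 2 * x * (((x / 2) ^ (2 * m + 1)) * rI (a + INR (S m)) x)) 1; [lra| |].
    + intros x _. unfold etaI. replace (2 * S m)%nat with (S (2 * m + 1)) by lia. cbn [pow]. field.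
    + replace 0 with (/ 2 * 0 * ((0 / 2) ^ (2 * m + 1) * rg (a + INR (S m) + 1))) by ring.
      assert (Hp : forall n, lim0 (fun x => (x / 2) ^ n) ((0 / 2) ^ n)).
      { induction n as [|n IH]; simpl; [apply lim0_const|]. apply lim0_mult; [|easy].
        apply (lim0_mult (fun x => x) (fun _ => / 2)); [apply lim0_id|apply lim0_const]. }
      apply lim0_mult; [apply lim0_mult; [apply lim0_const|apply lim0_id]|].
      apply lim0_mult; [apply Hp|apply rI_lim0].
Qed.

(** With the weight [(x/2)^(-2a)] every level survives: [eta_m] becomes [nB (a + m)], and the
    relation of [bc_lim0] is the functional equation of Gamma. *)
Lemma etaK_lim0_pos a m : 0 < a ->
  lim0 (fun x => etaK a m x * / Rpower (x / 2) (- (2 * a))) (/ (2 * rg (a + INR m))).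
Proof.
  intros Ha. assert (Hm := pos_INR m).
  apply lim0_ext with (nB (a + INR m)) 1; [lra| |apply nB_Gamma; lra].
  intros x Hx. rewrite etaK_eq by lra. unfold nB. rewrite <- Rpower_Ropp, Ropp_involutive.
  replace (a + INR m) with (INR m - a + 2 * a) at 1 by ring. rewrite Rpower_plus. ring.
Qed.

(** Only level 0 is logarithmic: for [m >= 1] the function [eta_m = nB m] has a finite limit, which
    the weight sends to 0. *)
Lemma etaK_lim0_zero m : lim0 (fun x => etaK 0 m x * / - ln (x / 2)) (match m with O => 1 | S _ => 0 end).
Proof.
  destruct m as [|m].
  - apply lim0_ext with (fun x => BesselK 0 x / - ln (x / 2)) 1; [lra| |apply K_0_log].
    intros x Hx. rewrite etaK_eq by lra. simpl. rewrite Rminus_0_r, Rplus_0_r, Rpower_O by lra. unfold Rdiv. ring.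
  - refine (eq_ind (/ (2 * rg (INR (S m))) * 0) (lim0 _) _ 0 _); [|ring].
    apply lim0_mult; [|apply lim0_inv_ln].
    assert (Hm : 0 < INR (S m)) by (apply lt_0_INR; lia).
    apply lim0_ext with (nB (INR (S m))) 1; [lra| |now apply nB_Gamma].
    intros x Hx. rewrite etaK_eq by lra. unfold nB. now rewrite Rminus_0_r, Rplus_0_l.
Qed.

(** At level 0, evenness in the order gives [nB (- a)]; above it [|a + m| < m - a] and
    [K_negligible] applies. *)
Lemma etaK_lim0_neg a m : a < 0 ->
  lim0 (fun x => etaK a m x * / 1) (match m with O => / (2 * rg (- a)) | S _ => 0 end).
Proof.
  intros Ha. rewrite Rinv_1. destruct m as [|m].
  - apply lim0_ext with (nB (- a)) 1; [lra| |apply nB_Gamma; lra].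
    intros x Hx. rewrite etaK_eq by lra. unfold nB. simpl. rewrite Rplus_0_r, K_neg.
    replace (0 - a) with (- a) by ring. ring.
  - apply lim0_ext with (fun x => Rpower (x / 2) (INR (S m) - a) * BesselK (a + INR (S m)) x) 1; [lra| |].
    + intros x Hx. rewrite etaK_eq by lra. ring.
    + apply K_negligible. assert (Hm : 0 < INR (S m)) by (apply lt_0_INR; lia).
      apply Rabs_def1; lra.
Qed.

(** A single [k] must serve all levels, whereas [rI_asymp] at order [a + m] would give a constant
    depending on [m]. Hence only level 0 rests on [rI_asymp], and the next ones follow from
    [eta_(m+1) = (x/2) rho (a+m) eta_m] with [rho] tending to 1. *)
Lemma etaI_Oinf a : exists k, 0 < k /\
  forall m, Oinf (fun x => etaI a m x * / ((k * (Rpower x (- a - 1 / 2) * exp x)) * (x / 2) ^ m)) 1.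
Proof.
  destruct (rI_asymp a) as [k [Hk H]]. exists k. split; [easy|].
  induction m as [|m IH].
  - apply Oinf_ext with (2 := H) (X := 0). intros x Hx. unfold etaI. simpl. rewrite Rplus_0_r, Rmult_1_r. unfold Rdiv. ring.
  - destruct (rI_eventually_pos (a + INR m)) as [X [d [HX [Hd Hp]]]].
    apply Oinf_ext with (fun x => etaI a m x * / ((k * (Rpower x (- a - 1 / 2) * exp x)) * (x / 2) ^ m) * rho (a + INR m) x) X.
    + intros x Hx. specialize (Hp x Hx). unfold etaI, rho.
      replace (2 * S m)%nat with (S (S (2 * m))) by lia.
      replace (a + INR (S m)) with (a + INR m + 1) by (rewrite S_INR; ring).
      assert (Hq : 0 < Rpower x (- a - 1 / 2) * exp x) by (apply Rmult_lt_0_compat; apply exp_pos).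
      assert (Hpw : 0 < (x / 2) ^ m) by (apply pow_lt; lra).
      cbn [pow]. set (q := Rpower x (- a - 1 / 2) * exp x) in *. field.
      repeat split; lra.
    + refine (eq_ind (1 * 1) (Oinf _) _ 1 _); [|ring]. apply Oinf_mult; [exact IH|apply rho_Oinf].
Qed.

(** The limit [kappa] of [nK] is the same for every order, so [k = kappa 2^a] serves all levels; the
    power [2^a] comes from [(x/2)^(-a)]. *)
Lemma etaK_Oinf a : exists k, 0 < k /\
  forall m, Oinf (fun x => etaK a m x * / ((k * (Rpower x (- a - 1 / 2) * exp (- x))) * (x / 2) ^ m)) 1.
Proof.
  assert (Hk := kappa_pos).
  exists (kappa * Rpower 2 a). split; [apply Rmult_lt_0_compat; [easy|apply exp_pos]|]. intros m.
  apply Oinf_ext with (fun x => / kappa * nK (a + INR m) x) 0.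
  - intros x Hx. rewrite etaK_eq by easy. unfold nK.
    assert (E1 : Rpower (x / 2) (INR m - a) = (x / 2) ^ m * (Rpower 2 a * Rpower x (- a))).
    { rewrite <- Rpower_pow by lra. unfold Rpower. rewrite <- !exp_plus. f_equal. rewrite ln_div by lra. ring. }
    assert (E2 : Rpower x (- a - 1 / 2) = Rpower x (- a) * / Rpower x (1 / 2)).
    { rewrite <- Rpower_Ropp, <- Rpower_plus. f_equal. }
    rewrite E1, E2, exp_Ropp.
    assert (P1 := exp_pos x). assert (P2 : 0 < Rpower 2 a) by apply exp_pos.
    assert (P3 : 0 < Rpower x (- a)) by apply exp_pos. assert (P4 : 0 < Rpower x (1 / 2)) by apply exp_pos.
    assert (P5 : 0 < (x / 2) ^ m) by (apply pow_lt; lra).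
    field. repeat split; lra.
  - refine (eq_ind (/ kappa * kappa) (Oinf _) _ 1 _); [|field; lra].
    apply (Oinf_mult (fun _ => / kappa)); [apply Oinf_const|apply nK_Oinf].
Qed.

(** The differential equation of the normalised I read on coefficients, with [mu = 2 al] in the
    notation of [gam_neq_0]. *)
Lemma even_coef_cI_rec al n :
  (RtoC (INR (S (S n))) * (RtoC (INR (S (S n))) + RtoC 2 * al) * even_coef (cI al) (S (S n)) = even_coef (cI al) n)%C.
Proof.
  unfold even_coef. simpl Nat.even. destruct (Nat.even n) eqn:En; [|ring].
  apply Nat.even_spec in En. destruct En as [i ->].
  change (Nat.div2 (S (S (2 * i)))) with (S (Nat.div2 (2 * i))). rewrite Nat.div2_double.
  unfold cI. rewrite (rgamma_rec (al + RtoC (INR i + 1))%C).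
  replace (al + RtoC (INR i + 1) + RtoC 1)%C with (al + RtoC (INR (S i) + 1))%C by (rewrite S_INR, !RtoC_plus; ring).
  rewrite fact_simpl, mult_INR.
  replace (INR (S (S (2 * i)))) with (2 * INR (S i)) by (rewrite !S_INR, mult_INR; simpl; ring).
  replace (INR i + 1) with (INR (S i)) by (rewrite S_INR; ring).
  assert (Hi : INR (S i) <> 0) by (apply not_0_INR; lia).
  assert (Hf := INR_fact_neq_0 i). assert (H4 : 4 ^ i <> 0) by (apply pow_nonzero; lra).
  replace (/ 4 ^ S i) with (/ 4 * / 4 ^ i) by (simpl; field; easy).
  rewrite !RtoC_mult, Rinv_mult, !RtoC_mult.
  assert (E : (RtoC (INR (S i)) * RtoC (/ INR (S i)))%C = RtoC 1) by (rewrite <- RtoC_mult; f_equal; field; easy).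
  assert (E4 : (RtoC 2 * RtoC 2 * RtoC (/ 4))%C = RtoC 1) by (rewrite <- !RtoC_mult; f_equal; field).
  set (G := rgamma (al + RtoC (INR (S i) + 1))%C).
  replace (RtoC 2 * RtoC (INR (S i)) * (RtoC 2 * RtoC (INR (S i)) + RtoC 2 * al) *
     (RtoC (/ 4) * RtoC (/ 4 ^ i) * (RtoC (/ INR (S i)) * RtoC (/ INR (fact i)) * G)))%C with
    ((RtoC 2 * RtoC 2 * RtoC (/ 4)) * (RtoC (INR (S i)) * RtoC (/ INR (S i))) * (RtoC (/ 4 ^ i) *
      (RtoC (/ INR (fact i)) * ((al + RtoC (INR (S i))) * G))))%C by ring.
  rewrite E, E4. ring.
Qed.

(* [z^(2m+1) Ktilde_(m+1/2)(z)] is a polynomial times [exp (-z)]. *)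
Definition Epole (m : nat) (z : R) : R := z ^ (2 * m + 1) * Ktilde (INR m + 1 / 2) z.

Lemma Ktilde_rec a z : 0 < z -> Ktilde (a + 1) z = 4 / z ^ 2 * (Ktilde (a - 1) z + a * Ktilde a z).
Proof.
  intros Hz. unfold Ktilde. assert (H := K_rec a z Hz).
  replace (- (a + 1)) with (- a + - (1)) by ring. replace (- (a - 1)) with (- a + 1) by ring.
  rewrite !Rpower_plus, (Rpower_Ropp (z / 2) 1), Rpower_1 by lra.
  replace (a * (Rpower (z / 2) (- a) * BesselK a z)) with (Rpower (z / 2) (- a) * (a * BesselK a z)) by ring.
  rewrite H. field. lra.
Qed.

Lemma rexpands_exp_opp n : rexpands (fun z => exp (- z)) (fun k => (-1) ^ k * / INR (fact k)) n.
Proof.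
  apply rexpands_series with 1; [lra|]. intros t _.
  assert (H := is_exp_Reals (- t)). apply is_pseries_R in H.
  apply is_series_ext with (2 := H). intros k. change (/ INR (fact k) * (- t) ^ k = (-1) ^ k * / INR (fact k) * t ^ k).
  replace (- t) with (-1 * t) by ring. rewrite Rpow_mult_distr. ring.
Qed.

(** Orders 1/2 and 3/2 are explicit. The power [z^(2m+1)] is the one for which the three-term
    recurrence becomes polynomial, [E_(m+2) = 4 (z^2 E_m + (m + 3/2) E_(m+1))], so expansions pass
    along pairs of consecutive [m]. *)
Lemma Epole_expands m : exists d : nat -> CC, forall n, expands (fun z => RtoC (Epole m z)) d n.
Proof.
  assert (Hexp : forall c n, expands (fun z => RtoC (c * exp (- z))) (fun k => RtoC c * RtoC ((-1) ^ k * / INR (fact k)))%C n).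
  { intros c n.
    apply (expands_ext (fun z => RtoC c * RtoC (exp (- z)))%C _ (fun k => RtoC c * RtoC ((-1) ^ k * / INR (fact k)))%C _ _ 1);
      [lra| |easy|].
    - intros t _. now rewrite RtoC_mult.
    - apply expands_scal, expands_RtoC, rexpands_exp_opp. }
  assert (HK : forall z, 0 < z -> BesselK (1 / 2) z = kappa * (Rpower z (- (1 / 2)) * exp (- z))).
  { intros z Hz. rewrite <- (nK_half z Hz). unfold nK. rewrite Rpower_Ropp, exp_Ropp. field.
    split; apply Rgt_not_eq, exp_pos. }
  set (c0 := kappa * Rpower 2 (1 / 2)). set (c1 := kappa * Rpower 2 (- (1 / 2))).
  assert (H0 : forall z, 0 < z -> Epole 0 z = c0 * exp (- z)).
  { intros z Hz. unfold Epole, Ktilde, c0. simpl. replace (0 + 1 / 2) with (1 / 2) by ring. rewrite HK by easy.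
    replace (z * 1) with (Rpower z 1) by (rewrite Rpower_1 by easy; ring).
    unfold Rpower. rewrite ln_div by lra.
    replace (exp (1 * ln z) * (exp (- (1 / 2) * (ln z - ln 2)) * (kappa * (exp (- (1 / 2) * ln z) * exp (- z))))) with
      (kappa * (exp (1 * ln z) * exp (- (1 / 2) * (ln z - ln 2)) * exp (- (1 / 2) * ln z)) * exp (- z)) by ring.
    rewrite <- !exp_plus. do 3 f_equal. field. }
  assert (H1 : forall z, 0 < z -> Epole 1 z = 4 * (z * (c1 * exp (- z)) + 1 / 2 * (c0 * exp (- z)))).
  { intros z Hz. rewrite <- H0 by easy. unfold Epole at 1. simpl (INR 1).
    replace (1 + 1 / 2) with (1 / 2 + 1) by ring. rewrite Ktilde_rec by easy.
    unfold Epole. simpl (INR 0). replace (0 + 1 / 2) with (1 / 2) by ring.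
    assert (E : Ktilde (1 / 2 - 1) z = c1 * exp (- z)).
    { unfold Ktilde, c1. replace (1 / 2 - 1) with (- (1 / 2)) by field. rewrite K_neg, HK by easy. rewrite Ropp_involutive.
      unfold Rpower. rewrite ln_div by lra.
      replace (exp (1 / 2 * (ln z - ln 2)) * (kappa * (exp (- (1 / 2) * ln z) * exp (- z)))) with
        (kappa * (exp (1 / 2 * (ln z - ln 2)) * exp (- (1 / 2) * ln z)) * exp (- z)) by ring.
      rewrite <- !exp_plus. do 3 f_equal. field. }
    rewrite E. simpl pow. field. lra. }
  assert (H2 : forall m z, 0 < z -> Epole (S (S m)) z = 4 * (z * (z * Epole m z) + (INR (S m) + 1 / 2) * Epole (S m) z)).
  { intros j z Hz. unfold Epole at 1. replace (INR (S (S j)) + 1 / 2) with (INR (S j) + 1 / 2 + 1) by (rewrite (S_INR (S j)); ring).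
    rewrite Ktilde_rec by easy. unfold Epole.
    replace (INR (S j) + 1 / 2 - 1) with (INR j + 1 / 2) by (rewrite S_INR; ring).
    replace (2 * S (S j) + 1)%nat with (4 + (2 * j + 1))%nat by lia.
    replace (2 * S j + 1)%nat with (2 + (2 * j + 1))%nat by lia.
    rewrite !pow_add. field. lra. }
  assert (H : (exists d : nat -> CC, forall n, expands (fun z => RtoC (Epole m z)) d n) /\
              (exists d : nat -> CC, forall n, expands (fun z => RtoC (Epole (S m) z)) d n)); [|apply H].
  induction m as [|m [[d Hd] [d' Hd']]].
  - split.
    + eexists. intros n. eapply expands_ext with (d := 1); [lra| |reflexivity|apply (Hexp c0)].
      intros z Hz. now rewrite H0 by lra.
    + eexists. intros n. eapply expands_ext with (d := 1);
        [lra| |reflexivity|apply expands_scal, expands_plus; [apply expands_le with (S n); [lia|]; apply expands_shift, (Hexp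
          c1)|apply expands_scal, (Hexp c0)]].
      instantiate (1 := RtoC (1 / 2)). instantiate (1 := RtoC 4).
      intros z Hz. rewrite H1 by lra. rewrite !RtoC_mult, !RtoC_plus, !RtoC_mult. ring.
  - split; [now exists d'|].
    eexists. intros n. eapply expands_ext with (d := 1);
      [lra| |reflexivity|apply expands_scal, expands_plus; [apply expands_le with (S (S n)); [lia|]; apply expands_shift,
        expands_shift, Hd|apply expands_scal, Hd']].
    instantiate (1 := RtoC (INR (S m) + 1 / 2)). instantiate (1 := RtoC 4).
    intros z Hz. rewrite H2 by lra. rewrite !RtoC_mult, (RtoC_plus (z * (z * Epole m z))), !RtoC_mult. ring.
Qed.

(** With [a = m + 1/2] one has [z^(2a) = 2^(2a) (z/2)^(2a)], so this is [2^(2a)] times the limit of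
    [nB a]. *)
Lemma Epole_lim0 m : lim0 (Epole m) (Rpower 2 (INR (2 * m + 1)) * / (2 * rg (INR m + 1 / 2))).
Proof.
  assert (Hm := pos_INR m).
  apply lim0_ext with (fun z => Rpower 2 (INR (2 * m + 1)) * nB (INR m + 1 / 2) z) 1; [lra| |].
  - intros z Hz. unfold Epole, nB, Ktilde. rewrite <- Rpower_pow by lra.
    replace (INR (2 * m + 1)) with ((INR m + 1 / 2) + (INR m + 1 / 2)) by (rewrite plus_INR, mult_INR; simpl; field).
    set (a := INR m + 1 / 2).
    replace (Rpower z (a + a)) with (Rpower 2 (a + a) * Rpower (z / 2) (a + a)).
    + rewrite (Rpower_plus a a (z / 2)), Rpower_Ropp. field. apply Rgt_not_eq, exp_pos.
    + rewrite Rpower_mult_distr by lra. f_equal. field.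
  - apply (lim0_mult (fun _ => _)); [apply lim0_const|]. apply nB_Gamma. lra.
Qed.

(** * From the coefficients to the theorem *)

Lemma gamma_real b : 0 < b -> Gamma (RtoC b) = RtoC (/ rg b).
Proof.
  intros Hb. unfold Gamma. rewrite rgamma_real, RtoC_inv; [easy|]. apply Rgt_not_eq, rg_pos, Hb.
Qed.

(** At fixed [x] both sides are coefficients of the same expansion in [t], so [expands_unique] makes
    the identity exact. The function [c] takes the power of [x] freed when a pole is cleared. *)
Lemma Lambda_Lc sg (eta : nat -> R -> R) (F : R -> CC) (f : nat -> CC) (s : CC)
  (p : nat) (G : R -> R -> CC) (Lam : Z -> R -> CC) (c : R -> R) :
  ladder sg eta -> (forall n, expands F f n) -> is_Lambda p G Lam ->
  (forall x t, 0 < x -> 0 < t < 1 -> (RtoC (t ^ p) * G t x =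
     RtoC (c x) * (Cpowpos (1 - t) (- s) * (F (t * x / (1 - t))%R * RtoC (eta 0%nat (x / (1 - t))%R))))%C) ->
  forall x k, 0 < x ->
    Lam (Z.of_nat k - Z.of_nat p)%Z x = (RtoC (c x) * Lc sg (fun j => eta j x) x f s k)%C.
Proof.
  intros Hlad HF HL HG x k Hx.
  assert (H1 := laurent_expands _ _ _ (HL x Hx)).
  apply (expands_unique _ (fun k => Lam (Z.of_nat k - Z.of_nat p)%Z x)
    (fun k => RtoC (c x) * Lc sg (fun j => eta j x) x f s k)%C H1).
  intros n.
  eapply expands_ext with (d := 1); [lra| |reflexivity|apply expands_scal, (Lc_expands sg eta x Hlad Hx F f s n HF)].
  intros t Ht. symmetry. apply HG; lra.
Qed.

(** Only the modulus of the comparison function matters, so the weight [- ln (x/2)] can serve for a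
    statement phrased with [ln (x/2)]. *)
Lemma small_o_of_Clim0 (u : R -> CC) (v : R -> CC) (g : R -> R) (l : CC) d :
  0 < d -> (forall x, 0 < x < d -> g x <> 0 /\ Cmod (v x) = Rabs (g x)) ->
  Clim0 (fun x => u x * RtoC (/ g x))%C l ->
  small_o_0 (fun x => u x - RtoC (g x) * l)%C v.
Proof.
  intros Hd Hv H eps He. destruct (H eps He) as [d' [Hd' H']].
  exists (Rmin d d'). split; [now apply Rmin_pos|]. intros x Hx.
  assert (A := Rmin_l d d'). assert (B := Rmin_r d d').
  destruct (Hv x ltac:(lra)) as [Hg Hvx]. specialize (H' x ltac:(lra)). rewrite Hvx.
  assert (E : (u x - RtoC (g x) * l)%C = ((u x * RtoC (/ g x) - l) * RtoC (g x))%C).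
  { rewrite RtoC_inv by easy. field. now apply RtoC_neq_0. }
  rewrite E, Cmod_mult, Cmod_R. apply Rmult_le_compat_r; [apply Rabs_pos|easy].
Qed.

Lemma small_o_0_ext (u u' v v' : R -> CC) d : 0 < d ->
  (forall x, 0 < x < d -> u x = u' x) -> (forall x, 0 < x < d -> v x = v' x) ->
  small_o_0 u v -> small_o_0 u' v'.
Proof.
  intros Hd Hu Hv H eps He. destruct (H eps He) as [d' [Hd' H']].
  exists (Rmin d d'). split; [now apply Rmin_pos|]. intros x Hx.
  assert (A := Rmin_l d d'). assert (B := Rmin_r d d').
  rewrite <- Hu, <- Hv by lra. apply H'. lra.
Qed.

Lemma big_O_of_COinf (L : R -> CC) (w : R -> R) (c : R) (l : CC) :
  (forall x, 0 < x -> 0 < w x) -> 0 < c -> l <> RtoC 0 ->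
  COinf (fun x => L x * RtoC (/ (c * w x)))%C l ->
  exists C1 : CC, C1 <> RtoC 0 /\
    big_O_oo (fun x => Cminus (Cdiv (L x) (Cmult C1 (RtoC (w x)))) (RtoC 1)) (fun x => RtoC (/ x)).
Proof.
  intros Hw Hc Hl H. exists (l * RtoC c)%C. split; [apply Cmult_neq_0; [easy|apply RtoC_neq_0; lra]|].
  destruct (COinf_mult _ _ _ _ H (COinf_const (/ l))) as [M [X [HX HM]]].
  exists M, X. intros x Hx. specialize (HM x Hx). specialize (Hw x ltac:(lra)).
  rewrite Rminus_0_r, Rabs_right in HM by apply Rle_ge, Cmod_ge_0.
  rewrite Cmod_R, Rabs_right by (apply Rle_ge, Rlt_le, Rinv_0_lt_compat; lra).
  replace (L x / (l * RtoC c * RtoC (w x)) - RtoC 1)%C with (L x * RtoC (/ (c * w x)) * / l - l * / l)%C; [exact HM|].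
  rewrite RtoC_inv, RtoC_mult by (apply Rgt_not_eq, Rmult_lt_0_compat; lra). field.
  repeat split; try easy; apply RtoC_neq_0; lra.
Qed.

(** Here [l] may be zero: for [mu = 1] and [sg = 1], the product of [exp z] and [Epole 0 z] is
    constant, so its higher coefficients vanish. *)
Lemma big_O_of_COinf_weak (L : R -> CC) (w : R -> R) (c : R) (l : CC) :
  (forall x, 0 < x -> 0 < w x) -> 0 < c ->
  COinf (fun x => L x * RtoC (/ (c * w x)))%C l ->
  big_O_oo L (fun x => RtoC (w x)).
Proof.
  intros Hw Hc [M [X [HX HM]]].
  exists ((Rabs M + Cmod l) * c), (Rmax 1 X). assert (A := Rmax_l 1 X). assert (B := Rmax_r 1 X).
  intros x Hx. specialize (HM x ltac:(lra)). specialize (Hw x ltac:(lra)).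
  rewrite Rminus_0_r, Rabs_right in HM by apply Rle_ge, Cmod_ge_0.
  rewrite Cmod_R, (Rabs_right (w x)) by lra.
  set (u := (L x * RtoC (/ (c * w x)))%C) in *.
  assert (Hcw : 0 < c * w x) by (apply Rmult_lt_0_compat; lra).
  assert (E : L x = (u * RtoC (c * w x))%C).
  { unfold u. rewrite RtoC_inv by lra. field. apply RtoC_neq_0. lra. }
  rewrite E, Cmod_mult, Cmod_R, (Rabs_right (c * w x)), Rmult_assoc by lra.
  apply Rmult_le_compat_r; [lra|].
  replace u with ((u - l) + l)%C by ring. eapply Rle_trans; [apply Cmod_triangle|].
  apply Rplus_le_compat_r. eapply Rle_trans; [exact HM|].
  apply Rle_trans with (Rabs M / x).
  - apply Rmult_le_compat_r; [apply Rlt_le, Rinv_0_lt_compat; lra|apply Rle_abs].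
  - assert (HA := Rabs_pos M). apply Rmult_le_reg_r with x; [lra|].
    unfold Rdiv. rewrite Rmult_assoc, Rinv_l by lra. nra.
Qed.

Lemma weight_pos q (ex : R -> R) x : 0 < ex x -> 0 < Rpower x q * ex x.
Proof. intros H. apply Rmult_lt_0_compat; [apply exp_pos|easy]. Qed.

Lemma Lambda_inf sg eta (ex : R -> R) (nu c : R) f s k : (forall x, 0 < ex x) ->
  (forall m, Oinf (fun x => eta m x * / ((c * (Rpower x (- (nu / 2) - 1 / 2) * ex x)) * (x / 2) ^ m)) 1) ->
  COinf (fun x => Lc sg (fun j => eta j x) x f s k * RtoC (/ (c * (Rpower x (INR k - (nu + 1) / 2) * ex x))))%C
        (gam sg f k).
Proof.
  intros Hex H.
  apply COinf_ext with (2 := Lc_inf sg eta _ H k f s) (X := 0). intros x Hx. do 3 f_equal.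
  replace (INR k - (nu + 1) / 2) with (- (nu / 2) - 1 / 2 + INR k) by field.
  rewrite Rpower_plus, Rpower_pow by easy. ring.
Qed.

Definition expo (mu : CC) (nu : R) : CC := Cdiv (Cplus mu (RtoC (nu + 2))) (RtoC 2).

(** Subtracting [2a] from the exponent shifts [nu] by [4a]; for [a = nu/2] this replaces [nu] by
    [- nu]. *)
Lemma expo_shift mu nu a : (expo mu nu - RtoC (2 * a))%C = Cdiv (Cplus mu (RtoC (nu - 4 * a + 2))) (RtoC 2).
Proof.
  unfold expo. replace (nu - 4 * a + 2) with (nu + 2 - 2 * (2 * a)) by ring. rewrite RtoC_minus, (RtoC_mult 2 (2 * a)).
  field.
Qed.

(** A pole [mu/2 + 1 = - k] would mean [mu = - 2 (k + 1)], a negative integer. *)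
Lemma half_ne_pole (mu : CC) : (forall n : nat, mu <> RtoC (- INR (S n))) ->
  forall k : nat, (mu / RtoC 2 + RtoC (INR 0 + 1))%C <> RtoC (- INR k).
Proof.
  intros H k E. apply (H (2 * k + 1)%nat).
  assert (H2 : RtoC 2 <> RtoC 0) by (apply RtoC_neq_0; lra).
  replace mu with ((mu / RtoC 2 + RtoC (INR 0 + 1)) * RtoC 2 - RtoC (INR 0 + 1) * RtoC 2)%C by (field; easy).
  rewrite E, <- !RtoC_mult, <- RtoC_minus. f_equal.
  rewrite S_INR, plus_INR, mult_INR. simpl. ring.
Qed.

Section IFactor.

Variables (mu : CC) (nu : R).
Hypothesis (hmu : forall n : nat, mu <> RtoC (- INR (S n))).

Let f := even_coef (cI (mu / RtoC 2)%C).

Lemma I_coef_0 : f O = rgamma (Cdiv (Cplus mu (RtoC 2)) (RtoC 2)).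
Proof.
  unfold f. rewrite even_coef_0. unfold cI. simpl. rewrite Rinv_1, Rplus_0_l, Cmult_1_l. f_equal.
  field.
Qed.

Lemma gam_I_coef_neq_0 sg k : sg ^ 2 = 1 -> gam sg f k <> RtoC 0.
Proof.
  intros Hsg. apply (gam_neq_0 sg f mu); auto.
  - unfold f. rewrite even_coef_0. unfold cI. apply Cmult_neq_0.
    + apply RtoC_neq_0. simpl. lra.
    + apply rgamma_neq_0. now apply half_ne_pole.
  - intros n. unfold f. rewrite <- (even_coef_cI_rec (mu / RtoC 2)%C n). f_equal. f_equal.
    f_equal. field.
Qed.

Lemma Lambda_IF sg eta (G : R -> R -> CC) Lam : ladder sg eta ->
  (forall x t, 0 < x -> 0 < t < 1 -> G t x =
     Cmult (pref mu nu t) (Cmult (Itilde (Cdiv mu (RtoC 2)) (t * x / (1 - t))) (RtoC (eta 0%nat (x / (1 - t)))))) ->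
  is_Lambda 0 G Lam -> forall x (j : nat), 0 < x ->
  Lam (Z.of_nat j) x = Lc sg (fun i => eta i x) x f (expo mu nu) j.
Proof.
  intros Hl HG HL x j Hx.
  assert (H := Lambda_Lc sg eta (Itilde (Cdiv mu (RtoC 2))) f (expo mu nu) 0 G Lam (fun _ => 1) Hl (Itilde_expands _) HL).
  specialize (H ltac:(intros y t Hy Ht; rewrite HG by easy; unfold pref, expo; simpl; ring) x j Hx).
  change (Z.of_nat 0) with 0%Z in H. rewrite Z.sub_0_r in H. rewrite H. ring.
Qed.

Lemma Lambda_IF_zero sg eta (G : R -> R -> CC) Lam g v e a j : ladder sg eta ->
  (forall x t, 0 < x -> 0 < t < 1 -> G t x =
     Cmult (pref mu nu t) (Cmult (Itilde (Cdiv mu (RtoC 2)) (t * x / (1 - t))) (RtoC (eta 0%nat (x / (1 - t)))))) ->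
  is_Lambda 0 G Lam ->
  (forall m, lim0 (fun x => eta m x * / g x) (e m)) ->
  (forall m, sg * e (S m) = - (a + INR m) * e m) ->
  (forall x, 0 < x < 1 -> g x <> 0 /\ Cmod (v x) = Rabs (g x)) ->
  small_o_0 (fun x => Lam (Z.of_nat j) x - RtoC (g x) * (f O * (RtoC (e O) * pochf (expo mu nu - RtoC (2 * a)) j)))%C v.
Proof.
  intros Hl HG HL Hlim He Hv.
  apply (small_o_of_Clim0 _ _ g _ 1); [lra|exact Hv|].
  apply Clim0_ext with (3 := Lc_lim0 sg eta g e a Hlim He j f (expo mu nu)) (d := 1); [lra|].
  intros x Hx. now rewrite (Lambda_IF sg eta G Lam Hl HG HL) by lra.
Qed.

Lemma Lambda_IF_inf sg eta (G : R -> R -> CC) Lam ex c j : sg ^ 2 = 1 -> ladder sg eta ->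
  (forall x t, 0 < x -> 0 < t < 1 -> G t x =
     Cmult (pref mu nu t) (Cmult (Itilde (Cdiv mu (RtoC 2)) (t * x / (1 - t))) (RtoC (eta 0%nat (x / (1 - t)))))) ->
  is_Lambda 0 G Lam -> (forall x, 0 < ex x) -> 0 < c ->
  (forall m, Oinf (fun x => eta m x * / ((c * (Rpower x (- (nu / 2) - 1 / 2) * ex x)) * (x / 2) ^ m)) 1) ->
  exists C1 : CC, C1 <> RtoC 0 /\
    big_O_oo (fun x => Cminus (Cdiv (Lam (Z.of_nat j) x) (Cmult C1 (RtoC (Rpower x (INR j - (nu + 1) / 2) * ex x)))) (RtoC 1))
             (fun x => RtoC (/ x)).
Proof.
  intros Hsg Hl HG HL Hex Hc H.
  apply (big_O_of_COinf _ (fun x => Rpower x (INR j - (nu + 1) / 2) * ex x) c (gam sg f j)); auto.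
  - intros x _. apply weight_pos, Hex.
  - now apply gam_I_coef_neq_0.
  - apply COinf_ext with (2 := Lambda_inf sg eta ex nu c f (expo mu nu) j Hex H) (X := 0).
    intros x Hx. now rewrite (Lambda_IF sg eta G Lam Hl HG HL).
Qed.

End IFactor.

Section KFactor.

Variables (m : nat) (nu : R).

Let p := (2 * m + 1)%nat.
Let muR := INR (2 * m + 1).

Lemma muR_half : muR / 2 = INR m + 1 / 2.
Proof. unfold muR. rewrite plus_INR, mult_INR. simpl. field. Qed.

(** The coefficients of the regularised K-factor, bundled with the leading one in the shape in which
    the theorem states it. *)
Definition KF_coef (d : nat -> CC) : Prop :=
  d O = (RtoC (Rpower 2 (muR - 1)) * Gamma (RtoC (muR / 2)))%C /\
  forall n, expands (fun z => RtoC (Epole m z)) d n.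

Lemma KF_coef_exists : exists d, KF_coef d.
Proof.
  destruct (Epole_expands m) as [d Hd]. exists d. split; [|exact Hd].
  assert (H1 := expands_Clim0 _ _ (Hd 1%nat)). assert (H2 := Clim0_RtoC _ _ (Epole_lim0 m)).
  rewrite (Clim0_unique _ _ _ H1 H2). fold muR. rewrite muR_half.
  assert (Hm := pos_INR m). assert (Hr := rg_pos (INR m + 1 / 2) ltac:(lra)).
  rewrite gamma_real, <- RtoC_mult by lra. f_equal.
  unfold Rminus. rewrite Rpower_plus, Rpower_Ropp, Rpower_1 by lra. field. lra.
Qed.

Variables (sg : R) (eta : nat -> R -> R) (G : R -> R -> CC) (Lam : Z -> R -> CC) (d : nat -> CC).
Hypothesis (Hd : KF_coef d) (Hl : ladder sg eta).
Hypothesis (HG : forall x t, 0 < x -> 0 < t < 1 -> G t x =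
     Cmult (pref (RtoC muR) nu t) (RtoC (Ktilde (muR / 2) (t * x / (1 - t)) * eta 0%nat (x / (1 - t))))).
Hypothesis (HL : is_Lambda p G Lam).
Variables (j : Z) (Hj : (- Z.of_nat p <= j)%Z).

Let k := Z.to_nat (j + Z.of_nat p).
(** Clearing the pole writes [t^mu] as [x^(-mu) (1-t)^mu z^mu], and the power of [1 - t] lowers the
    exponent by [mu]; the result [(- mu + nu + 2)/2] is the base of the Pochhammer symbol for
    [i = 3]. *)
Let s := (expo (RtoC muR) nu - RtoC muR)%C.

Lemma Lambda_KF x : 0 < x -> Lam j x = (RtoC (Rpower x (- muR)) * Lc sg (fun i => eta i x) x d s k)%C.
Proof.
  intros Hx. replace j with (Z.of_nat k - Z.of_nat p)%Z by (unfold k; lia).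
  apply (Lambda_Lc sg eta (fun z => RtoC (Epole m z)) d _ p G Lam (fun x => Rpower x (- muR)) Hl (proj2 Hd) HL); [|easy].
  clear x Hx. intros x t Hx Ht. rewrite HG by easy. unfold Epole. rewrite <- muR_half.
  replace (- s)%C with (- expo (RtoC muR) nu + RtoC muR)%C by (unfold s; ring).
  rewrite Cpowpos_plus, Cpowpos_real. unfold pref. fold (expo (RtoC muR) nu).
  assert (Hz : 0 < t * x / (1 - t)) by (apply Rdiv_lt_0_compat; nra).
  assert (E : t ^ p = Rpower x (- muR) * (Rpower (1 - t) muR * (t * x / (1 - t)) ^ (2 * m + 1))).
  { fold p. unfold Rdiv. rewrite !Rpow_mult_distr, pow_inv. unfold muR. fold p.
    rewrite Rpower_Ropp, !Rpower_pow by lra. field. split; apply pow_nonzero; lra. }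
  rewrite E, !RtoC_mult. ring.
Qed.

Lemma Lambda_KF_zero g v e a :
  (forall i, lim0 (fun x => eta i x * / g x) (e i)) ->
  (forall i, sg * e (S i) = - (a + INR i) * e i) ->
  (forall x, 0 < x < 1 -> g x <> 0 /\ Cmod (v x) = Rabs (Rpower x (- muR) * g x)) ->
  small_o_0 (fun x => Lam j x - RtoC (Rpower x (- muR) * g x) *
    (d O * (RtoC (e O) * pochf (RtoC ((- muR + (nu - 4 * a) + 2) / 2)) k)))%C v.
Proof.
  intros Hlim He Hv.
  apply (small_o_of_Clim0 _ _ (fun x => Rpower x (- muR) * g x) _ 1); [lra| |].
  - intros x Hx. destruct (Hv x Hx) as [H1 H2]. split; [|easy].
    apply Rmult_integral_contrapositive_currified; [apply Rgt_not_eq, exp_pos|easy].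
  - replace (RtoC ((- muR + (nu - 4 * a) + 2) / 2)) with (s - RtoC (2 * a))%C.
    + apply Clim0_ext with (3 := Lc_lim0 sg eta g e a Hlim He k d s) (d := 1); [lra|].
      intros x Hx. rewrite Lambda_KF, Rinv_mult, RtoC_mult by lra.
      assert (E : (RtoC (Rpower x (- muR)) * RtoC (/ Rpower x (- muR)))%C = RtoC 1).
      { rewrite <- RtoC_mult. f_equal. apply Rinv_r, Rgt_not_eq, exp_pos. }
      match goal with |- (?l * ?i)%C = (?r * ?l * (?r' * ?i))%C => replace (r * l * (r' * i))%C with ((r * r') * (l * i))%C by ring end.
      rewrite E. ring.
    + unfold s, expo. rewrite <- RtoC_plus, <- RtoC_div, <- !RtoC_minus by lra. f_equal. field.
Qed.

Lemma Lambda_KF_inf ex c : (forall x, 0 < ex x) -> 0 < c ->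
  (forall i, Oinf (fun x => eta i x * / ((c * (Rpower x (- (nu / 2) - 1 / 2) * ex x)) * (x / 2) ^ i)) 1) ->
  big_O_oo (fun x => Lam j x) (fun x => RtoC (Rpower x (IZR j - (nu + 1) / 2) * ex x)).
Proof.
  intros Hex Hc H.
  apply (big_O_of_COinf_weak _ (fun x => Rpower x (IZR j - (nu + 1) / 2) * ex x) c (gam sg d k)); [|easy|].
  - intros x _. apply weight_pos, Hex.
  - apply COinf_ext with (2 := Lambda_inf sg eta ex nu c d s k Hex H) (X := 0).
    intros x Hx. rewrite Lambda_KF by easy.
    (* As [k = j + mu], the factor [x^(-mu)] brings the power [x^k] back to [x^j]. *)
    assert (Ek : INR k = IZR j + muR).
    { unfold muR. fold p. rewrite !INR_IZR_INZ, <- plus_IZR. f_equal. unfold k. lia. }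
    assert (E : Rpower x (INR k - (nu + 1) / 2) = Rpower x (IZR j - (nu + 1) / 2) * / Rpower x (- muR)).
    { rewrite <- Rpower_Ropp, <- Rpower_plus. f_equal. rewrite Ek. ring. }
    rewrite E.
    replace (/ (c * (Rpower x (IZR j - (nu + 1) / 2) * / Rpower x (- muR) * ex x))) with
      (Rpower x (- muR) * / (c * (Rpower x (IZR j - (nu + 1) / 2) * ex x))).
    + rewrite RtoC_mult. ring.
    + rewrite !Rinv_mult, Rinv_inv. ring.
Qed.

End KFactor.

Lemma etaK_lim0_pos_x nu m : 0 < nu ->
  lim0 (fun x => etaK (nu / 2) m x * / Rpower x (- nu)) (Rpower 2 nu * / (2 * rg (nu / 2 + INR m))).
Proof.
  intros Hnu.
  apply lim0_ext with (fun x => Rpower 2 nu * (etaK (nu / 2) m x * / Rpower (x / 2) (- (2 * (nu / 2))))) 1; [lra| |].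
  - intros x Hx. replace (- (2 * (nu / 2))) with (- nu) by field.
    assert (E : Rpower (x / 2) (- nu) = Rpower x (- nu) * Rpower 2 nu).
    { unfold Rpower. rewrite <- exp_plus. f_equal. rewrite ln_div by lra. ring. }
    rewrite E. field. split; apply Rgt_not_eq, exp_pos.
  - apply (lim0_mult (fun _ => _)); [apply lim0_const|]. apply etaK_lim0_pos. lra.
Qed.

Lemma ln_half_neg x : 0 < x < 1 -> ln (x / 2) < 0.
Proof. intros Hx. rewrite <- ln_1. apply ln_increasing; lra. Qed.

Lemma Rpower_2_sub a b : Rpower 2 (a - b) = Rpower 2 a * / Rpower 2 b.
Proof. unfold Rminus. now rewrite Rpower_plus, Rpower_Ropp. Qed.

Lemma Rpower_2_2 : Rpower 2 2 = 4.
Proof. replace 2 with (INR 2) at 2 by (simpl; ring). rewrite Rpower_pow by lra. simpl; ring. Qed.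

Theorem theorem4p1 (mu : CC) (nu : R)
  (hmu : forall n : nat, mu <> RtoC (- INR (S n))) :
  (* ===== i = 1, j >= 0 ===== *)
  (forall Lam : Z -> R -> CC, is_Lambda 0 (G1 mu nu) Lam ->
   forall j : nat,
     small_o_0
       (fun x => Cminus (Lam (Z.of_nat j) x)
          (Cmult (Cdiv (poch (Cdiv (Cplus mu (RtoC (nu + 2))) (RtoC 2)) j)
                       (RtoC (INR (fact j))))
                 (Cmult (rgamma (Cdiv (Cplus mu (RtoC 2)) (RtoC 2)))
                        (rgamma (RtoC ((nu + 2) / 2))))))
       (fun _ => RtoC 1)
   /\
     exists C1 : CC, C1 <> RtoC 0 /\
       big_O_oo
         (fun x => Cminus
            (Cdiv (Lam (Z.of_nat j) x)
                  (Cmult C1 (RtoC (Rpower x (INR j - (nu + 1) / 2) * exp x))))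
            (RtoC 1))
         (fun x => RtoC (/ x)))
  /\
  (* ===== i = 2, j >= 0 ===== *)
  (forall Lam : Z -> R -> CC, is_Lambda 0 (G2 mu nu) Lam ->
   forall j : nat,
     let c := Cmult (Cdiv (poch (Cdiv (Cplus mu (RtoC (- Rabs nu + 2))) (RtoC 2)) j)
                          (RtoC (INR (fact j))))
                    (rgamma (Cdiv (Cplus mu (RtoC 2)) (RtoC 2))) in
     (0 < nu ->
        small_o_0
          (fun x => Cminus (Lam (Z.of_nat j) x)
             (Cmult c (Cmult (Cmult (RtoC (Rpower 2 (nu - 1))) (Gamma (RtoC (nu / 2))))
                             (RtoC (Rpower x (- nu))))))
          (fun x => RtoC (Rpower x (- nu))))
   /\ (nu = 0 ->
        small_o_0
          (fun x => Cminus (Lam (Z.of_nat j) x) (Cmult c (RtoC (- ln (x / 2)))))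
          (fun x => RtoC (ln (x / 2))))
   /\ (nu < 0 ->
        small_o_0
          (fun x => Cminus (Lam (Z.of_nat j) x)
             (Cmult c (Cmult (RtoC (1 / 2)) (Gamma (RtoC (- nu / 2))))))
          (fun _ => RtoC 1))
   /\
     exists C2 : CC, C2 <> RtoC 0 /\
       big_O_oo
         (fun x => Cminus
            (Cdiv (Lam (Z.of_nat j) x)
                  (Cmult C2 (RtoC (Rpower x (INR j - (nu + 1) / 2) * exp (- x)))))
            (RtoC 1))
         (fun x => RtoC (/ x)))
  /\
  (* ===== i = 3, 4: mu a positive odd integer, j >= -mu ===== *)
  (forall m : nat, mu = RtoC (INR (2 * m + 1)) ->
   (forall Lam : Z -> R -> CC, is_Lambda (2 * m + 1) (G3 (INR (2 * m + 1)) nu) Lam ->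
    forall j : Z, (- Z.of_nat (2 * m + 1) <= j)%Z ->
      let k := Z.to_nat (j + Z.of_nat (2 * m + 1)) in
      let muR := INR (2 * m + 1) in
      small_o_0
        (fun x => Cminus (Lam j x)
           (Cmult
              (Cmult (Cmult (RtoC (Rpower 2 (muR - 1))) (Gamma (RtoC (muR / 2))))
                 (Cmult (Cdiv (poch (RtoC ((- muR + nu + 2) / 2)) k) (RtoC (INR (fact k))))
                        (rgamma (RtoC ((nu + 2) / 2)))))
              (RtoC (Rpower x (- muR)))))
        (fun x => RtoC (Rpower x (- muR)))
    /\
      big_O_oo (fun x => Lam j x)
               (fun x => RtoC (Rpower x (IZR j - (nu + 1) / 2) * exp x)))
   /\
   (forall Lam : Z -> R -> CC, is_Lambda (2 * m + 1) (G4 (INR (2 * m + 1)) nu) Lam ->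
    forall j : Z, (- Z.of_nat (2 * m + 1) <= j)%Z ->
      let k := Z.to_nat (j + Z.of_nat (2 * m + 1)) in
      let muR := INR (2 * m + 1) in
      let c := Cmult (Gamma (RtoC (muR / 2)))
                 (Cdiv (poch (RtoC ((- muR - Rabs nu + 2) / 2)) k) (RtoC (INR (fact k)))) in
      (0 < nu ->
         small_o_0
           (fun x => Cminus (Lam j x)
              (Cmult c (Cmult (Cmult (RtoC (Rpower 2 (muR + nu - 2))) (Gamma (RtoC (nu / 2))))
                              (RtoC (Rpower x (- muR - nu))))))
           (fun x => RtoC (Rpower x (- muR - nu))))
    /\ (nu = 0 ->
         small_o_0
           (fun x => Cminus (Lam j x)
              (Cmult c (RtoC (- Rpower 2 (muR - 1) * Rpower x (- muR) * ln (x / 2)))))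
           (fun x => RtoC (Rpower x (- muR) * ln (x / 2))))
    /\ (nu < 0 ->
         small_o_0
           (fun x => Cminus (Lam j x)
              (Cmult c (Cmult (Cmult (RtoC (Rpower 2 (muR - 2))) (Gamma (RtoC (- nu / 2))))
                              (RtoC (Rpower x (- muR))))))
           (fun x => RtoC (Rpower x (- muR))))
    /\
      big_O_oo (fun x => Lam j x)
               (fun x => RtoC (Rpower x (IZR j - (nu + 1) / 2) * exp (- x))))).
Proof.
  split; [|split].
  - intros Lam HL j.
    assert (HG : forall x t, 0 < x -> 0 < t < 1 -> G1 mu nu t x =
      Cmult (pref mu nu t) (Cmult (Itilde (Cdiv mu (RtoC 2)) (t * x / (1 - t))) (RtoC (etaI (nu / 2) 0 (x / (1 - t)))))).
    { intros x t _ _. unfold G1, etaI. rewrite Itilde_real. simpl. now rewrite Rmult_1_l, Rplus_0_r. }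
    split.
    (* For I the weight is 1 and [a = 0], so the base of the Pochhammer symbol stays
       [(mu + nu + 2)/2]. *)
    + assert (H := Lambda_IF_zero mu nu 1 (etaI (nu / 2)) (G1 mu nu) Lam (fun _ => 1) (fun _ => RtoC 1)
        (fun m => match m with O => rg (nu / 2 + 1) | S _ => 0 end) 0 j (etaI_ladder _) HG HL (etaI_lim0 _)).
      eapply small_o_0_ext with (d := 1); [lra| |reflexivity|apply H].
      * intros x Hx. cbv beta. rewrite I_coef_0, expo_shift. unfold pochf.
        replace (nu - 4 * 0 + 2) with (nu + 2) by ring. rewrite rgamma_real.
        replace ((nu + 2) / 2) with (nu / 2 + 1) by field. ring.
      * intros [|i]; simpl; ring.
      * intros x _. split; [lra|]. apply Cmod_R.
    + destruct (etaI_Oinf (nu / 2)) as [c [Hc H]].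
      apply (Lambda_IF_inf mu nu hmu 1 (etaI (nu / 2)) (G1 mu nu) Lam exp c j); auto using etaI_ladder, exp_pos. ring.
  - intros Lam HL j c.
    assert (HG : forall x t, 0 < x -> 0 < t < 1 -> G2 mu nu t x =
      Cmult (pref mu nu t) (Cmult (Itilde (Cdiv mu (RtoC 2)) (t * x / (1 - t))) (RtoC (etaK (nu / 2) 0 (x / (1 - t)))))).
    { intros x t _ _. unfold G2, etaK. simpl. now rewrite Rmult_1_l, Rplus_0_r. }
    assert (H := fun g v e a => Lambda_IF_zero mu nu (-1) (etaK (nu / 2)) (G2 mu nu) Lam g v e a j (etaK_ladder _) HG HL).
    split; [|split; [|split]].
    + intros Hnu.
      (* Here [a = nu/2], so the base [(mu + nu + 2)/2] drops by [nu]. *)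
      eapply small_o_0_ext with (d := 1); [lra| |reflexivity|
        apply (H (fun x => Rpower x (- nu)) (fun x => RtoC (Rpower x (- nu))) (fun m => Rpower 2 nu * / (2 * rg (nu / 2 + INR
          m))) (nu / 2))].
      * intros x Hx. cbv beta. rewrite I_coef_0, expo_shift. unfold c, pochf. rewrite Rabs_right by lra.
        replace (nu - 4 * (nu / 2) + 2) with (- nu + 2) by field. rewrite gamma_real by lra.
        simpl INR. rewrite Rplus_0_r, Rpower_2_sub, Rpower_1, Rinv_mult, !RtoC_mult by lra. ring.
      * intros m. now apply etaK_lim0_pos_x.
      (* The ladder relation is [Gamma(b + 1) = b Gamma(b)], stated for reciprocals. *)
      * intros i. rewrite S_INR, (rg_rec (nu / 2 + INR i)). assert (Hi := pos_INR i).
        replace (nu / 2 + (INR i + 1)) with (nu / 2 + INR i + 1) by ring.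
        assert (Hr := rg_pos (nu / 2 + INR i + 1) ltac:(lra)). field. lra.
      * intros x _. split; [apply Rgt_not_eq, exp_pos|apply Cmod_R].
    + intros Hnu.
      (* For [nu = 0] the logarithm takes the place of the power: [a = 0], and only level 0
         survives. *)
      eapply small_o_0_ext with (d := 1); [lra| |reflexivity|
        apply (H (fun x => - ln (x / 2)) (fun x => RtoC (ln (x / 2))) (fun m => match m with O => 1 | S _ => 0 end) 0)].
      * intros x Hx. cbv beta. rewrite I_coef_0, expo_shift. unfold c, pochf. rewrite Hnu, Rabs_R0.
        replace (0 - 4 * 0 + 2) with (- 0 + 2) by ring. ring.
      * intros m. replace (nu / 2) with 0 by lra. apply etaK_lim0_zero.
      * intros [|i]; simpl; ring.
      * intros x Hx. assert (Hl := ln_half_neg x Hx). split; [lra|]. rewrite Cmod_R, Rabs_Ropp. easy.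
    + intros Hnu.
      (* For negative [nu] the base is already [(mu - |nu| + 2)/2], so [a = 0]. *)
      eapply small_o_0_ext with (d := 1); [lra| |reflexivity|
        apply (H (fun _ => 1) (fun _ => RtoC 1) (fun m => match m with O => / (2 * rg (- (nu / 2))) | S _ => 0 end) 0)].
      * intros x Hx. cbv beta. rewrite I_coef_0, expo_shift. unfold c, pochf. rewrite Rabs_left by lra.
        replace (nu - 4 * 0 + 2) with (- - nu + 2) by ring. rewrite gamma_real by lra.
        replace (- nu / 2) with (- (nu / 2)) by field. replace (1 / 2) with (/ 2) by field.
        rewrite Rinv_mult, RtoC_mult. ring.
      * intros m. apply etaK_lim0_neg. lra.
      * intros [|i]; simpl; ring.
      * intros x _. split; [lra|]. apply Cmod_R.
    + destruct (etaK_Oinf (nu / 2)) as [k [Hk Hinf]].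
      apply (Lambda_IF_inf mu nu hmu (-1) (etaK (nu / 2)) (G2 mu nu) Lam (fun x => exp (- x)) k j); auto using etaK_ladder.
      * ring.
      * intros x. apply exp_pos.
  - intros m _. destruct (KF_coef_exists m) as [d Hd]. split.
    + intros Lam HL j Hj k muR.
      assert (HG : forall x t, 0 < x -> 0 < t < 1 -> G3 muR nu t x =
        Cmult (pref (RtoC muR) nu t) (RtoC (Ktilde (muR / 2) (t * x / (1 - t)) * etaI (nu / 2) 0 (x / (1 - t))))).
      { intros x t _ _. unfold G3, etaI. rewrite Itilde_real, RtoC_mult. simpl. now rewrite Rmult_1_l, Rplus_0_r. }
      split.
      * eapply small_o_0_ext with (d := 1); [lra| |reflexivity|
          apply (Lambda_KF_zero m nu 1 (etaI (nu / 2)) (G3 muR nu) Lam d Hd (etaI_ladder _) HG HL j Hj (fun _ => 1)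
            (fun x => RtoC (Rpower x (- muR))) (fun m => match m with O => rg (nu / 2 + 1) | S _ => 0 end) 0 (etaI_lim0 _))].
        -- intros x Hx. cbv beta. rewrite (proj1 Hd). unfold pochf. fold muR k.
           replace (- muR + (nu - 4 * 0) + 2) with (- muR + nu + 2) by ring. rewrite rgamma_real.
           replace ((nu + 2) / 2) with (nu / 2 + 1) by field. rewrite Rmult_1_r. ring.
        -- intros [|i]; simpl; ring.
        -- intros x _. split; [lra|]. rewrite Rmult_1_r. apply Cmod_R.
      * destruct (etaI_Oinf (nu / 2)) as [c [Hc H]].
        apply (Lambda_KF_inf m nu 1 (etaI (nu / 2)) (G3 muR nu) Lam d Hd (etaI_ladder _) HG HL j Hj exp c exp_pos Hc H).
    + intros Lam HL j Hj k muR c.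
      assert (HG : forall x t, 0 < x -> 0 < t < 1 -> G4 muR nu t x =
        Cmult (pref (RtoC muR) nu t) (RtoC (Ktilde (muR / 2) (t * x / (1 - t)) * etaK (nu / 2) 0 (x / (1 - t))))).
      { intros x t _ _. unfold G4, etaK. simpl. now rewrite Rmult_1_l, Rplus_0_r. }
      assert (H := Lambda_KF_zero m nu (-1) (etaK (nu / 2)) (G4 muR nu) Lam d Hd (etaK_ladder _) HG HL j Hj).
      split; [|split; [|split]].
      * intros Hnu.
        eapply small_o_0_ext with (d := 1); [lra| |reflexivity|
          apply (H (fun x => Rpower x (- nu)) (fun x => RtoC (Rpower x (- muR - nu))) (fun m => Rpower 2 nu * / (2 * rg (nu / 2 +
            INR m))) (nu / 2))].
        -- intros x Hx. cbv beta. rewrite (proj1 Hd). unfold c, pochf. fold muR k. rewrite Rabs_right by lra.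
           replace (- muR + (nu - 4 * (nu / 2)) + 2) with (- muR - nu + 2) by field. rewrite (gamma_real (nu / 2)) by lra.
           (* The power [2^(mu + nu - 2)] collects [2^(mu-1)] from the factor of order [mu/2] and
              [2^nu / 2] from the one of order [nu/2]. *)
           simpl (INR 0). rewrite Rplus_0_r, !Rpower_2_sub, Rpower_plus, Rpower_2_2, Rpower_1 by lra.
           unfold Rminus. rewrite Rpower_plus. replace (/ 4) with (/ 2 * / 2) by field. rewrite Rinv_mult, !RtoC_mult. ring.
        -- intros i. now apply etaK_lim0_pos_x.
        -- intros i. rewrite S_INR, (rg_rec (nu / 2 + INR i)). assert (Hi := pos_INR i).
           replace (nu / 2 + (INR i + 1)) with (nu / 2 + INR i + 1) by ring.
           assert (Hr := rg_pos (nu / 2 + INR i + 1) ltac:(lra)). field. lra.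
        -- intros x _. split; [apply Rgt_not_eq, exp_pos|]. rewrite Cmod_R. unfold Rminus. now rewrite Rpower_plus.
      * intros Hnu.
        eapply small_o_0_ext with (d := 1); [lra| |reflexivity|
          apply (H (fun x => - ln (x / 2)) (fun x => RtoC (Rpower x (- muR) * ln (x / 2))) (fun m => match m with O => 1 | S _ =>
            0 end) 0)].
        -- intros x Hx. cbv beta. rewrite (proj1 Hd). unfold c, pochf. fold muR k. rewrite Hnu, Rabs_R0.
           replace (- muR + (0 - 4 * 0) + 2) with (- muR - 0 + 2) by ring.
           replace (- Rpower 2 (muR - 1) * Rpower x (- muR) * ln (x / 2)) with (Rpower 2 (muR - 1) * (Rpower x (- muR) * - ln (x
             / 2))) by ring.
           rewrite (RtoC_mult (Rpower 2 (muR - 1))). ring.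
        -- intros i. replace (nu / 2) with 0 by lra. apply etaK_lim0_zero.
        -- intros [|i]; simpl; ring.
        -- intros x Hx. assert (Hl := ln_half_neg x Hx). split; [lra|].
           rewrite Cmod_R, <- Rabs_Ropp. f_equal. unfold muR. ring.
      * intros Hnu.
        eapply small_o_0_ext with (d := 1); [lra| |reflexivity|
          apply (H (fun _ => 1) (fun x => RtoC (Rpower x (- muR))) (fun m => match m with O => / (2 * rg (- (nu / 2))) | S _ => 0 end) 0)].
        -- intros x Hx. cbv beta. rewrite (proj1 Hd). unfold c, pochf. fold muR k. rewrite Rabs_left by lra.
           replace (- muR + (nu - 4 * 0) + 2) with (- muR - - nu + 2) by ring. rewrite (gamma_real (- nu / 2)) by lra.
           replace (- nu / 2) with (- (nu / 2)) by field.
           rewrite !Rpower_2_sub, Rpower_2_2, Rpower_1, Rmult_1_r by lra.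
           replace (/ 4) with (/ 2 * / 2) by field. rewrite Rinv_mult, !RtoC_mult. ring.
        -- intros i. apply etaK_lim0_neg. lra.
        -- intros [|i]; simpl; ring.
        -- intros x _. split; [lra|]. rewrite Rmult_1_r. apply Cmod_R.
      * destruct (etaK_Oinf (nu / 2)) as [c0 [Hc H0]].
        apply (Lambda_KF_inf m nu (-1) (etaK (nu / 2)) (G4 muR nu) Lam d Hd (etaK_ladder _) HG HL j Hj (fun x => exp (- x)) c0
          (fun x => exp_pos (- x)) Hc H0).
Qed.
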